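(* Let $d \geq 1$ and let $n_1,\dots,n_d \geq 1$ be $d$ distinct positive integers such that $q-1$ does not divide $n_i$ for each $i$ and $n_i/n_j$ is not an integral power of $p$ for each $i \neq j$. For each $i$ take $\alpha_i \in K^\times$ with $|\alpha_i|_\infty < |\theta|_\infty^{n_i q/(q-1)}$. Then the set $$\{\tilde{\pi}\} \cup \{\operatorname{Li}_{n_\ell, n_{\ell+1},\dots,n_k}(\alpha_\ell, \alpha_{\ell+1},\dots,\alpha_k) \mid 1 \leq \ell \leq k \leq d\}$$ has cardinality $1 + \frac{d(d+1)}{2}$, and its elements are algebraically independent over $\overline{K}$.
   Context: Let $\mathbb{F}_q$ be the finite field with $q$ elements, $p$ its characteristic, $K = \mathbb{F}_q(\theta)$, $K_\infty = \mathbb{F}_q((\theta^{-1}))$ with absolute value $|\cdot|_\infty$ ($|\theta|_\infty>1$), $\mathbb{C}_\infty$ the completion of an algebraic closure of $K_\infty$, and $\overline{K}$ the algebraic closure of $K$ in $\mathbb{C}_\infty$. Fixing a $(q-1)$-st root of $-\theta$, $\tilde{\pi} = (-\theta)^{q/(q-1)} \prod_{i=1}^\infty (1-\theta^{1-q^i})^{-1}$. For positive integers $m_1,\dots,m_s$, the Carlitz multiple polylogarithm is $$\operatorname{Li}_{m_1,\dots,m_s}(z_1,\dots,z_s) = \sum_{i_1 > \cdots > i_s \geq 0} \frac{z_1^{q^{i_1}} \cdots z_s^{q^{i_s}}}{L_{i_1}^{m_1}\cdots L_{i_s}^{m_s}},\quad L_0=1,\ L_i = (\theta-\theta^q)(\theta-\theta^{q^2})\cdots(\theta-\theta^{q^i}),$$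 which converges when $|z_k|_\infty < |\theta|_\infty^{m_k q/(q-1)}$ for each $k$. *)

(* Defs.v *)
From HB Require Import structures.
From mathcomp Require Import all_boot all_order all_algebra.
From mathcomp Require Import reals.
From mathcomp Require Import mpoly.
From Stdlib Require Import ClassicalEpsilon.

Set Implicit Arguments.
Unset Strict Implicit.
Unset Printing Implicit Defensive.

Import Order.TTheory GRing.Theory Num.Theory.
Local Open Scope ring_scope.

Section CarlitzDefs.
Variables (R : realType) (L : fieldType) (abs : L -> R).

Definition is_lim (u : nat -> L) (v : L) : Prop :=
  forall eps : R, 0 < eps -> exists N : nat, forall m : nat, (N <= m)%N ->
    abs (u m - v) < eps.

Definition cauchy_seq (u : nat -> L) : Prop :=
  forall eps : R, 0 < eps -> exists N : nat, forall m k : nat,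
    (N <= m)%N -> (N <= k)%N -> abs (u m - u k) < eps.

(** The limit of u (meaningful when it exists; limits are unique since
    abs is definite). *)
Definition lim (u : nat -> L) : L := epsilon (inhabits 0) (is_lim u).

Variables (q : nat) (theta : L).

Definition inFq (c : L) : Prop := c ^+ q = c.

Definition polyOverFq (f : {poly L}) : Prop := forall i : nat, inFq f`_i.

Definition inK (x : L) : Prop :=
  exists f g : {poly L}, [/\ polyOverFq f, polyOverFq g, g.[theta] != 0
                          & x = f.[theta] / g.[theta]].

Definition inKbar (x : L) : Prop :=
  exists P : {poly L}, [/\ P != 0, forall i : nat, inK P`_i & root P x].

Definition alg_indep_Kbar (I : finType) (f : I -> L) : Prop :=
  forall P : {mpoly L[#|I|]},
    (forall m, inKbar (P@_m)) ->
    P.@[fun j : 'I_#|I| => f (enum_val j)] = 0 -> P = 0.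

Definition carlitzL (i : nat) : L :=
  \prod_(1 <= j < i.+1) (theta - theta ^+ (q ^ j)).

(** Partial sums of the Carlitz multiple polylogarithm:
    Li_partial [:: (m1,z1); ...; (ms,zs)] N
      = sum_{N > i1 > ... > is >= 0} z1^{q^i1}...zs^{q^is}/(L_i1^m1...L_is^ms). *)
Fixpoint Li_partial (s : seq (nat * L)) (N : nat) : L :=
  match s with
  | [::] => 1
  | (m, z) :: s' =>
      \sum_(i < N) (z ^+ (q ^ i) / (carlitzL i) ^+ m) * Li_partial s' i
  end.

Definition Li (s : seq (nat * L)) : L := lim (Li_partial s).

(** tilde pi = (-theta)^{q/(q-1)} prod_{i>=1} (1 - theta^{1-q^i})^{-1},
    where xi is the fixed (q-1)-st root of -theta, so (-theta)^{q/(q-1)} = xi^q. *)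
Definition pitilde (xi : L) : L :=
  xi ^+ q * lim (fun N => \prod_(1 <= i < N.+1)
                           (1 - theta ^- (q ^ i - 1))^-1).

End CarlitzDefs.

(* Main.v *)
(** Let sigma be the Frobenius twist of functions of t, (sigma f)(t) = f(t^(1/q))^q. The entire
    function Omega(t) = xi^(-q) prod_(i >= 1) (1 - t/theta^(q^i)) satisfies
    Omega = (t - theta^q) sigma Omega and Omega(theta) = 1 / pi tilde, and the deformation
    S_(l,k)(t) = sum_(i_l > ... > i_k >= 0) prod_j sigma^(i_j)(alpha_j Omega^(n_j)) satisfies
    S_(l,k) = sigma S_(l,k) + alpha_k Omega^(n_k) sigma S_(l,k-1), its value at theta being
    Li_(n_l,...,n_k)(alpha_l,...,alpha_k) times a power of Omega(theta).

    Values: if entire functions g_i satisfy g = M sigma g with M over F_q[theta][t], then a linear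
    relation over F_q[theta] between the g_i(theta) forces a linear relation between the g_i with
    polynomial coefficients. Indeed sigma^(-k) moves the relation to the points theta^(1/q^k);
    Siegel's lemma yields a form h.g vanishing at many of them, hence very small by Schwarz's
    lemma; and a nonzero such form is bounded below, because finitely many of its twists are
    linearly dependent. Applied to the monomials in 1/Omega and in the quotients
    F_(l,k) = S_(l,k) / Omega^(n_l+...+n_k), this reduces the theorem to the algebraic
    independence of these functions over polynomials in t.

    Functions: a minimal algebraic relation is, up to factors in L[t], invariant under the
    substitution describing sigma. Removing the variables one at a time by means of Hasse
    derivatives, such a relation can only be a monomial in 1/Omega, unless one of the equations
    f sigma P = sigma f (t - theta^q)^(n_k p^j) (P + alpha_k^(p^j) f) has a polynomial solution.
    This is excluded by the size of P at the points theta^(1/q^k), since q - 1 does not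
    divide n_k. *)

Require Import Defs.
From HB Require Import structures.
From mathcomp Require Import all_boot all_order all_algebra separable.
From mathcomp Require Import reals.
From mathcomp Require Import mpoly.
From mathcomp Require Import ring lra zify.

Set Implicit Arguments.
Unset Strict Implicit.
Unset Printing Implicit Defensive.

Import Order.TTheory GRing.Theory Num.Theory.
Local Open Scope ring_scope.

(** * The ground field and its Frobenius *)

Record setting := Setting {
  sR : realType; sp : nat; se : nat;
  sp_prime : prime sp; se_gt0 : (0 < se)%N;
  sL : closedFieldType;
  sL_pchar : sp \in [pchar sL];
  sabs : sL -> sR;
  sabs_ge0 : forall x, 0 <= sabs x;
  sabs_eq0 : forall x, sabs x = 0 <-> x = 0;
  sabsM : forall x y, sabs (x * y) = sabs x * sabs y;
  sabsD : forall x y, sabs (x + y) <= Num.max (sabs x) (sabs y);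
  scomplete : forall u : nat -> sL, cauchy_seq sabs u -> exists v, is_lim sabs u v;
  stheta : sL;
  sabs_theta : 1 < sabs stheta;
  sxi : sL;
  sxiE : sxi ^+ (sp ^ se - 1) = - stheta }.

Definition sq (S : setting) := (sp S ^ se S)%N.

Definition frob (S : setting) (x : sL S) : sL S := x ^+ sq S.

Section Frob.
Variable S : setting.
Local Notation L := (sL S).
Local Notation q := (sq S).

Lemma q_gt1 : (1 < q)%N.
Proof.
rewrite /sq; apply: (leq_trans (prime_gt1 (sp_prime S))).
by rewrite -{1}(expn1 (sp S)) leq_exp2l ?prime_gt1 ?sp_prime// se_gt0.
Qed.

Lemma q_gt0 : (0 < q)%N. Proof. exact: ltnW q_gt1. Qed.

Lemma q_pnat : [pchar L].-nat q.
Proof.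
rewrite /sq pnatX; apply/orP; left.
by rewrite (eq_pnat _ (pcharf_eq (sL_pchar S))) pnat_id // sp_prime.
Qed.

Lemma frob_is_zmod_morphism : zmod_morphism (@frob S).
Proof.
move=> x y; rewrite /frob exprDn_pchar ?q_pnat //; congr (_ + _).
by rewrite exprNn_pchar ?q_pnat.
Qed.

Lemma frob_is_monoid_morphism : monoid_morphism (@frob S).
Proof. by split=> [|x y]; rewrite /frob ?expr1n ?exprMn. Qed.

HB.instance Definition _ := GRing.isZmodMorphism.Build L L (@frob S) frob_is_zmod_morphism.
HB.instance Definition _ := GRing.isMonoidMorphism.Build L L (@frob S) frob_is_monoid_morphism.

Lemma frobE (x : L) : frob x = x ^+ q. Proof. by []. Qed.

Lemma frob_inj : injective (@frob S).
Proof. exact: fmorph_inj. Qed.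

Lemma frob_surj (x : L) : exists y, frob y == x.
Proof.
have [y yE] := @solve_monicpoly L q (fun i => if i == 0%N then x else 0) q_gt0.
exists y; apply/eqP; rewrite frobE yE.
move: q_gt0; case: (q) => // k _; rewrite big_ord_recl /= expr0 mulr1 big1 ?addr0 //.
by move=> i _; rewrite mul0r.
Qed.

Definition frobV (x : L) : L := xchoose (frob_surj x).

Lemma frobVK : cancel frobV (@frob S).
Proof. by move=> x; apply/eqP; exact: xchooseP (frob_surj x). Qed.

Lemma frobK : cancel (@frob S) frobV.
Proof. by move=> x; apply: frob_inj; rewrite frobVK. Qed.

Lemma frobV_is_zmod_morphism : zmod_morphism frobV.
Proof. by move=> x y; apply: frob_inj; rewrite rmorphB /= !frobVK. Qed.

Lemma frobV_is_monoid_morphism : monoid_morphism frobV.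
Proof.
by split=> [|x y]; apply: frob_inj; rewrite ?rmorphM ?rmorph1 /= !frobVK ?rmorph1.
Qed.

HB.instance Definition _ := GRing.isZmodMorphism.Build L L frobV frobV_is_zmod_morphism.
HB.instance Definition _ := GRing.isMonoidMorphism.Build L L frobV frobV_is_monoid_morphism.

Lemma iter_frobE k (x : L) : iter k (@frob S) x = x ^+ (q ^ k).
Proof.
elim: k => [|k IH]; first by rewrite expn0 expr1.
by rewrite iterS IH frobE -exprM expnSr.
Qed.

End Frob.

Section Abs.
Variable S : setting.
Local Notation L := (sL S).
Local Notation abs := (@sabs S).
Local Notation q := (sq S).
Implicit Types x y : L.

Lemma abs_ge0 x : 0 <= abs x. Proof. exact: sabs_ge0. Qed.

Lemma abs0 : abs 0 = 0. Proof. exact/sabs_eq0. Qed.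

Lemma abs_eq0 x : (abs x == 0) = (x == 0).
Proof. by apply/eqP/eqP => /sabs_eq0. Qed.

Lemma abs_gt0 x : (0 < abs x) = (x != 0).
Proof. by rewrite lt_def abs_ge0 andbT abs_eq0. Qed.

Lemma absM x y : abs (x * y) = abs x * abs y. Proof. exact: sabsM. Qed.

Lemma abs1 : abs 1 = 1.
Proof.
have h : abs 1 != 0 by rewrite abs_eq0 oner_eq0.
by apply: (mulfI h); rewrite -absM !mulr1.
Qed.

Lemma absX x k : abs (x ^+ k) = abs x ^+ k.
Proof. by elim: k => [|k IH]; rewrite ?expr0 ?abs1 // !exprS absM IH. Qed.

Lemma absV x : abs x^-1 = (abs x)^-1.
Proof.
have [->|x0] := eqVneq x 0; first by rewrite invr0 abs0 invr0.
have h : abs x != 0 by rewrite abs_eq0.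
by apply: (mulfI h); rewrite -absM !mulfV // abs1.
Qed.

Lemma abs_div x y : abs (x / y) = abs x / abs y.
Proof. by rewrite absM absV. Qed.

Lemma absN x : abs (- x) = abs x.
Proof.
have h : abs (-1) = 1.
  have : abs (-1) ^+ 2 = 1 by rewrite -absX sqrrN expr1n abs1.
  move/eqP; rewrite sqrf_eq1 => /orP[] /eqP // h.
  by have := abs_ge0 (-1); rewrite h; lra.
by rewrite -mulN1r absM h mul1r.
Qed.

Lemma absD x y B : abs x <= B -> abs y <= B -> abs (x + y) <= B.
Proof. by move=> hx hy; apply: le_trans (sabsD _ _) _; rewrite ge_max hx hy. Qed.

Lemma absB x y B : abs x <= B -> abs y <= B -> abs (x - y) <= B.
Proof. by move=> hx hy; apply: absD; rewrite ?absN. Qed.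

Lemma absD_lt x y B : abs x < B -> abs y < B -> abs (x + y) < B.
Proof. by move=> hx hy; apply: le_lt_trans (sabsD _ _) _; rewrite gt_max hx hy. Qed.

Lemma absB_lt x y B : abs x < B -> abs y < B -> abs (x - y) < B.
Proof. by move=> hx hy; apply: absD_lt; rewrite ?absN. Qed.

Lemma absDl x y : abs y < abs x -> abs (x + y) = abs x.
Proof.
move=> h; apply/eqP; rewrite eq_le; apply/andP; split.
  by apply: absD => //; exact: ltW.
rewrite leNgt; apply/negP => h2.
have : abs (x + y - y) < abs x by apply: absB_lt.
by rewrite addrK ltxx.
Qed.

Lemma absDr x y : abs x < abs y -> abs (x + y) = abs y.
Proof. by move=> h; rewrite addrC absDl. Qed.

Lemma abs_sum I (r : seq I) (P : pred I) (F : I -> L) B : 0 <= B ->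
  (forall i, P i -> abs (F i) <= B) -> abs (\sum_(i <- r | P i) F i) <= B.
Proof.
by move=> B0 h; elim/big_ind: _ => //; [rewrite abs0 | move=> *; apply: absD].
Qed.

Lemma abs_prod I (r : seq I) (P : pred I) (F : I -> L) :
  abs (\prod_(i <- r | P i) F i) = \prod_(i <- r | P i) abs (F i).
Proof. exact: (big_morph _ absM abs1). Qed.

Lemma abs_frob x : abs (frob x) = abs x ^+ q. Proof. exact: absX. Qed.

Lemma abs_frobV x : abs (frobV x) ^+ q = abs x.
Proof. by rewrite -abs_frob frobVK. Qed.

Lemma abs_frobV_le x B : 1 <= B -> abs x <= B -> abs (frobV x) <= B.
Proof.
move=> B1 h; rewrite leNgt; apply/negP => h2.
have : abs (frobV x) <= abs (frobV x) ^+ q.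
  by rewrite ler_eXnr ?q_gt0 //; apply: le_trans B1 (ltW h2).
by rewrite abs_frobV => h3; have := le_lt_trans h (lt_le_trans h2 h3); rewrite ltxx.
Qed.

End Abs.

(** * Uniform limits of polynomials on discs *)

Section Analytic.
Variable S : setting.
Local Notation L := (sL S).
Local Notation R := (sR S).
Local Notation abs := (@sabs S).
Local Notation q := (sq S).

Lemma abs_root_unity m (x : L) : iter m (@frob S) x = x -> x != 0 -> (0 < m)%N -> abs x = 1.
Proof.
rewrite iter_frobE => xE x0 m0.
have Q1 : (1 < q ^ m)%N.
  apply: leq_trans (q_gt1 S) _; rewrite -{1}(expn1 q) leq_exp2l ?q_gt1 //.
have /(congr1 abs) := xE; rewrite absX -{1}(prednK (ltnW Q1)) exprS.
rewrite -[RHS]mulr1; have ax0 : abs x != 0 by rewrite abs_eq0.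
move/(mulfI ax0)/eqP; rewrite pexpr_eq1 ?abs_ge0 //; last by lia.
by move/eqP.
Qed.

(* The nodes are the nonzero elements of the field with [q ^ s.+1] elements. *)
Lemma unit_nodes s : exists zs : seq L, [/\ (s <= size zs)%N, uniq zs,
  forall z, z \in zs -> abs z = 1 &
  forall y z, y \in zs -> z \in zs -> y != z -> abs (y - z) = 1].
Proof.
pose m := s.+1; pose Q := (q ^ m)%N.
have Qs : (s < Q)%N by apply: leq_trans (ltnW (ltn_expl m (q_gt1 S))).
have Q1 : (1 < Q)%N.
  by apply: leq_trans (q_gt1 S) _; rewrite -{1}(expn1 q) leq_exp2l ?q_gt1.
pose P : {poly L} := 'X^Q - 'X.
have sP : size P = Q.+1 by rewrite size_polyDl size_polyXn ?size_polyN ?size_polyX.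
have [r rE] := closed_field_poly_normal P.
have lP : lead_coef P = 1.
  by rewrite lead_coefE sP /= coefB coefXn eqxx coefX gtn_eqF ?subr0.
rewrite lP scale1r in rE.
have ur : uniq r.
  rewrite -separable_prod_XsubC -rE separable_poly.unlock.
  rewrite derivB derivXn derivX.
  have -> : 'X^(Q.-1) *+ Q = 0 :> {poly L}.
    apply/polyP => i; rewrite coefMn coef0 -mulr_natr.
    suff -> : Q%:R = 0 :> L by rewrite mulr0.
    apply/eqP; rewrite -(dvdn_pcharf (sL_pchar S)) /Q /sq -expnM.
    by rewrite dvdn_exp // muln_gt0 se_gt0.
  by rewrite sub0r -scaleN1r coprimepZr ?coprimep1 // oppr_eq0 oner_eq0.
have szr : size r = Q.
  by have := congr1 (fun P : {poly L} => size P) rE; rewrite size_prod_XsubC sP => -[].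
have fr z : z \in r -> iter m (@frob S) z = z.
  rewrite -root_prod_XsubC -rE rootE !hornerE iter_frobE subr_eq0 => /eqP //.
have r0 : 0 \in r.
  by rewrite -root_prod_XsubC -rE rootE !hornerE expr0n /= (gtn_eqF (ltnW Q1)) subr0.
exists (rem 0 r); split.
- by rewrite size_rem // szr; lia.
- exact: rem_uniq.
- move=> z; rewrite mem_rem_uniq // inE => /andP[z0 zr].
  exact: (abs_root_unity (fr _ zr)).
- move=> y z /mem_rem yr /mem_rem zr yz; apply: (@abs_root_unity m).
  + rewrite iter_frobE; have := fr _ yr; have := fr _ zr; rewrite !iter_frobE => {2}<- {2}<-.
    by rewrite -!iter_frobE; elim: (m) => [|k IH] //=; rewrite IH rmorphB.
  + by rewrite subr_eq0.
  + by [].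
Qed.

Lemma bound_on_nodes (rho : R) (zs : seq L) (P : {poly L}) (B : R) :
  0 < rho -> 0 <= B -> (size P <= size zs)%N -> uniq zs ->
  (forall z, z \in zs -> abs z <= rho) ->
  (forall y z, y \in zs -> z \in zs -> y != z -> abs (y - z) = rho) ->
  (forall z, z \in zs -> abs P.[z] <= B) ->
  forall s, abs s <= rho -> abs P.[s] <= B.
Proof.
move=> rho0; elim: zs P B => [|z0 zs IH] P B B0 /= szP uz hz hd hP s hs.
  by move: szP; rewrite leqn0 size_poly_eq0 => /eqP->; rewrite horner0 abs0.
have /andP[z0zs uzs] := uz.
have : root (P - P.[z0]%:P) z0 by rewrite rootE !hornerE subrr.
move/factor_theorem => [Q QE].
have PE t : P.[t] = P.[z0] + Q.[t] * (t - z0).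
  have := congr1 (fun P : {poly L} => P.[t]) QE; rewrite !hornerE => <-.
  by rewrite addrC subrK.
have szQ : (size Q <= size zs)%N.
  have [->|Q0] := eqVneq Q 0; first by rewrite size_poly0.
  have : (size (P - P.[z0]%:P)%R <= (size zs).+1)%N.
    apply: leq_trans (size_polyD _ _) _; rewrite size_polyN geq_max szP /=.
    by apply: leq_trans (size_polyC_leq1 _) _.
  by rewrite QE size_Mmonic ?monicXsubC // size_XsubC addn2 /= ltnS.
have Bz : abs P.[z0] <= B by apply: hP; rewrite mem_head.
rewrite PE; apply: absD => //.
have -> : B = (B / rho) * rho by rewrite divfK ?gt_eqF.
rewrite absM; apply: ler_pM; rewrite ?abs_ge0 //; last first.
  by apply: absB => //; apply: hz; rewrite mem_head.
apply: (IH Q) => //.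
- by rewrite divr_ge0 // ltW.
- by move=> z h; apply: hz; rewrite inE h orbT.
- by move=> y z h1 h2; apply: hd; rewrite inE ?h1 ?h2 orbT.
- move=> z h; have zz0 : z != z0 by apply: contraNneq z0zs => <-.
  rewrite ler_pdivlMr // -(hd z z0) ?inE ?h ?orbT ?eqxx // -absM.
  have -> : Q.[z] * (z - z0) = P.[z] - P.[z0] by rewrite (PE z) [RHS]addrC addKr.
  by apply: absB => //; apply: hP; rewrite inE h orbT.
Qed.

Lemma max_principle (r : L) (P : {poly L}) (B : R) : r != 0 ->
  (forall s, abs s = abs r -> abs P.[s] <= B) ->
  forall s, abs s <= abs r -> abs P.[s] <= B.
Proof.
move=> r0 h.
have [zs [szs uzs z1 zd]] := unit_nodes (size P).
have B0 : 0 <= B by apply: le_trans (h r _); rewrite ?abs_ge0.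
apply: (@bound_on_nodes (abs r) [seq r * z | z <- zs]); rewrite ?abs_gt0 ?size_map //.
- by rewrite map_inj_uniq //; apply: mulfI.
- by move=> _ /mapP[z hz ->]; rewrite absM (z1 z) // mulr1.
- move=> _ _ /mapP[y hy ->] /mapP[z hz ->] yz.
  rewrite -mulrBr absM zd ?mulr1 //; by apply: contraNneq yz => ->.
- by move=> _ /mapP[z hz ->]; apply: h; rewrite absM (z1 z) // mulr1.
Qed.

Definition quo_at (P : {poly L}) (z : L) := (P - P.[z]%:P) %/ ('X - z%:P).

Lemma quo_atE P z t : P.[t] = P.[z] + (t - z) * (quo_at P z).[t].
Proof.
have : ('X - z%:P) %| P - P.[z]%:P by rewrite dvdp_XsubCl rootE !hornerE subrr.
move/divpK => /(congr1 (fun P : {poly L} => P.[t])); rewrite !hornerE -/(quo_at P z) => h.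
by rewrite mulrC h addrC subrK.
Qed.

Lemma quo_at_bound (r : L) P z B : r != 0 -> abs z <= abs r ->
  (forall s, abs s <= abs r -> abs P.[s] <= B) ->
  forall s, abs s <= abs r -> abs (quo_at P z).[s] <= B / abs r.
Proof.
move=> r0 hz h s hs.
have -> : (quo_at P z).[s] = (quo_at P z \Po ('X + z%:P)).[s - z].
  by rewrite horner_comp !hornerE subrK.
apply: (max_principle r0) => [t tr|]; last exact: absB.
rewrite horner_comp !hornerE ler_pdivlMr ?abs_gt0 // -tr -absM.
have := quo_atE P z (t + z); rewrite addrK => /(canLR (addKr _)).
rewrite [t * _]mulrC => <-; rewrite addrC; apply: absB; apply: h => //.
by apply: absD => //; rewrite tr.
Qed.

Lemma quo_atB P P' z : quo_at (P - P') z = quo_at P z - quo_at P' z.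
Proof.
by rewrite /quo_at !hornerE polyCB opprD addrACA -opprD divpD divpN.
Qed.

Definition analytic (rho B : R) (f : L -> L) : Prop :=
  (forall t, abs t <= rho -> abs (f t) <= B) /\
  forall eps : R, 0 < eps -> exists P : {poly L},
    forall t, abs t <= rho -> abs (f t - P.[t]) <= eps.

Lemma analytic_bound rho B f : analytic rho B f ->
  forall t, abs t <= rho -> abs (f t) <= B.
Proof. by case. Qed.

Lemma analytic_poly rho B (P : {poly L}) :
  (forall t, abs t <= rho -> abs P.[t] <= B) -> analytic rho B (fun t => P.[t]).
Proof.
by move=> h; split=> // eps e0; exists P => t _; rewrite subrr abs0 ltW.
Qed.

Lemma analytic_ext rho B f g : (forall t, abs t <= rho -> f t = g t) ->
  analytic rho B f -> analytic rho B g.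
Proof.
move=> h [h1 h2]; split=> [t ht|eps e0]; first by rewrite -h // h1.
by have [P hP] := h2 _ e0; exists P => t ht; rewrite -h // hP.
Qed.

Lemma analyticW rho B B' f : B <= B' -> analytic rho B f -> analytic rho B' f.
Proof. by move=> h [h1 h2]; split=> // t ht; apply: le_trans (h1 _ ht) h. Qed.

Lemma analyticD rho B f g : analytic rho B f -> analytic rho B g ->
  analytic rho B (fun t => f t + g t).
Proof.
move=> [f1 f2] [g1 g2]; split=> [t ht|eps e0]; first by apply: absD; auto.
have [P hP] := f2 _ e0; have [Q hQ] := g2 _ e0; exists (P + Q) => t ht.
by rewrite hornerD opprD addrACA; apply: absD; auto.
Qed.

Lemma analyticM rho B B' f g : analytic rho B f -> analytic rho B' g ->
  analytic rho (B * B') (fun t => f t * g t).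
Proof.
move=> [f1 f2] [g1 g2]; split=> [t ht|eps e0].
  by rewrite absM ler_pM ?abs_ge0; auto.
pose C := Num.max (Num.max B B') 1.
have C0 : 0 < C by rewrite lt_max ltr01 orbT.
have CB : B <= C by rewrite !le_max lexx.
have CB' : B' <= C by rewrite !le_max lexx orbT.
have [P hP] := f2 (Num.min eps C / C) ltac:(by rewrite divr_gt0 // lt_min e0).
have [Q hQ] := g2 (Num.min eps C / C) ltac:(by rewrite divr_gt0 // lt_min e0).
have e1 : Num.min eps C / C <= 1 by rewrite ler_pdivrMr // mul1r ge_min lexx orbT.
exists (P * Q) => t ht; rewrite hornerM.
have -> : f t * g t - P.[t] * Q.[t] = (f t - P.[t]) * g t + P.[t] * (g t - Q.[t]) by ring.
have C1 : 1 <= C by rewrite le_max lexx orbT.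
apply: absD; rewrite absM; apply: le_trans (_ : (Num.min eps C / C) * C <= _).
- by apply: ler_pM; rewrite ?abs_ge0 ?hP //; apply: le_trans (g1 _ ht) CB'.
- by rewrite divfK ?gt_eqF // ge_min lexx.
- rewrite mulrC; apply: ler_pM; rewrite ?abs_ge0 ?hQ //.
  have -> : P.[t] = f t - (f t - P.[t]) by ring.
  apply: absB; first by apply: le_trans (f1 _ ht) CB.
  by apply: le_trans (hP _ ht) (le_trans e1 C1).
- by rewrite divfK ?gt_eqF // ge_min lexx.
Qed.

Lemma analyticX rho B f k : 0 <= B -> analytic rho B f ->
  analytic rho (B ^+ k) (fun t => f t ^+ k).
Proof.
move=> B0 hf; elim: k => [|k IH].
  apply: (@analytic_ext _ _ (fun t => (1 : {poly L}).[t])) => [t _|].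
    by rewrite hornerE expr0.
  by apply: analytic_poly => t _; rewrite hornerE abs1 expr0.
apply: (@analytic_ext _ _ (fun t => f t * f t ^+ k)) => [t _|]; first by rewrite exprS.
by rewrite exprS; apply: analyticM.
Qed.

Lemma analytic_cst rho (c : L) : analytic rho (abs c) (fun=> c).
Proof.
apply: (@analytic_ext _ _ (fun t => c%:P.[t])) => [t _|]; first by rewrite hornerE.
by apply: analytic_poly => t _; rewrite hornerE.
Qed.

Lemma analytic_sum rho B I (r : seq I) (P : pred I) (f : I -> L -> L) : 0 <= B ->
  (forall i, P i -> analytic rho B (f i)) ->
  analytic rho B (fun t => \sum_(i <- r | P i) f i t).
Proof.
move=> B0 h; elim: r => [|i r IH].
  apply: (@analytic_ext _ _ (fun=> 0)) => [t _|]; first by rewrite big_nil.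
  by apply: analyticW (analytic_cst rho 0); rewrite abs0.
apply: (@analytic_ext _ _ (fun t => if P i then f i t + \sum_(j <- r | P j) f j t
   else \sum_(j <- r | P j) f j t)) => [t _|]; first by rewrite big_cons.
by case Pi: (P i) => //; apply: analyticD => //; apply: h.
Qed.

Lemma lim_unique (u : nat -> L) x y : is_lim abs u x -> is_lim abs u y -> x = y.
Proof.
move=> hx hy; apply/eqP; rewrite -subr_eq0 -abs_eq0 eq_le abs_ge0 andbT leNgt.
apply/negP => h; have [N1 h1] := hx _ h; have [N2 h2] := hy _ h.
have := absB_lt (h1 (maxn N1 N2) (leq_maxl _ _)) (h2 (maxn N1 N2) (leq_maxr _ _)).
by rewrite opprB addrC addrA subrK -[X in abs X < _]opprB absN ltxx.
Qed.

Lemma lim_le (u : nat -> L) x B N :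
  (forall m, (N <= m)%N -> abs (u m) <= B) -> is_lim abs u x -> abs x <= B.
Proof.
move=> h hx; rewrite leNgt; apply/negP => hB.
have B0 : 0 <= B by apply: le_trans (h N _); rewrite ?abs_ge0.
have [N1 h1] := hx _ (le_lt_trans B0 hB).
have := absDl (x := x) (y := u (maxn N N1) - x) (h1 _ (leq_maxr _ _)).
rewrite addrC subrK => e; have := h _ (leq_maxl N N1).
by rewrite e leNgt hB.
Qed.

Lemma limP (u : nat -> L) x : is_lim abs u x <->
  forall eps : R, 0 < eps -> exists N, forall m, (N <= m)%N -> abs (u m - x) <= eps.
Proof.
split=> h eps e0; have [N hN] := h _ e0.
  by exists N => m /hN /ltW.
have [N' hN'] := h (eps / 2) ltac:(lra).
by exists N' => m /hN' h'; apply: le_lt_trans h' _; lra.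
Qed.

Lemma uniform_limit rho B (f : nat -> L -> L) (g : L -> L) :
  (forall n, analytic rho B (f n)) ->
  (forall eps : R, 0 < eps -> exists N, forall m k, (N <= m)%N -> (N <= k)%N ->
     forall t, abs t <= rho -> abs (f m t - f k t) <= eps) ->
  (forall t, abs t <= rho -> is_lim abs (f^~ t) (g t)) ->
  analytic rho B g.
Proof.
move=> hf hu hl; split=> [t ht|eps e0].
  by apply: (lim_le (N := 0)) (hl _ ht) => m _; apply: analytic_bound (hf m) _ ht.
have [N hN] := hu _ e0; have [P hP] := (hf N).2 _ e0; exists P => t ht.
have -> : g t - P.[t] = (g t - f N t) + (f N t - P.[t]) by ring.
apply: absD; last exact: hP.
apply: (@lim_le (fun k => f k t - f N t) _ _ N) => [m hm|]; first exact: hN.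
move=> e he; have [N' h'] := hl _ ht _ he; exists N' => m /h'.
by rewrite opprB addrA subrK.
Qed.

Lemma analytic_div (r : L) B f z : r != 0 -> 0 < B -> abs z <= abs r ->
  analytic (abs r) B f -> f z = 0 ->
  exists g, analytic (abs r) (B / abs r) g /\
    forall t, abs t <= abs r -> f t = (t - z) * g t.
Proof.
move=> r0 B0 hz [f1 f2] fz.
have r1 : 0 < abs r by rewrite abs_gt0.
pose e k : R := B / k.+1%:R.
have e0 k : 0 < e k by rewrite divr_gt0 ?ltr0n.
have /ClassicalEpsilon.choice[P hP] :
    forall k, exists Pk : {poly L}, forall t, abs t <= abs r -> abs (f t - Pk.[t]) <= e k.
  by move=> k; apply: f2.
have mono m k : (m <= k)%N -> e k <= e m.
  by move=> h; rewrite ler_pM2l // lef_pV2 ?posrE ?ltr0n // ler_nat ltnS.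
have eB k : e k <= B by have := mono 0%N k (leq0n _); rewrite /e divr1.
have esmall (eps : R) : 0 < eps -> exists N, e N <= eps.
  move=> eps0; exists (Num.truncn (B / eps)); rewrite /e ler_pdivrMr ?ltr0n // mulrC.
  by rewrite -ler_pdivrMr // ltW // truncnS_gt.
pose Q k := quo_at (P k) z.
have dQ m k : (m <= k)%N -> forall t, abs t <= abs r -> abs ((Q m).[t] - (Q k).[t]) <= e m / abs r.
  move=> mk t ht; rewrite -hornerN -hornerD -quo_atB; apply: quo_at_bound => // s hs.
  rewrite !hornerE.
  have -> : (P m).[s] - (P k).[s] = (f s - (P k).[s]) - (f s - (P m).[s]) by ring.
  by apply: absB; [apply: le_trans (mono _ _ mk)|]; apply: hP.
have [c hc] : exists c, is_lim abs (fun k => (Q k).[z]) c.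
  apply: scomplete => eps eps0.
  have [N hN] := esmall (eps / 2 * abs r) ltac:(by rewrite mulr_gt0 ?divr_gt0).
  have aux m : (N <= m)%N -> abs ((Q N).[z] - (Q m).[z]) < eps.
    move=> hm; apply: le_lt_trans (dQ _ _ hm _ hz) _.
    by rewrite ltr_pdivrMr //; apply: le_lt_trans hN _; rewrite ltr_pM2r //; lra.
  exists N => m k hm hk.
  have -> : (Q m).[z] - (Q k).[z] = ((Q N).[z] - (Q k).[z]) - ((Q N).[z] - (Q m).[z]) by ring.
  by apply: absB_lt; apply: aux.
pose g t := if t == z then c else f t / (t - z).
have gE t : f t = (t - z) * g t.
  rewrite /g; case: eqP => [->|/eqP tz]; first by rewrite fz subrr mul0r.
  by rewrite mulrC divfK // subr_eq0.
have glim t : abs t <= abs r -> is_lim abs (fun k => (Q k).[t]) (g t).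
  move=> ht; rewrite /g; case: eqP => [->//|/eqP tz].
  apply/limP => eps eps0.
  have tz0 : 0 < abs (t - z) by rewrite abs_gt0 subr_eq0.
  have [N hN] := esmall (eps * abs (t - z)) ltac:(by rewrite mulr_gt0).
  exists N => m hm.
  have -> : (Q m).[t] - f t / (t - z) = ((0 - (P m).[z]) - (f t - (P m).[t])) / (t - z).
    by rewrite (quo_atE (P m) z t) -/(Q m); field; rewrite subr_eq0.
  rewrite abs_div ler_pdivrMr //; apply: le_trans hN.
  apply: le_trans (mono _ _ hm); apply: absB; last exact: hP.
  by rewrite -fz; apply: hP.
exists g; split=> //; apply: (@uniform_limit _ _ (fun k t => (Q k).[t])) => // [k|eps eps0].
  apply: analytic_poly => t; apply: quo_at_bound => // s hs.
  have -> : (P k).[s] = f s - (f s - (P k).[s]) by ring.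
  by apply: absB; [apply: f1 | apply: le_trans (hP _ _ hs) (eB k)].
have [N hN] := esmall (eps * abs r) ltac:(by rewrite mulr_gt0).
have aux m : (N <= m)%N -> forall t, abs t <= abs r -> abs ((Q N).[t] - (Q m).[t]) <= eps.
  by move=> hm t ht; apply: le_trans (dQ _ _ hm _ ht) _; rewrite ler_pdivrMr.
exists N => m k hm hk t ht.
have -> : (Q m).[t] - (Q k).[t] = ((Q N).[t] - (Q k).[t]) - ((Q N).[t] - (Q m).[t]) by ring.
by apply: absB; apply: aux.
Qed.

End Analytic.

(** * Schwarz's lemma *)

Lemma expr_unbounded (R : realType) (x B : R) : 1 < x -> exists k, B < x ^+ k.
Proof.
move=> x1; have d1 : 0 < x - 1 by rewrite subr_gt0.
pose K := (Num.truncn (B / (x - 1))).+1; exists K.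
have hK : B < K%:R * (x - 1) by rewrite -ltr_pdivrMr // truncnS_gt.
apply: lt_trans hK _; elim: K => [|k IH]; first by rewrite mul0r expr0 ltr01.
rewrite exprS -natr1 mulrDl mul1r.
have : 1 <= x ^+ k by rewrite exprn_ege1 // ltW.
by nra.
Qed.

Section Schwarz.
Variable S : setting.
Local Notation L := (sL S).
Local Notation R := (sR S).
Local Notation abs := (@sabs S).

Lemma analytic_div_seq (r : L) B f zs : r != 0 -> 0 < B -> uniq zs ->
  (forall z, z \in zs -> abs z <= abs r /\ f z = 0) -> analytic (abs r) B f ->
  exists g, analytic (abs r) (B / abs r ^+ size zs) g /\
    forall t, abs t <= abs r -> f t = (\prod_(z <- zs) (t - z)) * g t.
Proof.
move=> r0; elim: zs B f => [|z zs IH] B f B0 uz hz hf.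
  by exists f; split=> [|t _]; rewrite ?expr0 ?divr1 // big_nil mul1r.
have r1 : 0 < abs r by rewrite abs_gt0.
have [zr fz] := hz z (mem_head _ _).
have [g [hg gE]] := analytic_div r0 B0 zr hf fz.
have /andP[zzs uzs] : (z \notin zs) && uniq zs by [].
have [h [hh hE]] : exists h, analytic (abs r) (B / abs r / abs r ^+ size zs) h /\
    forall t, abs t <= abs r -> g t = (\prod_(z <- zs) (t - z)) * h t.
  apply: IH => //; first by rewrite divr_gt0.
  move=> y hy; have [yr fy] := hz y (mem_behead (s := z :: zs) hy); split=> //.
  apply/eqP; move: fy; rewrite gE // => /eqP; rewrite mulf_eq0 subr_eq0 => /orP[/eqP yz|//].
  by move: zzs; rewrite -yz hy.
exists h; split=> [|t ht].
  by move: hh; rewrite -mulrA -invfM -exprS.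
by rewrite gE // hE // big_cons mulrA.
Qed.

Lemma analytic_order (r : L) B f t0 : 1 < abs r -> 0 < B ->
  analytic (abs r) B f -> abs t0 <= 1 -> f t0 != 0 ->
  exists nu g, [/\ analytic (abs r) (B / abs r ^+ nu) g,
    forall t, abs t <= abs r -> f t = t ^+ nu * g t & g 0 != 0].
Proof.
move=> r1 B0 hf ht0 f0.
have r0 : 0 < abs r by apply: lt_trans r1.
have rn0 : r != 0 by rewrite -abs_gt0.
have ht0r : abs t0 <= abs r by apply: le_trans ht0 (ltW r1).
have [K] : exists K, B / abs r ^+ K < abs (f t0).
  have [K hK] := expr_unbounded (B / abs (f t0)) r1; exists K.
  by rewrite ltr_pdivrMr ?exprn_gt0 // mulrC -ltr_pdivrMr // abs_gt0.
elim: K B f B0 hf f0 => [|K IH] B f B0 hf f0.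
  by rewrite expr0 divr1 ltNge (analytic_bound hf).
move=> hK; have [f00|f00] := eqVneq (f 0) 0; last first.
  exists 0%N, f; split=> // [|t _]; rewrite expr0 ?mul1r ?divr1 //.
have e1 : abs (0 : L) <= abs r by rewrite abs0 ltW.
have [g [hg gE]] := analytic_div rn0 B0 e1 hf f00.
have g0 : g t0 != 0.
  by apply: contraNneq f0 => e; rewrite gE // e mulr0.
have [|nu [h [hh hE h0]]] := IH (B / abs r) g ltac:(by rewrite divr_gt0) hg g0.
  rewrite -mulrA -invfM -exprS; apply: lt_le_trans hK _.
  rewrite gE // subr0 absM -[leRHS]mul1r ler_pM ?abs_ge0 //.
exists nu.+1, h; split=> // [|t ht].
  by move: hh; rewrite -mulrA -invfM -exprS.
by rewrite gE // subr0 hE // exprS mulrA.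
Qed.

(* The factor [t ^+ nu] is split off first, so that the conclusion bounds the lowest Taylor
   coefficient [h 0] of [f]. *)
Lemma schwarz_lemma (r : L) B f zs t0 : 1 < abs r -> 0 < B ->
  analytic (abs r) B f -> abs t0 <= 1 -> f t0 != 0 -> uniq zs ->
  (forall z, z \in zs -> [/\ z != 0, abs z <= abs r & f z = 0]) ->
  exists nu h B', [/\ analytic (abs r) B' h,
    forall t, abs t <= abs r -> f t = t ^+ nu * h t, h 0 != 0 &
    abs (h 0) * abs r ^+ size zs <= B * \prod_(z <- zs) abs z].
Proof.
move=> r1 B0 hf ht0 f0 uz hz.
have r0 : 0 < abs r by apply: lt_trans r1.
have rn0 : r != 0 by rewrite -abs_gt0.
have [nu [h [hh hE h0]]] := analytic_order r1 B0 hf ht0 f0.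
have B'0 : 0 < B / abs r ^+ nu by rewrite divr_gt0 // exprn_gt0.
exists nu, h, (B / abs r ^+ nu); split=> //.
have [|g [hg gE]] := analytic_div_seq rn0 B'0 uz _ hh.
  move=> z /hz[z0 zr fz]; split=> //; apply/eqP; move: fz; rewrite hE // => /eqP.
  by rewrite mulf_eq0 expf_eq0 (negPf z0) andbF.
have e0 : abs (0 : L) <= abs r by rewrite abs0 ltW.
rewrite gE // absM abs_prod.
have -> : \prod_(i <- zs) abs (0 - i) = \prod_(i <- zs) abs i.
  by apply: eq_bigr => i _; rewrite sub0r absN.
rewrite -mulrA mulrC; apply: ler_wpM2r.
  by rewrite prodr_ge0 // => i _; rewrite abs_ge0.
rewrite -ler_pdivlMr ?exprn_gt0 //.
apply: le_trans (analytic_bound hg e0) _.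
rewrite ler_pM2r ?invr_gt0 ?exprn_gt0 // ler_pdivrMr ?exprn_gt0 //.
by rewrite ler_peMr ?(ltW B0) // exprn_ege1 // ltW.
Qed.

Definition continuous0 (f : L -> L) := forall eps : R, 0 < eps ->
  exists2 d : R, 0 < d & forall t, abs t <= d -> abs (f t - f 0) <= eps.

Lemma continuous0_analytic (r : L) B f : r != 0 -> analytic (abs r) B f -> continuous0 f.
Proof.
move=> r0 hf eps e0; have r1 : 0 < abs r by rewrite abs_gt0.
pose B' := Num.max 1 B.
have e1 : abs (0 : L) <= abs r by rewrite abs0 ltW.
have B0 : 0 < B' by rewrite lt_max ltr01.
have hg : analytic (abs r) B' (fun t => f t + - f 0).
  apply: analyticD; first by apply: analyticW hf; rewrite le_max lexx orbT.
  apply: analyticW (analytic_cst _ (- f 0)); rewrite absN.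
  by apply: le_trans (analytic_bound hf e1) _; rewrite le_max lexx orbT.
have [g [h1 h2]] := analytic_div r0 B0 e1 hg (subrr _).
exists (Num.min (abs r) (eps * abs r / B')).
  by rewrite lt_min r1 divr_gt0 ?mulr_gt0.
move=> t; rewrite le_min => /andP[tr tb]; rewrite h2 // subr0 absM.
have -> : eps = (eps * abs r / B') * (B' / abs r) by field; rewrite !gt_eqF.
by apply: ler_pM; rewrite ?abs_ge0 //; apply: analytic_bound h1 _ tr.
Qed.

Lemma continuous0_poly (P : {poly L}) : continuous0 (fun t => P.[t]).
Proof.
have h1 : (1 : L) != 0 by rewrite oner_eq0.
apply: (@continuous0_analytic 1 (\sum_(i < size P) abs P`_i)) => //.
apply: analytic_poly => t; rewrite abs1 => t1; rewrite horner_coef.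
apply: abs_sum => [|i _]; first by apply: sumr_ge0 => i _; rewrite abs_ge0.
rewrite absM absX; apply: le_trans (_ : abs P`_i <= _).
  by rewrite ler_piMr ?abs_ge0 // exprn_ile1 ?abs_ge0.
by rewrite (bigD1 i) //= lerDl sumr_ge0 // => j _; rewrite abs_ge0.
Qed.

Lemma continuous0D f g : continuous0 f -> continuous0 g -> continuous0 (fun t => f t + g t).
Proof.
move=> hf hg eps e0; have [d1 d10 h1] := hf _ e0; have [d2 d20 h2] := hg _ e0.
exists (Num.min d1 d2); rewrite ?lt_min ?d10 // => t; rewrite le_min => /andP[t1 t2].
by rewrite opprD addrACA; apply: absD; auto.
Qed.

Lemma continuous0M f g : continuous0 f -> continuous0 g -> continuous0 (fun t => f t * g t).
Proof.
move=> hf hg eps e0.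
pose C := 1 + abs (f 0) + abs (g 0).
have C1 : 0 < C by rewrite /C; have := abs_ge0 (f 0); have := abs_ge0 (g 0); lra.
pose e := Num.min 1 (eps / C).
have e1 : 0 < e by rewrite lt_min ltr01 divr_gt0.
have eC : e * C <= eps by rewrite -ler_pdivlMr // ge_min lexx orbT.
have [d1 d10 h1] := hf _ e1; have [d2 d20 h2] := hg _ e1.
exists (Num.min d1 d2); rewrite ?lt_min ?d10 // => t; rewrite le_min => /andP[t1 t2].
have -> : f t * g t - f 0 * g 0 = (f t - f 0) * g t + f 0 * (g t - g 0) by ring.
apply: absD; rewrite absM; apply: le_trans eC.
  apply: ler_pM; rewrite ?abs_ge0 ?h1 //.
  have -> : g t = (g t - g 0) + g 0 by ring.
  have := abs_ge0 (f 0); have := abs_ge0 (g 0) => g0 f0; apply: absD.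
    apply: le_trans (h2 _ t2) _; apply: le_trans (_ : 1 <= _); rewrite /C ?ge_min ?lexx //.
    by lra.
  by rewrite /C; lra.
rewrite mulrC; apply: ler_pM; rewrite ?abs_ge0 ?h2 //.
by rewrite /C; have := abs_ge0 (f 0); have := abs_ge0 (g 0); lra.
Qed.

Lemma continuous0_sum I (r : seq I) (f : I -> L -> L) :
  (forall i, continuous0 (f i)) -> continuous0 (fun t => \sum_(i <- r) f i t).
Proof.
move=> h; elim: r => [|i r IH] eps e0.
  by exists 1 => // t _; rewrite !big_nil subrr abs0 ltW.
have [d d0 hd] := continuous0D (h i) IH e0.
by exists d => // t ht; rewrite !big_cons; apply: hd.
Qed.

Lemma continuous0X f k : continuous0 f -> continuous0 (fun t => f t ^+ k).
Proof.
move=> hf; elim: k => [|k IH] eps e0.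
  by exists 1 => // t _; rewrite !expr0 subrr abs0 ltW.
have [d d0 hd] := continuous0M hf IH e0.
by exists d => // t ht; rewrite !exprS; apply: hd.
Qed.

Lemma continuous0_compX f k : (0 < k)%N -> continuous0 f -> continuous0 (fun t => f (t ^+ k)).
Proof.
move=> k0 hf eps e0; have [d d0 hd] := hf _ e0.
exists (Num.min 1 d); rewrite ?lt_min ?ltr01 // => t; rewrite le_min => /andP[t1 td].
rewrite expr0n (gtn_eqF k0); apply: hd; rewrite absX; apply: le_trans td.
by rewrite ler_iXnr ?abs_ge0.
Qed.

Lemma continuous0_eq0 f (d : R) : 0 < d -> continuous0 f ->
  (forall t, t != 0 -> abs t <= d -> f t = 0) -> f 0 = 0.
Proof.
move=> d0 hf h; apply/eqP; rewrite -abs_eq0 eq_le abs_ge0 andbT leNgt; apply/negP => f0.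
have [d' d'0 h'] := hf (abs (f 0) / 2) ltac:(lra).
have [t t0 td] : exists2 t : L, t != 0 & abs t <= Num.min d d'.
  have th := sabs_theta S.
  have th0 : 0 < abs (stheta S) by apply: lt_trans th.
  have m0 : 0 < Num.min d d' by rewrite lt_min d0.
  have [K /ltW hK] := expr_unbounded (Num.min d d')^-1 th.
  exists ((stheta S) ^- K); first by rewrite invr_eq0 expf_neq0 // -abs_gt0.
  by rewrite absV absX invf_ple ?posrE ?exprn_gt0.
move: td; rewrite le_min => /andP[td td'].
have := h' _ td'; rewrite h // sub0r absN; lra.
Qed.

End Schwarz.

(** * Siegel's lemma *)

Section Siegel.
Variable S : setting.
Local Notation L := (sL S).
Local Notation abs := (@sabs S).
Local Notation q := (sq S).
Local Notation overFq := (@polyOverFq (sL S) q).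
Implicit Types f g : {poly L}.

Lemma overFqP f : overFq f <-> map_poly (@frob S) f = f.
Proof.
split=> [h|h i]; first by apply/polyP => i; rewrite coef_map /= frobE h.
by rewrite /inFq -frobE -[RHS](congr1 (fun f : {poly L} => f`_i) h) coef_map.
Qed.

Lemma overFqD f g : overFq f -> overFq g -> overFq (f + g).
Proof. by move=> /overFqP hf /overFqP hg; apply/overFqP; rewrite rmorphD /= hf hg. Qed.

Lemma overFqN f : overFq f -> overFq (- f).
Proof. by move=> /overFqP hf; apply/overFqP; rewrite rmorphN /= hf. Qed.

Lemma overFqB f g : overFq f -> overFq g -> overFq (f - g).
Proof. by move=> hf hg; apply: overFqD => //; apply: overFqN. Qed.

Lemma overFqM f g : overFq f -> overFq g -> overFq (f * g).
Proof. by move=> /overFqP hf /overFqP hg; apply/overFqP; rewrite rmorphM /= hf hg. Qed.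

Lemma overFq0 : overFq 0. Proof. by apply/overFqP; rewrite rmorph0. Qed.
Lemma overFq1 : overFq 1. Proof. by apply/overFqP; rewrite rmorph1. Qed.
Lemma overFqXn k : overFq 'X^k. Proof. by apply/overFqP; rewrite map_polyXn. Qed.

Lemma overFq_sum I (r : seq I) (P : pred I) (F : I -> {poly L}) :
  (forall i, P i -> overFq (F i)) -> overFq (\sum_(i <- r | P i) F i).
Proof. by move=> h; elim/big_ind: _ => //; [apply: overFq0 | apply: overFqD]. Qed.

Lemma overFq_comp f g : overFq f -> overFq g -> overFq (f \Po g).
Proof. by move=> /overFqP hf /overFqP hg; apply/overFqP; rewrite map_comp_poly /= hf hg. Qed.

Lemma frob_horner f x : frob f.[x] = (map_poly (@frob S) f).[frob x].
Proof. by rewrite horner_map. Qed.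

Lemma overFq_frob f x : overFq f -> frob f.[x] = f.[frob x].
Proof. by move=> /overFqP hf; rewrite frob_horner hf. Qed.

Lemma overFq_frobV f x : overFq f -> frobV f.[x] = f.[frobV x].
Proof. by move=> hf; apply: frob_inj; rewrite overFq_frob // !frobVK. Qed.

Lemma abs_Fq (c : L) : inFq q c -> c != 0 -> abs c = 1.
Proof. by move=> h c0; apply: (@abs_root_unity S 1) => //=; rewrite frobE. Qed.

Lemma abs_overFq f u : overFq f -> 1 < abs u -> f != 0 ->
  abs f.[u] = abs u ^+ (size f).-1.
Proof.
move=> hf u1 f0.
have sf : (0 < size f)%N by rewrite size_poly_gt0.
have u0 : 0 < abs u by apply: lt_trans u1.
rewrite horner_coef; case sfk: (size f) sf => [//|k] _.
have lc : abs (f`_k * u ^+ k) = abs u ^+ k.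
  rewrite absM absX abs_Fq ?mul1r //.
  by have := f0; rewrite -lead_coef_eq0 lead_coefE sfk.
rewrite big_ord_recr /= -lc; apply: absDr.
case: k sfk lc => [|k] sfk lc.
  by rewrite big_ord0 abs0 lc expr0 ltr01.
apply: le_lt_trans (_ : abs u ^+ k < _); last first.
  by rewrite lc exprS ltr_pMl ?exprn_gt0.
apply: abs_sum => [|i _]; first by rewrite exprn_ge0 // ltW.
rewrite absM absX; have [->|c0] := eqVneq f`_i 0.
  by rewrite abs0 mul0r exprn_ge0 // ltW.
by rewrite abs_Fq // mul1r ler_weXn2l ?(ltW u1) // -ltnS.
Qed.

Lemma abs_overFq_ge1 f u : overFq f -> 1 < abs u -> f != 0 -> 1 <= abs f.[u].
Proof. by move=> hf u1 f0; rewrite abs_overFq // exprn_ege1 // ltW. Qed.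

Lemma overFq_root f u : overFq f -> 1 < abs u -> f.[u] = 0 -> f = 0.
Proof.
move=> hf u1 h; apply/eqP/negPn/negP => f0.
by have := abs_overFq_ge1 hf u1 f0; rewrite h abs0 ler10.
Qed.

Lemma abs_overFq_le f u k : overFq f -> 1 < abs u -> (size f <= k.+1)%N ->
  abs f.[u] <= abs u ^+ k.
Proof.
move=> hf u1 szf; have [->|f0] := eqVneq f 0.
  by rewrite horner0 abs0 exprn_ge0 // ltW // (lt_trans _ u1).
rewrite abs_overFq // ler_weXn2l ?(ltW u1) //.
by rewrite -ltnS (leq_trans _ szf) // prednK // size_poly_gt0.
Qed.

(* Counting F_q-coefficients suffices, although the linear system is solved over L: the kernel
   of a matrix with Frobenius-invariant entries has a Frobenius-invariant basis. *)
Lemma siegel (E U : finType) (s m : nat) (a : E -> U -> {poly L}) :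
  (forall i j, overFq (a i j)) -> (forall i j, (size (a i j) <= s.+1)%N) ->
  (#|E| * (m + s) < #|U| * m)%N ->
  exists x : U -> {poly L}, [/\ forall j, overFq (x j),
    forall j, (size (x j) <= m)%N, exists j, x j != 0 &
    forall i, \sum_j a i j * x j = 0].
Proof.
move=> ha sa; case: m => [|m] hcount; first by rewrite muln0 in hcount.
pose RT := (U * 'I_m.+1)%type; pose CT := (E * 'I_(m.+1 + s))%type.
pose A : 'M[L]_(#|{: RT}|, #|{: CT}|) := \matrix_(r, c)
  let jb : U * 'I_m.+1 := enum_val r in
  let ik : E * 'I_(m.+1 + s) := enum_val c in
  (a ik.1 jb.1 * 'X^(jb.2))`_(ik.2).
have Af : map_mx (@frob S) A = A.
  apply/matrixP => r c; rewrite !mxE /= frobE.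
  by apply: (overFqM (ha _ _) (overFqXn _)).
have kf : map_mx (@frob S) (kermx A) = kermx A by rewrite map_kermx Af.
have k0 : kermx A != 0.
  apply/negP => /eqP k0; have : \rank (kermx A) = 0%N by rewrite k0 mxrank0.
  rewrite mxrank_ker => /eqP; rewrite subn_eq0 leqNgt => /negP; apply.
  apply: leq_ltn_trans (rank_leq_col A) _.
  by rewrite !card_prod !card_ord.
have [i iN] : exists i, row i (kermx A) != 0.
  by apply/existsP; rewrite -negb_forall; apply: contraNN k0 => /forallP h;
     apply/eqP/row_matrixP => i; rewrite row0; apply/eqP.
pose v := row i (kermx A).
have vA : v *m A = 0 by rewrite -row_mul mulmx_ker row0.
pose x j := \poly_(b < m.+1) v 0 (enum_rank ((j, inord b) : RT)).
have xE j : x j = \sum_(b < m.+1) v 0 (enum_rank ((j, b) : RT)) *: 'X^b.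
  by rewrite /x poly_def; apply: eq_bigr => b _; rewrite inord_val.
exists x; split.
- move=> j k; rewrite coef_poly; case: ifP => _; last by rewrite /inFq -frobE rmorph0.
  by rewrite /inFq -frobE mxE; have := congr1 (fun M : 'M_(_, _) => M i (enum_rank ((j, inord k) : RT))) kf;
     rewrite mxE.
- by move=> j; apply: size_poly.
- have [r vr] : exists r, v 0 r != 0.
    apply/existsP; rewrite -negb_forall; apply: contraNN iN => /forallP h.
    by apply/eqP/rowP => r; rewrite [RHS]mxE; apply/eqP.
  pose jb : U * 'I_m.+1 := enum_val r; exists jb.1; apply: contraNneq vr => /(congr1 (fun f : {poly L} => f`_jb.2)).
  rewrite coef_poly coef0 ltn_ord inord_val => <-.
  by rewrite -surjective_pairing enum_valK.
- move=> e; apply/polyP => k; rewrite coef0.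
  have [ks|ks] := ltnP k (m.+1 + s); last first.
    apply: nth_default; apply: leq_trans ks.
    apply: leq_trans (size_sum _ _ _) _; apply/bigmax_leqP => j _.
    apply: leq_trans (size_polyMleq _ _) _.
    have := sa e j; have : (size (x j) <= m.+1)%N by apply: size_poly.
    by move: (size _) (size _) => n1 n2; lia.
  pose c : 'I_#|{: CT}| := enum_rank ((e, Ordinal ks) : CT).
  have vA' : \sum_r v 0 r * A r c = 0.
    by have := congr1 (fun w : 'rV_(_) => w 0 c) vA; rewrite [LHS]mxE [RHS]mxE.
  rewrite -[RHS]vA' coef_sum (reindex (fun jb : RT => enum_rank jb)) /=; last first.
    by exists enum_val => ? _; rewrite ?enum_rankK ?enum_valK.
  have AE jb : A (enum_rank jb) c = (a e jb.1 * 'X^(jb.2))`_k.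
    by rewrite [LHS]mxE !enum_rankK.
  under [RHS]eq_bigr => jb _ do rewrite AE.
  transitivity (\sum_j \sum_b v 0 (enum_rank ((j, b) : RT)) * (a e j * 'X^b)`_k); last first.
    by rewrite pair_bigA; apply: eq_bigr => -[].
  apply: eq_bigr => j _; rewrite xE mulr_sumr coef_sum; apply: eq_bigr => b _.
  by rewrite -scalerAr coefZ.
Qed.

End Siegel.

(** * Specialization at roots of theta *)

Section Bivariate.
Variable S : setting.
Local Notation L := (sL S).
Local Notation R := (sR S).
Local Notation abs := (@sabs S).
Local Notation q := (sq S).
Local Notation overFq := (@polyOverFq (sL S) q).
Local Notation theta := (stheta S).
Implicit Types (P Q : {poly {poly L}}).

(* [troot n] is theta^(1/q^n). *)
Definition troot n : L := iter n (@frobV S) theta.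

Lemma frob_troot n : frob (troot n.+1) = troot n.
Proof. by rewrite /troot iterS frobVK. Qed.

Lemma troot_expn n k : troot (n + k) ^+ (q ^ k) = troot n.
Proof.
elim: k => [|k IH]; first by rewrite addn0 expn0 expr1.
by rewrite addnS expnS exprM -frobE frob_troot.
Qed.

Lemma abs_troot_expn n : abs (troot n) ^+ (q ^ n) = abs theta.
Proof. by rewrite -absX -{1}(add0n n) troot_expn. Qed.

Lemma abs_troot_gt1 n : 1 < abs (troot n).
Proof.
have := sabs_theta S; rewrite -(abs_troot_expn n); apply: contraTT; rewrite -!leNgt => h.
by rewrite exprn_ile1 // abs_ge0.
Qed.

Lemma troot_neq0 n : troot n != 0.
Proof. by rewrite -abs_gt0; apply: lt_trans (abs_troot_gt1 n). Qed.

Lemma abs_troot_ltS n : abs (troot n.+1) < abs (troot n).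
Proof. by rewrite -(frob_troot n) abs_frob ltr_eXnr ?q_gt1 // abs_troot_gt1. Qed.

Lemma abs_troot_lt m n : (m < n)%N -> abs (troot n) < abs (troot m).
Proof.
elim: n => // n IH; rewrite ltnS leq_eqVlt => /orP[/eqP->|/IH h]; first exact: abs_troot_ltS.
exact: lt_trans (abs_troot_ltS n) h.
Qed.

Lemma troot_inj : injective troot.
Proof.
move=> m n h; apply/eqP; case: ltngtP => // /abs_troot_lt; by rewrite h ltxx.
Qed.

Lemma abs_troot_le n : abs (troot n) <= abs theta.
Proof.
by case: n => // n; apply: ltW; apply: (abs_troot_lt (m := 0%N)).
Qed.

(* An element of [{poly {poly L}}] is read as a polynomial in t whose coefficients are
   polynomials in a variable u standing for theta or one of its roots: [spec x] sets u := x,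
   [inflate m] sets u := u^m, and [diagonal m] sets u := t^m. *)
Definition bidegree a b P := [/\ forall i, overFq P`_i,
  forall i, (size (P`_i)%R <= a.+1)%N & (size P <= b.+1)%N].

Lemma bidegreeW a b a' b' P : (a <= a')%N -> (b <= b')%N -> bidegree a b P -> bidegree a' b' P.
Proof.
move=> ha hb [h1 h2 h3]; split=> // [i|]; last exact: leq_trans h3 _.
exact: leq_trans (h2 i) _.
Qed.

Lemma bidegree_sum a b I (r : seq I) (A : pred I) (F : I -> {poly {poly L}}) :
  (forall i, A i -> bidegree a b (F i)) -> bidegree a b (\sum_(i <- r | A i) F i).
Proof.
move=> h; elim/big_ind: _ => // [|P Q [p1 p2 p3] [q1 q2 q3]].
  by split=> [i|i|]; rewrite ?coef0 ?size_poly0 //; apply: overFq0.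
split=> [i|i|]; rewrite ?coefD; first exact: overFqD.
- by apply: leq_trans (size_polyD _ _) _; rewrite geq_max p2 q2.
- by apply: leq_trans (size_polyD _ _) _; rewrite geq_max p3 q3.
Qed.

Lemma bidegreeM a b a' b' P Q : bidegree a b P -> bidegree a' b' Q ->
  bidegree (a + a') (b + b') (P * Q).
Proof.
move=> [p1 p2 p3] [q1 q2 q3]; split=> [i|i|].
- by rewrite coefM; apply: overFq_sum => j _; apply: overFqM.
- rewrite coefM; apply: leq_trans (size_sum _ _ _) _; apply/bigmax_leqP => j _.
  apply: leq_trans (size_polyMleq _ _) _.
  have := p2 j; have := q2 (i - j)%N; move: (size _) (size _) => n1 n2; lia.
- apply: leq_trans (size_polyMleq _ _) _.
  by move: p3 q3; move: (size P) (size Q) => n1 n2; lia.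
Qed.

Definition spec (x : L) : {poly {poly L}} -> {poly L} := map_poly (horner_eval x).
HB.instance Definition _ (x : L) := GRing.RMorphism.copy (spec x) (map_poly (horner_eval x)).
Definition inflate m P : {poly {poly L}} := map_poly (comp_poly 'X^m) P.
Definition diagonal m P : {poly L} := (inflate m P).['X].

Lemma coef_spec x P i : (spec x P)`_i = (P`_i).[x].
Proof. by rewrite coef_map /= /horner_eval. Qed.

Lemma coef_inflate m P i : (inflate m P)`_i = (P`_i) \Po 'X^m.
Proof. by rewrite coef_map. Qed.

Lemma spec_inflate x m P : spec x (inflate m P) = spec (x ^+ m) P.
Proof. by apply/polyP => i; rewrite !coef_spec coef_inflate horner_comp hornerXn. Qed.

Lemma horner_diagonal m P x : (diagonal m P).[x] = (spec (x ^+ m) P).[x].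
Proof.
rewrite -spec_inflate /diagonal /spec.
have -> : (inflate m P).['X].[x] = horner_eval x (inflate m P).['X] by [].
by rewrite -horner_map /= /horner_eval hornerX.
Qed.

Lemma size_comp_polyXn (f : {poly L}) a m : (size f <= a.+1)%N ->
  (size (f \Po 'X^m)%R <= (a * m).+1)%N.
Proof.
move=> h; apply: leq_trans (size_comp_poly_leq _ _) _.
rewrite size_polyXn /= ltnS leq_mul2r; apply/orP; right.
by move: h; move: (size f) => k; lia.
Qed.

Lemma bidegree_inflate a b m P : bidegree a b P -> bidegree (a * m) b (inflate m P).
Proof.
move=> [h1 h2 h3]; split=> [i|i|]; rewrite ?coef_inflate.
- by apply: overFq_comp => //; apply: overFqXn.
- exact: size_comp_polyXn.
- by apply: leq_trans (size_poly _ _) h3.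
Qed.

Lemma diagonal_overFq a b m P : bidegree a b P ->
  overFq (diagonal m P) /\ (size (diagonal m P) <= (a * m + b).+1)%N.
Proof.
move=> /(bidegree_inflate m)[h1 h2 h3]; rewrite /diagonal horner_coef; split.
  by apply: overFq_sum => i _; apply: overFqM => //; apply: overFqXn.
apply: leq_trans (size_sum _ _ _) _; apply/bigmax_leqP => i _.
apply: leq_trans (size_polyMleq _ _) _; rewrite size_polyXn.
have := h2 i; have h4 := leq_trans (ltn_ord i) h3; move: (nat_of_ord i) h4 => k h4; move: (size _) => n1; lia.
Qed.

Lemma spec_eq0 x P : 1 < abs x -> (forall i, overFq P`_i) -> spec x P = 0 -> P = 0.
Proof.
move=> x1 hP h; apply/polyP => i; rewrite coef0; apply: (overFq_root (hP i) x1).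
by rewrite -coef_spec h coef0.
Qed.

Lemma frobV_spec x P t : (forall i, overFq P`_i) ->
  frobV (spec x P).[frob t] = (spec (frobV x) P).[t].
Proof.
move=> hP; rewrite -{2}(frobK t) -[LHS]horner_map /=; congr (_.[_]).
by apply/polyP => i; rewrite coef_map /= !coef_spec overFq_frobV.
Qed.

Lemma abs_spec_le a b x P (rho : R) t : bidegree a b P -> 1 < abs x -> 1 <= rho ->
  abs t <= rho -> abs (spec x P).[t] <= abs x ^+ a * rho ^+ b.
Proof.
move=> [h1 h2 h3] x1 r1 tr; rewrite horner_coef.
have x0 : 0 <= abs x by rewrite abs_ge0.
have r0 : 0 <= rho by apply: le_trans r1.
apply: abs_sum => [|i _]; first by rewrite mulr_ge0 // exprn_ge0.
rewrite absM absX coef_spec; apply: ler_pM; rewrite ?abs_ge0 ?exprn_ge0 ?abs_ge0 //.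
  exact: abs_overFq_le.
apply: le_trans (_ : rho ^+ i <= _); first by rewrite lerXn2r ?nnegrE ?abs_ge0.
rewrite ler_weXn2l // -ltnS (leq_trans (ltn_ord i)) // (leq_trans _ h3) //.
exact: size_poly.
Qed.

End Bivariate.

(** * Linear relations between values *)

Section Criterion.
Variable S : setting.
Local Notation L := (sL S).
Local Notation R := (sR S).
Local Notation abs := (@sabs S).
Local Notation q := (sq S).
Local Notation overFq := (@polyOverFq (sL S) q).
Local Notation theta := (stheta S).
Local Notation troot := (@troot S).
Local Notation T := (sabs (stheta S)).

Variables (l d : nat) (M : 'I_l.+1 -> 'I_l.+1 -> {poly {poly L}}).
Variables (g : 'I_l.+1 -> L -> L).
Hypothesis Mdeg : forall i j, bidegree d d (M i j).
Hypothesis gE : forall t i, abs t <= T ->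
  g i t = \sum_j (spec theta (M i j)).[t] * frob (g j (frobV t)).
Hypothesis Minj : forall z (c : 'I_l.+1 -> L), abs z <= T ->
  (forall j, \sum_i c i * (spec theta (M i j)).[z] = 0) -> forall i, c i = 0.
Hypothesis gan : forall r : nat, exists B : R, forall i, analytic (T ^+ r) B (g i).

Section Relation.
Variables (d0 : nat) (F0 : 'I_l.+1 -> {poly L}).
Hypothesis F0q : forall i, overFq (F0 i).
Hypothesis F0deg : forall i, (size (F0 i) <= d0.+1)%N.
Hypothesis F0n0 : exists i, F0 i != 0.
Hypothesis F0rel : \sum_i (F0 i).[theta] * g i theta = 0.

Let G := (d0 + 2 * d)%N.

(* The functional equation of g transports the relation at theta to its q^k-th root. *)
Lemma relation_at_troot k : exists F : 'I_l.+1 -> {poly L},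
  [/\ forall i, overFq (F i), forall i, (size (F i) <= (G * q ^ k).+1)%N,
      exists i, F i != 0 & \sum_i (F i).[troot k] * g i (troot k) = 0].
Proof.
elim: k => [|k [F [Fq Fd [i0 Fi0] Frel]]].
  exists F0; split=> // i; rewrite expn0 muln1; apply: leq_trans (F0deg i) _.
  by rewrite /G; lia.
pose F' j := \sum_i F i * diagonal (q ^ k) (M i j).
have F'E j : (F' j).[troot k] = \sum_i (F i).[troot k] * (spec theta (M i j)).[troot k].
  have tE : troot k ^+ (q ^ k) = theta := troot_expn S 0 k.
  by rewrite horner_sum; apply: eq_bigr => i _; rewrite hornerM horner_diagonal tE.
have dgn i j : overFq (diagonal (q ^ k) (M i j)) /\
    (size (diagonal (q ^ k) (M i j)) <= (d * q ^ k + d).+1)%N.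
  exact: diagonal_overFq.
have F'q j : overFq (F' j).
  by apply: overFq_sum => i _; apply: overFqM; [|case: (dgn i j)].
exists F'; split=> // [j|| ].
- apply: leq_trans (size_sum _ _ _) _; apply/bigmax_leqP => i _.
  apply: leq_trans (size_polyMleq _ _) _; rewrite expnS.
  have h2 := q_gt1 S; have h1 : (0 < q ^ k)%N by rewrite expn_gt0 q_gt0.
  have [_] := dgn i j; have := Fd i.
  set n1 := size (F i); set n2 := size _; set n3 := (q ^ k)%N in h1 *; move=> h3 h4.
  have h5 : (G * n3 * 2 <= G * (q * n3))%N by rewrite -mulnA leq_mul2l mulnC leq_mul2r h2 !orbT.
  have h6 : (2 * d * n3 <= G * n3)%N by rewrite leq_mul2r /G leq_addl orbT.
  have h7 : (d <= d * n3)%N by rewrite leq_pmulr.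
  lia.
- have [j F'j|F'0] := pickP (fun j => F' j != 0); first by exists j.
  case/eqP: Fi0; apply: (overFq_root (Fq i0) (abs_troot_gt1 S k)).
  apply: (Minj (z := troot k) (c := fun i => (F i).[troot k])) => [|j]; first exact: abs_troot_le.
  by rewrite -F'E; have /negbFE/eqP-> := F'0 j; rewrite horner0.
apply: (@frob_inj S); rewrite rmorph0 rmorph_sum /= -[RHS]Frel.
transitivity (\sum_j \sum_i (F i).[troot k] * (spec theta (M i j)).[troot k] * frob (g j (troot k.+1))).
  apply: eq_bigr => j _; rewrite rmorphM /= -mulr_suml -F'E; congr (_ * _).
  by rewrite overFq_frob // frob_troot.
rewrite exchange_big; apply: eq_bigr => i _ /=; rewrite gE ?abs_troot_le // mulr_sumr.
by apply: eq_bigr => j _; rewrite mulrA.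
Qed.

(* The unknowns [h i] only have to make (h i)(theta^(1/q^k)) proportional to the relation of
   [relation_at_troot], for k < n; these are linear conditions over F_q[theta^(1/q^n)]. *)
Lemma first_siegel m : (0 < m)%N ->
  let N := (2 * l.+1 * m)%N in let n := ((2 * l.+1).+1 * m)%N in
  exists h : 'I_l.+1 -> {poly {poly L}},
  [/\ forall i, bidegree (2 * l.+1 * (G + N) * q ^ n) N (h i),
      exists i, h i != 0 &
      forall k, (k < n)%N -> \sum_i (spec (troot n) (h i)).[troot k] * g i (troot k) = 0].
Proof.
move=> m0 N n.
have /ClassicalEpsilon.choice[F hF] := relation_at_troot.
have /ClassicalEpsilon.choice[e he] : forall k, exists i, F k i != 0 by move=> k; have [] := hF k.
pose s := ((G + N) * q ^ n)%N.
pose f k i : {poly L} := F k i \Po 'X^(q ^ (n - k)).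
pose a (kj : 'I_n * 'I_l) (ji : 'I_l.+1 * 'I_N) : {poly L} :=
  (f kj.1 (e kj.1) *+ (ji.1 == lift (e kj.1) kj.2) - f kj.1 (lift (e kj.1) kj.2) *+ (ji.1 == e kj.1))
  * 'X^(ji.2 * q ^ (n - kj.1)).
have fq k i : overFq (f k i).
  by apply: overFq_comp; [have [] := hF k | apply: overFqXn].
have fM (b : bool) k i : overFq (f k i *+ b) by case: b; rewrite ?mulr1n ?mulr0n //; apply: overFq0.
have fs k i : (k < n)%N -> (size (f k i) <= (G * q ^ n).+1)%N.
  move=> kn; have [_ h _ _] := hF k.
  apply: leq_trans (size_comp_polyXn (q ^ (n - k)) (h i)) _.
  by rewrite -mulnA -expnD subnKC // ltnW.
have fsM (b : bool) k i : (k < n)%N -> (size (f k i *+ b)%R <= (G * q ^ n).+1)%N.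
  by move=> kn; case: b; rewrite ?mulr1n ?mulr0n ?size_poly0 //; apply: fs.
have [||| x [xq xs [j0 xj0] xE]] := @siegel S _ _ s (2 * l.+1 * s).+1 a.
- move=> kj ji; apply: overFqM; last exact: overFqXn.
  by apply: overFqB; apply: fM.
- move=> [k j] [j' i]; rewrite /a /=; apply: leq_trans (size_polyMleq _ _) _.
  rewrite size_polyXn addnS /= /s mulnDl -addSn leq_add //.
    apply: leq_trans (size_polyD _ _) _; rewrite size_polyN geq_max.
    by rewrite !fsM.
  by apply: leq_mul; [apply: ltnW | rewrite leq_exp2l ?q_gt1 // leq_subr].
- rewrite !card_prod !card_ord /N /n; move: (s) => s'; clear -m0.
  apply: (@leq_ltn_trans (m * (l * (2 * l.+1).+1 * ((2 * l.+1).+1 * s' + 1)))); first by nia.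
  apply: (@leq_trans (m * (l.+1 * (2 * l.+1) * (2 * l.+1 * s' + 1)))); last by nia.
  rewrite ltn_pmul2l //.
  have -> : (l.+1 * (2 * l.+1) * (2 * l.+1 * s' + 1) = l * (2 * l.+1).+1 * ((2 * l.+1).+1 * s' + 1)
     + ((3 * l + 4) * s' + l.+2))%N by lia.
  by rewrite -[X in (X < _)%N]addn0 ltn_add2l; lia.
pose h j : {poly {poly L}} := \poly_(i < N) (if insub i is Some i' then x (j, i') else 0).
have hE j (i : 'I_N) : (h j)`_i = x (j, i).
  by rewrite coef_poly ltn_ord; case: insubP => [i' _ /val_inj->|]; rewrite ?ltn_ord.
have hc j i : (h j)`_i = 0 \/ exists i', (h j)`_i = x (j, i').
  rewrite coef_poly; case: ifP => iN; last by left.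
  by case: insubP => [i' _ _|]; [right; exists i' | left].
have hsum j y z : (spec y (h j)).[z] = \sum_(i < N) (x (j, i)).[y] * z ^+ i.
  have sh : (size (spec y (h j)) <= N)%N.
    by apply: leq_trans (size_poly _ _) _; apply: size_poly.
  rewrite (horner_coef_wide _ sh); apply: eq_bigr => i _.
  by rewrite coef_spec hE.
exists h; split.
- move=> j; split=> [i|i|]; last by apply: leq_trans (size_poly _ _) _.
    by case: (hc j i) => [->|[i' ->//]]; apply: overFq0.
  case: (hc j i) => [->|[i' ->//]]; first by rewrite size_poly0.
  by apply: leq_trans (xs _) _; rewrite /s mulnA.
- by exists j0.1; apply: contraNneq xj0 => h0; case: (j0) h0 => j i /= h0; rewrite -hE h0 coef0.
move=> k kn.
have [_ _ _ Frel] := hF k.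
pose j1 := e k; pose u := troot n.
have uE : u ^+ (q ^ (n - k)) = troot k by rewrite /u -{1}(subnKC (ltnW kn)) troot_expn.
have fE j : (f k j).[u] = (F k j).[troot k] by rewrite horner_comp hornerXn uE.
have Hprop j : (F k j1).[troot k] * (spec u (h j)).[troot k] =
               (F k j).[troot k] * (spec u (h j1)).[troot k].
  have [->//|jj1] := eqVneq j j1.
  have [j' jE] : exists j', j = lift j1 j'.
    by case: (unliftP j1 j) jj1 => [j' ->|->]; [exists j' | rewrite eqxx].
  have := congr1 (fun P : {poly L} => P.[u]) (xE (Ordinal kn, j')).
  rewrite horner0 horner_sum.
  have -> : \sum_ji (a (Ordinal kn, j') ji * x ji).[u] =
    \sum_j2 \sum_(i < N) (a (Ordinal kn, j') (j2, i) * x (j2, i)).[u].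
    by rewrite pair_bigA; apply: eq_bigr => -[].
  have aE j2 : \sum_(i < N) (a (Ordinal kn, j') (j2, i) * x (j2, i)).[u] =
    ((F k j1).[troot k] *+ (j2 == j) - (F k j).[troot k] *+ (j2 == j1)) * (spec u (h j2)).[troot k].
    rewrite hsum mulr_sumr; apply: eq_bigr => i _.
    rewrite /a /= -/j1 -jE !hornerM hornerD hornerN !hornerMn !fE hornerXn.
    by rewrite mulnC exprM uE mulrA mulrAC -!mulrA; congr (_ * _); rewrite mulrC.
  under eq_bigr => j2 _ do rewrite aE mulrBl.
  rewrite sumrB (bigD1 j) //= eqxx mulr1n big1 ?addr0; last first.
    by move=> j2 /negPf->; rewrite mulr0n mul0r.
  rewrite (bigD1 j1) //= eqxx mulr1n big1 ?addr0; last first.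
    by move=> j2 /negPf->; rewrite mulr0n mul0r.
  by move/eqP; rewrite subr_eq0 => /eqP.
have Fk0 : (F k j1).[troot k] != 0.
  have [Fq _ _ _] := hF k.
  by apply: contraNneq (he k) => h0; rewrite (overFq_root (Fq _) (abs_troot_gt1 S k) h0).
apply: (mulfI Fk0); rewrite mulr0 mulr_sumr.
transitivity ((spec u (h j1)).[troot k] * \sum_i (F k i).[troot k] * g i (troot k)); last first.
  by rewrite Frel mulr0.
rewrite mulr_sumr; apply: eq_bigr => i _; rewrite -/u [LHS]mulrA Hprop mulrA.
by rewrite [X in X * _ = _]mulrC.
Qed.
End Relation.

Lemma lowest_power_bound (m : nat) (c : 'I_m.+1 -> L) (b : L) (H : R) :
  1 <= H -> (forall j, abs (c j) <= H) -> (forall j, c j != 0 -> 1 <= abs (c j)) ->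
  (exists j, c j != 0) -> b != 0 -> \sum_j c j * b ^+ (q ^ (m - j)) = 0 ->
  1 <= abs b * H.
Proof.
move=> H1 cH c1 [j0 cj0] b0 hsum.
have [b1|b1] := leP 1 (abs b); first by rewrite -[1]mulr1 ler_pM.
case: (@arg_maxnP _ j0 (fun j => c j != 0) (fun j : 'I_m.+1 => nat_of_ord j) cj0) => j1 cj1 jmax.
set k := (q ^ (m - j1))%N.
have k0 : (0 < k)%N by rewrite expn_gt0 q_gt0.
have ab0 : 0 < abs b by rewrite abs_gt0.
have H0 : 0 <= H by apply: le_trans H1.
have : abs b ^+ k <= H * abs b ^+ k.+1.
  move: hsum; rewrite (bigD1 j1) //= => /eqP; rewrite addr_eq0 => /eqP hsum.
  apply: le_trans (_ : abs (c j1 * b ^+ k) <= _).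
    by rewrite absM absX ler_peMl ?exprn_ge0 ?abs_ge0 ?c1.
  rewrite hsum absN; apply: abs_sum => [|j jj1]; first by rewrite mulr_ge0 ?exprn_ge0 ?abs_ge0.
  have [->|cj] := eqVneq (c j) 0.
    by rewrite mul0r abs0 mulr_ge0 ?exprn_ge0 ?abs_ge0.
  rewrite absM absX ler_pM ?abs_ge0 ?exprn_ge0 ?abs_ge0 //.
  apply: ler_wiXn2l; rewrite ?abs_ge0 ?(ltW b1) //.
  have jlt : (j < j1)%N by rewrite ltn_neqAle; apply/andP; split; [exact: jj1 | exact: jmax].
  apply: leq_trans (_ : q * k <= _)%N; first by rewrite -[X in (X < _)%N]mul1n ltn_mul2r k0 q_gt1.
  by rewrite /k -expnS leq_exp2l ?q_gt1 //; move: (ltn_ord j1) jlt; clear; lia.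
rewrite exprS mulrA -[leLHS]mul1r ler_pM2r ?exprn_gt0 //.
by rewrite mulrC.
Qed.

Lemma iter_frobM (f : {rmorphism L -> L}) j x y : iter j f (x * y) = iter j f x * iter j f y.
Proof. by elim: j => //= j ->; rewrite rmorphM. Qed.

Lemma iter_frob_sum j I (r : seq I) (P : pred I) (F : I -> L) :
  iter j (@frob S) (\sum_(i <- r | P i) F i) = \sum_(i <- r | P i) iter j (@frob S) (F i).
Proof. by elim: j => //= j ->; rewrite rmorph_sum. Qed.

Lemma iter_frobVK j (x : L) : iter j (@frob S) (iter j (@frobV S) x) = x.
Proof. by elim: j x => //= j IH x; rewrite -iterS iterSr frobVK IH. Qed.

Lemma iter_frobK j (x : L) : iter j (@frobV S) (iter j (@frob S) x) = x.
Proof. by elim: j x => //= j IH x; rewrite -iterS iterSr frobK IH. Qed.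

(* The coordinates in g of the j-th inverse Frobenius twist of the form h.g. *)
Fixpoint twisted (n : nat) (h : 'I_l.+1 -> {poly {poly L}}) (j : nat) : 'I_l.+1 -> {poly {poly L}} :=
  if j is j'.+1 then
    fun i' => \sum_i twisted n h j' i * inflate (q ^ (n + j')) (M i i')
  else h.

Lemma twistedE n h j t : (forall i, exists a b, bidegree a b (h i)) -> abs t <= 1 ->
  iter j (@frobV S) (\sum_i (spec (troot n) (h i)).[t ^+ (q ^ j)] * g i (t ^+ (q ^ j))) =
  \sum_i (spec (troot (n + j)) (twisted n h j i)).[t] * g i t.
Proof.
move=> hh; have hq j' i i' : overFq (twisted n h j' i)`_i'.
  elim: j' i i' => [|j' IH] i i' /=; first by have [a [b []]] := hh i.
  rewrite coef_sum; apply: overFq_sum => i1 _; rewrite coefM; apply: overFq_sum => k _.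
  by apply: overFqM => //; have [] := bidegree_inflate (q ^ (n + j')) (Mdeg i1 i).
elim: j t => [|j IH] t t1; first by rewrite expn0 addn0 expr1.
have t1' : abs (frob t) <= 1 by rewrite abs_frob exprn_ile1 ?abs_ge0.
rewrite iterS expnS exprM -frobE IH // rmorph_sum /= addnS.
transitivity (\sum_i \sum_i' (spec (troot (n + j).+1) (twisted n h j i)).[t] *
   ((spec (troot 1) (M i i')).[t] * g i' t)).
  apply: eq_bigr => i _; rewrite rmorphM /= frobV_spec // -mulr_sumr; congr (_ * _).
  rewrite gE; last by apply: le_trans t1' (ltW (sabs_theta S)).
  rewrite rmorph_sum; apply: eq_bigr => i' _ /=; rewrite rmorphM /= frobV_spec ?frobK //.
  by have [] := Mdeg i i'.
rewrite exchange_big; apply: eq_bigr => i' _ /=.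
rewrite rmorph_sum horner_sum mulr_suml; apply: eq_bigr => i _ /=.
rewrite rmorphM /= hornerM spec_inflate.
have := troot_expn S 1 (n + j); rewrite add1n => ->.
by rewrite mulrA.
Qed.

Lemma bidegree_twisted n h a b j : (forall i, bidegree a b (h i)) -> (j <= l.+1)%N ->
  forall i, bidegree (a + j * (d * q ^ (n + l.+1))) (b + j * d) (twisted n h j i).
Proof.
move=> hh; elim: j => [|j IH] jl i /=; first by rewrite !mul0n !addn0.
apply: bidegree_sum => i1 _.
have := bidegreeM (IH (ltnW jl) i1) (bidegree_inflate (q ^ (n + j)) (Mdeg i1 i)).
apply: bidegreeW; last by rewrite mulSn; lia.
rewrite mulSn -addnA leq_add2l addnC leq_add2r leq_mul2l leq_exp2l ?q_gt1 //.
by rewrite leq_add2l (ltnW jl) orbT.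
Qed.

(* Liouville-type bound: the l+2 successive twists of the form h.g are linearly dependent over
   polynomials of small height, and the dependence, read at t = 0, is a q-polynomial
   equation for [B 0]. *)
Lemma order_coef_lower_bound (n a N : nat) h nu (B : L -> L) :
  (forall i, bidegree a N (h i)) ->
  (forall t, abs t <= 1 -> \sum_i (spec (troot n) (h i)).[t] * g i t = t ^+ nu * B t) ->
  continuous0 B -> B 0 != 0 ->
  1 <= abs (B 0) * abs (troot n) ^+
    ((2 * l.+1).+1 * ((a + l.+1 * (d * q ^ (n + l.+1))) * q ^ l.+1)).+1.
Proof.
move=> hh hB Bc b0; set la := l.+1; set s := ((a + _) * _)%N; set m := (_ * s).+1.
pose W (j : 'I_la.+1) i := inflate (q ^ (la - j)) (twisted n h j i).
have Wd j i : bidegree s (N + la * d) (W j i).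
  have jla : (j <= la)%N by rewrite -ltnS.
  have := bidegree_inflate (q ^ (la - j)) (bidegree_twisted n hh jla i).
  apply: bidegreeW; last by rewrite leq_add2l leq_mul2r jla orbT.
  by apply: leq_mul; rewrite ?leq_add2l ?leq_mul2r ?jla ?orbT // leq_exp2l ?q_gt1 // leq_subr.
pose D0 := (N + la * d).+1; pose D := (2 * la * D0)%N.
pose A (ic : 'I_la * 'I_(D + D0)) (jb : 'I_la.+1 * 'I_D) : {poly L} :=
  (W jb.1 ic.1 * 'X^(jb.2))`_(ic.2).
have AE ic jb : A ic jb = 0 \/ exists k, A ic jb = (W jb.1 ic.1)`_k.
  by rewrite /A coefMXn; case: ifP => _; [left | right; exists (ic.2 - jb.2)%N].
have [||| x [xq xs [jb0 xn0] xE]] := @siegel S _ _ s m A.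
- move=> ic jb; case: (AE ic jb) => [->|[k ->]]; first exact: overFq0.
  by have [] := Wd jb.1 ic.1.
- move=> ic jb; case: (AE ic jb) => [->|[k ->]]; first by rewrite size_poly0.
  by have [] := Wd jb.1 ic.1.
- rewrite !card_prod !card_ord /D /m; move: (s) => s'.
  have : (0 < D0)%N by [].
  move: (D0) => D1 D10; clear -D10.
  rewrite [X in (_ < X)%N](_ : _ = (D1 * la) * ((2 * la).+2 * ((2 * la).+1 * s').+1))%N; last by nia.
  rewrite [X in (X < _)%N](_ : _ = (D1 * la) * ((2 * la).+1 * (((2 * la).+1 * s').+1 + s')))%N; last by nia.
  rewrite ltn_pmul2l; last by rewrite muln_gt0 D10.
  by move: (2 * la)%N => k; lia.
pose C (j : 'I_la.+1) : {poly {poly L}} := \sum_(b < D) x (j, b) *: 'X^b.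
have Cc j k : overFq (C j)`_k /\ (size ((C j)`_k)%R <= m)%N.
  have [kD|kD] := ltnP k D; last first.
    rewrite nth_default ?size_poly0; first by split=> //; apply: overFq0.
    apply: leq_trans kD; apply: leq_trans (size_sum _ _ _) _; apply/bigmax_leqP => b _.
    by apply: leq_trans (size_scale_leq _ _) _; rewrite size_polyXn.
  have -> : (C j)`_k = x (j, Ordinal kD).
    rewrite coef_sum (bigD1 (Ordinal kD)) //= coefZ coefXn eqxx mulr1 big1 ?addr0 //.
    move=> b bk; rewrite coefZ coefXn; case: eqP => [e|]; rewrite ?mulr0 //.
    by case/eqP: bk; apply: val_inj.
  by split.
have CW i : \sum_j W j i * C j = 0.
  apply/polyP => k; rewrite coef0.
  have [kD|kD] := ltnP k (D + D0); last first.
    apply: nth_default; apply: leq_trans kD; apply: leq_trans (size_sum _ _ _) _.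
    apply/bigmax_leqP => j _; apply: leq_trans (size_polyMleq _ _) _.
    have [_ _ h1] := Wd j i; have h2 : (size (C j) <= D)%N.
      apply: leq_trans (size_sum _ _ _) _; apply/bigmax_leqP => b _.
      by apply: leq_trans (size_scale_leq _ _) _; rewrite size_polyXn.
    by rewrite /D0; move: (size _) h1 (size _) h2 => n1 h1 n2 h2; lia.
  have h0 := xE (i, Ordinal kD); rewrite coef_sum -[RHS]h0.
  transitivity (\sum_j \sum_b A (i, Ordinal kD) (j, b) * x (j, b)); last first.
    by rewrite pair_bigA; apply: eq_bigr => -[].
  apply: eq_bigr => j _; rewrite /C mulr_sumr coef_sum; apply: eq_bigr => b _.
  by rewrite -scalerAr coefZ mulrC.
pose u := troot (n + la).
have uE (j : 'I_la.+1) : u ^+ (q ^ (la - j)) = troot (n + j).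
  have jla : (j <= la)%N by rewrite -ltnS.
  by rewrite /u -{1}(subnKC jla) addnA troot_expn.
have rel t : abs t <= 1 -> t != 0 ->
    \sum_(j < la.+1) (spec u (C j)).[t] * iter j (@frobV S) (B (t ^+ (q ^ j))) = 0.
  move=> t1 t0.
  have tn0 : t ^+ nu != 0 by rewrite expf_neq0.
  apply: (mulfI tn0); rewrite mulr0 mulr_sumr.
  transitivity (\sum_(j < la.+1) (spec u (C j)).[t] * \sum_i (spec u (W j i)).[t] * g i t).
    apply: eq_bigr => j _; rewrite mulrCA; congr (_ * _).
    under [RHS]eq_bigr => i _ do rewrite spec_inflate uE.
    rewrite -twistedE //; last by move=> i; exists a, N.
    rewrite hB; last by rewrite absX exprn_ile1 ?abs_ge0.
    rewrite iter_frobM -exprM mulnC exprM; congr (_ * _).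
    by rewrite -iter_frobE iter_frobK.
  under eq_bigr => j _ do rewrite mulr_sumr.
  rewrite exchange_big big1 // => i _ /=.
  have := congr1 (fun P => (spec u P).[t]) (CW i).
  rewrite rmorph0 horner0 rmorph_sum horner_sum /= => h0.
  transitivity ((\sum_j (spec u (W j i * C j)).[t]) * g i t); last by rewrite h0 mul0r.
  rewrite mulr_suml; apply: eq_bigr => j _.
  by rewrite rmorphM /= hornerM mulrA; congr (_ * _); rewrite mulrC.
have Cn0 : exists k, [exists j, (C j)`_k != 0].
  exists jb0.2; apply/existsP; exists jb0.1; case: jb0 xn0 => j b /= xn0.
  rewrite coef_sum (bigD1 b) //= coefZ coefXn eqxx mulr1 big1 ?addr0 //.
  move=> b' bb; rewrite coefZ coefXn; case: eqP => [e|]; rewrite ?mulr0 //.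
  by case/eqP: bb; apply: val_inj.
case: (ex_minnP Cn0) => k /existsP[j1 Cj1] kmin.
pose E j : {poly L} := drop_poly k (spec u (C j)).
have CE j : spec u (C j) = E j * 'X^k.
  rewrite -[LHS](poly_take_drop k) (_ : take_poly k _ = 0) ?add0r //.
  apply/polyP => i; rewrite coef_take_poly coef0; case: ifP => // ik.
  rewrite coef_spec; have [->|Ci] := eqVneq (C j)`_i 0; first by rewrite horner0.
  have ki : (k <= i)%N by apply: kmin; apply/existsP; exists j.
  by move: ik; rewrite ltnNge ki.
have E0 j : (E j).[0] = ((C j)`_k).[u].
  by rewrite horner_coef0 coef_drop_poly add0n coef_spec.
pose F t := \sum_(j < la.+1) ((E j).[t] ^+ (q ^ la)) * (B (t ^+ (q ^ j))) ^+ (q ^ (la - j)).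
have F0 : F 0 = 0.
  apply: (@continuous0_eq0 S F 1) => // [|t t0 t1].
    apply: continuous0_sum => j; apply: continuous0M.
      by apply: continuous0X; apply: continuous0_poly.
    by apply: continuous0X; apply: continuous0_compX => //; rewrite expn_gt0 q_gt0.
  have := rel t t1 t0.
  under eq_bigr => j _ do rewrite CE hornerM hornerXn mulrAC.
  rewrite -mulr_suml => /eqP; rewrite mulf_eq0 expf_eq0 (negPf t0) andbF orbF => /eqP.
  move=> /(congr1 (iter la (@frob S))); rewrite iter_frob_sum => h0.
  transitivity (iter la (@frob S) 0); last by elim: (la) => //= n' ->; rewrite rmorph0.
  rewrite -[RHS]h0; apply: eq_bigr => j _; rewrite iter_frobM iter_frobE; congr (_ * _).
  have jla : (j <= la)%N by rewrite -ltnS.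
  have aux k1 k2 (y : L) : iter (k1 + k2) (@frob S) (iter k2 (@frobV S) y) = y ^+ (q ^ k1).
    by rewrite iterD iter_frobVK iter_frobE.
  by rewrite -[LHS](aux _ j) subnK.
have uu : abs u ^+ (q ^ la) = abs (troot n) by rewrite -absX troot_expn.
apply: (@lowest_power_bound la (fun j => (((C j)`_k).[u]) ^+ (q ^ la))) => //.
- by rewrite exprn_ege1 // ltW // abs_troot_gt1.
- move=> j; rewrite absX -uu -exprM mulnC exprM.
  rewrite lerXn2r ?nnegrE ?exprn_ge0 ?abs_ge0 //.
  have [h1 h2] := Cc j k; apply: abs_overFq_le; rewrite ?abs_troot_gt1 //.
  exact: leq_trans h2 _.
- move=> j; rewrite expf_eq0 negb_and => /orP[|cn0]; first by rewrite -eqn0Ngt expn_eq0 gtn_eqF ?q_gt0.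
  rewrite absX exprn_ege1 //; apply: abs_overFq_ge1; rewrite ?abs_troot_gt1 //.
    by have [] := Cc j k.
  by apply: contraNneq cn0 => ->; rewrite horner0.
- exists j1; rewrite expf_neq0 //; apply: contraNneq Cj1 => h0.
  by have [h1 _] := Cc j1 k; rewrite (overFq_root h1 (abs_troot_gt1 S _) h0).
- rewrite -[RHS]F0; apply: eq_bigr => j _; rewrite E0; congr (_ * _).
  by rewrite expr0n gtn_eqF // expn_gt0 q_gt0.
Qed.

Theorem linear_relation_criterion (d0 : nat) (F0 : 'I_l.+1 -> {poly L}) :
  (forall i, overFq (F0 i)) -> (forall i, (size (F0 i) <= d0.+1)%N) ->
  (exists i, F0 i != 0) -> \sum_i (F0 i).[theta] * g i theta = 0 ->
  exists h : 'I_l.+1 -> {poly L}, (exists i, h i != 0) /\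
    forall t, abs t <= 1 -> \sum_i (h i).[t] * g i t = 0.
Proof.
move=> F0q F0d F0n F0r; pose la := l.+1; pose G := (d0 + 2 * d)%N.
pose kap := ((2 * la).+1 * (2 * la * G.+1 + la * (d * q ^ la)) * q ^ la).+1.
pose e := (2 * la * (G + 2 * la) + (2 * la).+1 + kap * (2 * la))%N.
pose rho := e.+1.
have T1 : 1 < T := sabs_theta S.
have T0 : 0 < T by apply: lt_trans T1.
have [B0 hB0] := gan rho.
pose B := Num.max 1 B0.
have B1 : 1 <= B by rewrite le_max lexx.
have gB i : analytic (T ^+ rho) B (g i) by apply: analyticW (hB0 i); rewrite le_max lexx orbT.
have [m hm] := expr_unbounded B T1.
have m0 : (0 < m)%N.
  by case: (m) hm => //; rewrite expr0 ltNge B1.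
pose N := (2 * la * m)%N; pose n := ((2 * la).+1 * m)%N.
have [h [hd [i0 hi0] hz]] := first_siegel F0q F0d F0n F0r m0.
rewrite -/la -/N -/n -/G in h hd i0 hi0 hz.
pose E t := \sum_i (spec (troot n) (h i)).[t] * g i t.
exists (fun i => spec (troot n) (h i)); split.
  exists i0; apply: contraNneq hi0 => h0.
  by apply/eqP; apply: (spec_eq0 (abs_troot_gt1 S n)) h0; have [] := hd i0.
move=> t0 t01; apply/eqP/negPn/negP => Et0; rewrite -/(E t0) in Et0.
pose r := theta ^+ rho.
have rE : abs r = T ^+ rho by rewrite absX.
have r1 : 1 < abs r by rewrite rE exprn_egt1.
pose Bd := T ^+ (2 * la * (G + N)) * abs r ^+ N * B.
have Bd0 : 0 < Bd by rewrite !mulr_gt0 ?exprn_gt0 ?abs_gt0 // -?abs_gt0 ?(lt_trans _ r1) // (lt_le_trans _ B1).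
have trootX : abs (troot n) ^+ (q ^ n) = T by apply: abs_troot_expn.
have Ean : analytic (abs r) Bd E.
  apply: analytic_sum => [|i _]; first exact: ltW.
  apply: analyticM; last by rewrite rE.
  apply: analytic_poly => t tr.
  have := abs_spec_le (hd i) (abs_troot_gt1 S n) (ltW r1) tr.
  by rewrite [in X in _ <= X * _ -> _]mulnC exprM trootX.
have [|z|nu [b [B' [ban bE b0 hb]]]] :=
  @schwarz_lemma S r Bd E [seq troot k | k <- iota 0 n] t0 r1 Bd0 Ean t01 Et0.
- by rewrite map_inj_uniq ?iota_uniq //; apply: troot_inj.
- move=> /mapP[k]; rewrite mem_iota add0n => /andP[_ kn] ->; split.
  + exact: troot_neq0.
  + by apply: le_trans (abs_troot_le S k) _; rewrite rE ler_eXnr // ltW.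
  + exact: hz.
rewrite size_map size_iota in hb.
have rn0 : r != 0 by rewrite -abs_gt0; apply: lt_trans r1.
have r1' t : abs t <= 1 -> abs t <= abs r by move=> t1; apply: le_trans t1 (ltW r1).
have := order_coef_lower_bound hd (fun t t1 => bE t (r1' t t1)) (continuous0_analytic rn0 ban) b0.
rewrite -/la; set x := (_.+1); move=> low.
have xk : (x <= q ^ n * (kap * N))%N.
  have N0 : (0 < N)%N by rewrite /N !muln_gt0.
  have Q0 : (0 < q ^ n)%N by rewrite expn_gt0 q_gt0.
  rewrite /x /kap expnD; move: (q ^ n)%N (q ^ la)%N Q0 (N) N0 => Q Ql Q0 N' N0.
  have hG : (G + N' <= G.+1 * N')%N by rewrite mulSn addnC leq_add2l leq_pmulr.
  have h1 : (2 * la * (G + N') * Q <= 2 * la * (G.+1 * N') * Q)%N.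
    by rewrite leq_mul2r leq_mul2l hG !orbT.
  have h2 : (la * (d * (Q * Ql)) <= la * (d * Ql) * N' * Q)%N.
    have -> : (la * (d * (Q * Ql)) = la * (d * Ql) * 1 * Q)%N by ring.
    by rewrite leq_mul2r leq_mul2l N0 !orbT.
  have h3 : (1 <= N' * Q)%N by rewrite muln_gt0 N0.
  have -> : (Q * (((2 * la).+1 * (2 * la * G.+1 + la * (d * Ql)) * Ql).+1 * N') =
    (2 * la).+1 * ((2 * la * (G.+1 * N') * Q + la * (d * Ql) * N' * Q) * Ql) + N' * Q)%N by ring.
  rewrite -addn1; apply: leq_add => //.
  by rewrite leq_mul2l leq_mul2r leq_add ?orbT.
have low' : 1 <= abs (b 0) * T ^+ (kap * N).
  apply: le_trans low _; rewrite ler_wpM2l ?abs_ge0 // -trootX -exprM.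
  by rewrite ler_weXn2l // ltW // abs_troot_gt1.
have zprod : \prod_(z <- [seq troot k | k <- iota 0 n]) abs z <= T ^+ n.
  rewrite big_map; apply: le_trans (_ : \prod_(k <- iota 0 n) T <= _).
    by apply: ler_prod => k _; rewrite abs_ge0 abs_troot_le.
  by rewrite big_const_seq count_predT size_iota iter_mulr mulr1.
have final : abs r ^+ n <= Bd * T ^+ n * T ^+ (kap * N).
  apply: le_trans (_ : abs (b 0) * abs r ^+ n * T ^+ (kap * N) <= _).
    by rewrite mulrAC ler_peMl // exprn_ge0 // ltW // (lt_trans _ r1).
  rewrite ler_pM2r ?exprn_gt0 //; apply: le_trans hb _.
  by rewrite ler_pM2l.
have nE : n = (N + m)%N by rewrite /n /N mulSn addnC.
have r0 : 0 < abs r by apply: lt_trans r1.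
have le1 : abs r ^+ m <= T ^+ (2 * la * (G + N) + n + kap * N) * B.
  rewrite -(ler_pM2l (exprn_gt0 N r0)) -exprD -nE; apply: le_trans final _.
  by rewrite /Bd !exprD le_eqVlt; apply/orP; left; apply/eqP; ring.
have le2 : (2 * la * (G + N) + n + kap * N <= e * m)%N.
  rewrite (_ : e * m = 2 * la * (G * m + N) + n + kap * N)%N.
    by rewrite !leq_add2r leq_mul2l leq_add2r leq_pmulr ?orbT.
  rewrite /e /N /n; move: (kap) (G) (la) (m); clear => k x y z; ring.
have : abs r ^+ m <= T ^+ (e * m) * B.
  apply: le_trans le1 _; rewrite ler_pM2r ?(lt_le_trans _ B1) //.
  by rewrite ler_weXn2l // ltW.
rewrite rE -exprM /rho mulSn exprD mulrC ler_pM2l ?exprn_gt0 //.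
by rewrite leNgt hm.
Qed.

End Criterion.

(** * A twisted equation without solutions *)

Section Base.
Variable S : setting.
Local Notation L := (sL S).
Local Notation R := (sR S).
Local Notation abs := (@sabs S).
Local Notation q := (sq S).
Local Notation overFq := (@polyOverFq (sL S) q).
Local Notation theta := (stheta S).
Local Notation troot := (@troot S).
Local Notation T := (sabs (stheta S)).
Local Notation sg := (map_poly (@frob S)).

Definition tau : {poly L} := 'X - (theta ^+ q)%:P.

Lemma abs_sum_lt I (r : seq I) (P : pred I) (F : I -> L) (B : R) : 0 < B ->
  (forall i, P i -> abs (F i) < B) -> abs (\sum_(i <- r | P i) F i) < B.
Proof.
by move=> B0 h; elim/big_ind: _ => //; [rewrite abs0 | move=> *; apply: absD_lt].
Qed.

Lemma dominating_coef (P : {poly L}) : P != 0 -> exists i k0, P`_i != 0 /\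
  forall k, (k0 <= k)%N -> abs P.[troot k] = abs P`_i * abs (troot k) ^+ i.
Proof.
move=> P0; have szP : (0 < size P)%N by rewrite size_poly_gt0.
pose n := (size P).-1; have szPE : size P = n.+1 by rewrite prednK.
case: (@Order.TotalTheory.arg_maxP _ _ 'I_n.+1 ord0 xpredT (fun j : 'I_n.+1 => abs P`_j) isT) => i1 _ i1max.
have i1e : abs P`_i1 == abs P`_i1 by [].
case: (@arg_maxnP _ i1 (fun j : 'I_n.+1 => abs P`_j == abs P`_i1) (fun j => nat_of_ord j) i1e) => i /eqP iE imax.
have Pi0 : 0 < abs P`_i.
  rewrite iE; apply: lt_le_trans (i1max ord_max isT).
  by rewrite abs_gt0; have := P0; rewrite -lead_coef_eq0 lead_coefE szPE.
pose m := Num.max (\big[Num.max/0]_(j < n.+1 | abs P`_j < abs P`_i) abs P`_j) (abs P`_i / 2).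
have mlt : m < abs P`_i.
  rewrite gt_max; apply/andP; split; last by lra.
  by apply: Order.POrderTheory.bigmax_lt.
have m0 : 0 < m by rewrite lt_max divr_gt0 ?orbT.
have c1 : 1 < abs P`_i / m by rewrite ltr_pdivlMr // mul1r.
have [k0 hk0] := expr_unbounded (T ^+ n) c1.
exists i, k0; split; first by rewrite -abs_gt0.
move=> k kk0; have z1 := abs_troot_gt1 S k.
have z0 : 0 < abs (troot k) by apply: lt_trans z1.
have zn : abs (troot k) ^+ n < abs P`_i / m.
  rewrite ltNge; apply/negP => h.
  have : (abs P`_i / m) ^+ (q ^ k) <= (abs (troot k) ^+ n) ^+ (q ^ k).
    by rewrite lerXn2r ?nnegrE ?exprn_ge0 ?(ltW z0) // divr_ge0 // ltW.
  rewrite -exprM mulnC exprM abs_troot_expn leNgt (lt_le_trans hk0) //.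
  rewrite ler_weXn2l ?(ltW c1) //; apply: leq_trans kk0 _.
  by apply: ltnW; apply: ltn_expl; apply: q_gt1.
have zi : 0 < abs P`_i * abs (troot k) ^+ i by rewrite mulr_gt0 ?exprn_gt0.
rewrite horner_coef szPE (bigD1 i) //= -absX -absM; apply: absDl.
rewrite absM absX; apply: abs_sum_lt => // j ji; rewrite absM absX.
have jle : abs P`_j <= abs P`_i by rewrite iE; apply: i1max.
have [jilt|ijle] := ltnP j i.
  apply: le_lt_trans (_ : abs P`_i * abs (troot k) ^+ j < _).
    by rewrite ler_wpM2r ?exprn_ge0 // ltW.
  by rewrite ltr_pM2l // ltr_eXn2l.
have jlt : abs P`_j < abs P`_i.
  rewrite lt_neqAle jle andbT; apply: contraNneq ji => e.
  have : (j <= i)%N by apply: imax; rewrite /= e iE.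
  by move=> h; apply/eqP/val_inj/eqP; rewrite eqn_leq h.
have jm : abs P`_j <= m.
  by rewrite le_max; apply/orP; left; apply: (Order.TotalTheory.le_bigmax_cond _ (fun j : 'I_n.+1 => abs P`_j)).
apply: le_lt_trans (_ : m * abs (troot k) ^+ n < _).
  apply: ler_pM; rewrite ?abs_ge0 ?exprn_ge0 ?(ltW z0) //.
  by rewrite ler_weXn2l ?(ltW z1) // -ltnS.
apply: lt_le_trans (_ : abs P`_i <= _); first by rewrite mulrC -ltr_pdivlMr.
by rewrite ler_peMr ?(ltW Pi0) // exprn_ege1 // ltW.
Qed.

Lemma geom_q k : ((q - 1) * \sum_(i < k) q ^ i = q ^ k - 1)%N.
Proof.
elim: k => [|k IH]; first by rewrite big_ord0 muln0 expn0.
rewrite big_ord_recr /= mulnDr IH expnS.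
have := q_gt1 S; have : (0 < q ^ k)%N by rewrite expn_gt0 q_gt0.
by move: (q ^ k)%N => Q Q0 q1; rewrite mulnBl mul1n; nia.
Qed.

Section NoSolution.
Variables (N m1 m2 : nat) (a : L).
Hypotheses (N0 : (0 < N)%N) (a0 : a != 0) (aq : abs a ^+ (q - 1) < T ^+ (N * q)).
Hypothesis aK : abs a * T ^+ m1 = T ^+ m2.
Hypothesis qN : ~~ ((q - 1) %| N * q)%N.

(* At theta the equation gives A = aB, and going down the roots theta^(1/q^k) it determines
   |A|; comparing with the dominating coefficient of A forces q - 1 to divide Nq. *)
Lemma no_twisted_poly (A B : {poly L}) : overFq B -> B != 0 ->
  sg A = tau ^+ N * A + (a ^+ q) *: B -> False.
Proof.
move=> Bq B0 AE.
have T1 : 1 < T := sabs_theta S; have T0 : 0 < T by apply: lt_trans T1.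
have step x : frob A.[x] = (frob x - theta ^+ q) ^+ N * A.[frob x] + frob (a * B.[x]).
  rewrite frob_horner AE /tau !hornerE rmorphM /= overFq_frob //.
have At : A.[theta] = a * B.[theta].
  by apply: (@frob_inj S); rewrite step -frobE subrr expr0n (gtn_eqF N0) mul0r add0r.
pose D := (size B).-1.
have Bz k : abs B.[troot k] = abs (troot k) ^+ D by rewrite abs_overFq // abs_troot_gt1.
have stepz k : abs (frob A.[troot k.+1] - frob (a * B.[troot k.+1])) = T ^+ (N * q) * abs A.[troot k].
  rewrite step addrK frob_troot absM absX; congr (_ * _).
  rewrite mulnC exprM; congr (_ ^+ _); rewrite -[RHS]absX -absN opprB.
  apply: absDl; rewrite absN absX; apply: le_lt_trans (abs_troot_le S k) _.
  by rewrite ltr_eXnr // q_gt1.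
pose s k := (\sum_(i < k) q ^ i)%N.
have sS k : s k.+1 = (s k + q ^ k)%N by rewrite /s big_ord_recr.
have a1 : 0 < abs a by rewrite abs_gt0.
have V k : abs A.[troot k] ^+ (q ^ k) = abs a * T ^+ D * T ^+ (N * q * s k).
  elim: k => [|k IH].
    have Bth : abs B.[theta] = T ^+ D := Bz 0%N.
    by rewrite expn0 expr1 At absM Bth /s big_ord0 muln0 expr0 mulr1.
  have small : abs (frob (a * B.[troot k.+1])) < T ^+ (N * q) * abs A.[troot k].
    rewrite ltNge; apply/negP => h.
    have : (T ^+ (N * q) * abs A.[troot k]) ^+ (q ^ k) <= abs (frob (a * B.[troot k.+1])) ^+ (q ^ k).
      by rewrite lerXn2r ?nnegrE ?mulr_ge0 ?exprn_ge0 ?abs_ge0 // ltW.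
    rewrite abs_frob -exprM -expnS exprMn -exprM IH absM Bz exprMn -[X in _ <= _ * X]exprM.
    rewrite [(D * _)%N]mulnC [X in _ <= _ * X]exprM abs_troot_expn.
    rewrite mulrCA -exprD -mulnDr addnC -sS mulrAC ler_pM2r ?exprn_gt0 //.
    have qE : (q ^ k.+1 = ((q - 1) * s k.+1).+1)%N.
      by rewrite geom_q subn1 prednK // expn_gt0 q_gt0.
    rewrite qE exprS ler_pM2l // leNgt exprM [X in _ < X]exprM.
    rewrite ltrXn2r // ?nnegrE ?exprn_ge0 ?abs_ge0 ?(ltW T0) //.
    by rewrite -lt0n sS addn_gt0 expn_gt0 q_gt0 orbT.
  have e : abs A.[troot k.+1] ^+ q = T ^+ (N * q) * abs A.[troot k].
    rewrite -abs_frob -[in LHS](subrK (frob (a * B.[troot k.+1])) (frob _)).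
    by rewrite absDl ?stepz; last exact: small.
  by rewrite expnS exprM e exprMn IH sS mulnDr exprD -exprM; ring.
have A0 : A != 0.
  apply/negP => /eqP A0; have := V 0%N; rewrite A0 horner0 abs0 expn0 expr1.
  by move/esym/eqP; rewrite !mulf_eq0 !expf_eq0 (gt_eqF T0) (gt_eqF a1) !andbF.
have [i [k [Ai0 hk]]] := dominating_coef A0.
have V' j : (k <= j)%N -> abs A`_i ^+ (q ^ j) * T ^+ i = abs a * T ^+ D * T ^+ (N * q * s j).
  by move=> kj; rewrite -V hk // exprMn -[X in _ = _ * X]exprM [(i * _)%N]mulnC exprM abs_troot_expn.
have Ai1 : 0 < abs A`_i by rewrite abs_gt0.
have h1 := V' _ (leqnn k); have h2 := V' _ (leqnSn k).
have e1 : abs A`_i ^+ q = abs A`_i * T ^+ (N * q).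
  have qk : (0 < q ^ k)%N by rewrite expn_gt0 q_gt0.
  have p1 : 0 <= abs A`_i ^+ q by rewrite exprn_ge0 ?abs_ge0.
  have p2 : 0 <= abs A`_i * T ^+ (N * q) by rewrite mulr_ge0 ?abs_ge0 // exprn_ge0 ?(ltW T0).
  apply/eqP; rewrite -(eqrXn2 qk p1 p2).
  have ti : T ^+ i != 0 by rewrite gt_eqF // exprn_gt0.
  rewrite -exprM -expnS exprMn -exprM; apply/eqP/(mulIf ti).
  by rewrite h2 sS mulnDr exprD mulrA -h1 mulrAC.
have e2 : abs A`_i ^+ (q - 1) = T ^+ (N * q).
  apply: (mulfI (lt0r_neq0 Ai1)); rewrite -e1 -exprS; congr (_ ^+ _).
  by rewrite subn1 prednK // q_gt0.
have tA : T ^+ (N * q * q ^ k) = (abs A`_i ^+ (q ^ k)) ^+ (q - 1).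
  by rewrite exprAC e2 -exprM.
have : T ^+ (N * q * q ^ k + (i + m1) * (q - 1)) = T ^+ ((m2 + D + N * q * s k) * (q - 1)).
  rewrite exprD tA [X in _ * X]exprM -exprMn exprD mulrA h1 [RHS]exprM; congr (_ ^+ _).
  by rewrite !exprD -aK; ring.
move/(ieexprIn T0 (negbT (gt_eqF T1))) => e3.
case/negP: qN.
have e4 : (N * q * q ^ k = N * q * s k * (q - 1) + N * q)%N.
  rewrite -[(N * q * s k * _)%N]mulnA [(s k * _)%N]mulnC geom_q -mulnSr subn1 prednK //.
  by rewrite expn_gt0 q_gt0.
move: e3; rewrite e4 => e3.
rewrite -(dvdn_addr _ (_ : (q - 1) %| N * q * s k * (q - 1) + (i + m1) * (q - 1))%N).
  have -> : (N * q * s k * (q - 1) + (i + m1) * (q - 1) + N * q = (m2 + D + N * q * s k) * (q - 1))%N.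
    by rewrite -e3 addnAC.
  exact: dvdn_mull.
by rewrite dvdn_add ?dvdn_mull.
Qed.

Lemma no_twisted_solution (P f : {poly L}) : f != 0 ->
  f * sg P = sg f * tau ^+ N * (P + a *: f) -> False.
Proof.
move=> f0 PE.
pose g0 := gcdp P f; have g00 : g0 != 0 by rewrite gcdp_eq0 negb_and f0 orbT.
pose B0 := f %/ g0; have fE0 : f = B0 * g0 by rewrite divpK // dvdp_gcdr.
pose A0 := P %/ g0; have PE0 : P = A0 * g0 by rewrite divpK // dvdp_gcdl.
have B00 : B0 != 0 by apply: contraNneq f0 => h; rewrite fE0 h mul0r.
have cop0 : coprimep A0 B0 by rewrite coprimep_div_gcd // f0 orbT.
pose c := lead_coef B0; have c0 : c != 0 by rewrite lead_coef_eq0.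
pose B := c^-1 *: B0; pose A := c^-1 *: A0; pose g := c *: g0.
have Bm : B \is monic by rewrite monicE lead_coefZ mulVf.
have fE : f = B * g by rewrite fE0 /B /g -scalerAl -scalerAr scalerA mulVf // scale1r.
have PE' : P = A * g by rewrite PE0 /A /g -scalerAl -scalerAr scalerA mulVf // scale1r.
have cop : coprimep A B by rewrite coprimepZl ?coprimepZr // invr_eq0.
have g0' : g != 0 by rewrite scaler_eq0 negb_or c0.
have gg0 : g * sg g != 0 by rewrite mulf_neq0 // map_poly_eq0.
have eq1 : B * sg A = sg B * tau ^+ N * (A + a *: B).
  apply: (mulIf gg0); move: PE; rewrite {1}fE PE' !rmorphM /= fE rmorphM /=.
  rewrite scalerAl -mulrDl => h; transitivity (B * g * (sg A * sg g)); first by ring.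
  by rewrite h; ring.
have sBB : sg B = B.
  have dv : sg B %| B.
    suff : sg B %| B * sg A by rewrite Gauss_dvdpl // coprimep_sym coprimep_map.
    by rewrite eq1 -mulrA dvdp_mulr.
  apply/eqP; rewrite -eqp_monic ?map_monic // -dvdp_size_eqp // size_map_poly //.
have Bq : overFq B by apply/overFqP.
have B1 : B != 0 by apply: monic_neq0.
apply: (@no_twisted_poly (A + a *: B) B Bq B1).
have sgA : sg A = tau ^+ N * (A + a *: B).
  by apply: (mulfI B1); rewrite eq1 sBB mulrA.
by rewrite rmorphD /= sgA map_polyZ sBB /= frobE.
Qed.

End NoSolution.
End Base.

(** * Hasse derivatives *)

Lemma mpoly_hom_eq (n : nat) (A : comNzRingType) (B : comNzRingType)
  (f g : {rmorphism {mpoly A[n]} -> B}) (V : pred 'I_n) (P : {mpoly A[n]}) :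
  (forall c, f c%:MP = g c%:MP) -> (forall i, V i -> f 'X_i = g 'X_i) ->
  (forall m, m \in msupp P -> forall i, ~~ V i -> m i = 0%N) -> f P = g P.
Proof.
move=> hC hX hV; rewrite [P]mpolyE !rmorph_sum /= !big_seq; apply: eq_bigr => m hm.
rewrite -mul_mpolyC !rmorphM /= hC; congr (_ * _).
rewrite mpolyXE_id !rmorph_prod /=; apply: eq_bigr => i _; rewrite !rmorphXn /=.
by case Vi: (V i); [rewrite hX | rewrite (hV _ hm) ?Vi ?expr0].
Qed.

Lemma prime_pow_of_bin (K : idomainType) (p m : nat) : prime p -> p \in [pchar K] ->
  (0 < m)%N -> (forall i, (0 < i < m)%N -> ('C(m, i))%:R = 0 :> K) -> exists j, m = (p ^ j)%N.
Proof.
move=> pp pK m0 h; have [m' pm' mE] := pfactor_coprime pp m0.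
exists (logn p m); set k := (p ^ logn p m)%N in mE *.
have k0 : (0 < k)%N by rewrite expn_gt0 prime_gt0.
case: m' pm' mE => [|[|m']] pm' mE; first by move: m0; rewrite mE.
  by rewrite mE mul1n.
have km : (0 < k < m)%N by rewrite k0 mE -[X in (X < _)%N]mul1n ltn_mul2r k0.
have := h k km; have e : ((1 + 'X) ^+ m : {poly K}) = (1 + 'X^k) ^+ m'.+2.
  rewrite mE mulnC exprM; congr (_ ^+ _); rewrite exprDn_pchar ?expr1n //.
  have pP : p \in [pchar {poly K}] by rewrite pchar_poly.
  by rewrite (eq_pnat _ (pcharf_eq pP)) pnatX pnat_id.
have := congr1 (fun P : {poly K} => P`_k) e; rewrite !exprDn !coef_sum.
rewrite (bigD1 (Ordinal (leq_trans (proj2 (andP km)) (leqnSn m)))) //= big1 ?addr0; last first.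
  move=> i ik; rewrite expr1n mul1r coefMn coefXn eq_sym; case: eqP => [e'|]; rewrite ?mul0rn //.
  by case/eqP: ik; apply: val_inj; rewrite /= e'.
rewrite expr1n mul1r coefMn coefXn eqxx => ->.
rewrite (bigD1 (Ordinal (isT : (1 < m'.+3)%N))) //= big1 ?addr0; last first.
  move=> i i1; rewrite expr1n mul1r coefMn -exprM coefXn; case: eqP => [e'|]; rewrite ?mul0rn //.
  case/eqP: i1; apply: val_inj => /=.
  by apply/eqP; rewrite -(eqn_pmul2l k0) muln1 -e'.
rewrite expr1n mul1r coefMn expr1 coefXn eqxx bin1 => /eqP.
rewrite -(dvdn_pcharf pK) => dv; move: pm'; rewrite /coprime.
by move/gcdn_idPl: dv => ->; rewrite gtn_eqF // prime_gt1.
Qed.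

Section Hasse.
Variables (A : idomainType) (r : nat).
Local Notation Y := {mpoly A[r]}.
Implicit Types (P Q : Y) (V : seq 'I_r) (Z : 'I_r).

Definition mvars V P := forall m, m \in msupp P -> forall i, i \notin V -> m i = 0%N.

(* [taylor Z P] substitutes X_Z + t for X_Z. Its coefficients, the Hasse derivatives, do not
   lose information in positive characteristic, unlike iterated derivatives. *)
Definition taylor Z : Y -> {poly Y} :=
  mmap (polyC \o @mpolyC r A) (fun i => ('X_i)%:P + (i == Z)%:R *: 'X).
HB.instance Definition _ Z := GRing.RMorphism.copy (taylor Z)
  (mmap (polyC \o @mpolyC r A) (fun i => ('X_i)%:P + (i == Z)%:R *: 'X)).

Lemma taylorC Z c : taylor Z c%:MP = (c%:MP)%:P.
Proof. exact: mmapC. Qed.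

Lemma taylorX Z i : taylor Z 'X_i = ('X_i)%:P + (i == Z)%:R *: 'X.
Proof. by rewrite /taylor mmapX mmap1U. Qed.

Definition hasse Z m P := (taylor Z P)`_m.

Definition kill Z : Y -> Y := mmap (@mpolyC r A) (fun i => if i == Z then 0 else 'X_i).
HB.instance Definition _ Z := GRing.RMorphism.copy (kill Z)
  (mmap (@mpolyC r A) (fun i => if i == Z then 0 else 'X_i)).

Lemma killC Z c : kill Z c%:MP = c%:MP. Proof. exact: mmapC. Qed.
Lemma killX Z i : kill Z 'X_i = if i == Z then 0 else 'X_i.
Proof. by rewrite /kill mmapX mmap1U. Qed.

Lemma hasse_monomial Z k m : hasse Z k 'X_[m] = 'X_[m - U_(Z) *+ k] *+ 'C(m Z, k).
Proof.
rewrite /hasse mpolyXE_id rmorph_prod /= (bigD1 Z) //= rmorphXn /= taylorX eqxx scale1r.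
have -> : \prod_(i < r | i != Z) taylor Z ('X_i ^+ m i) = (\prod_(i < r | i != Z) 'X_i ^+ m i)%:P :> {poly Y}.
  rewrite rmorph_prod; apply: eq_bigr => i iZ /=.
  by rewrite rmorphXn /= taylorX (negPf iZ) scale0r addr0 rmorphXn.
rewrite coefMC exprDn coef_sum.
have [km|mk] := leqP k (m Z); last first.
  rewrite bin_small // mulr0n big1 ?mul0r // => i _.
  rewrite -rmorphXn coefMn coefCM coefXn gtn_eqF ?mulr0 ?mul0rn //.
  by apply: leq_trans mk; rewrite ltnS -ltnS.
rewrite (bigD1 (Ordinal (km : (k < (m Z).+1)%N))) //= big1 ?addr0; last first.
  move=> i ik; rewrite -rmorphXn coefMn coefCM coefXn; case: eqP => [e|]; rewrite ?mulr0 ?mul0rn //.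
  by case/eqP: ik; apply: val_inj.
rewrite -rmorphXn coefMn coefCM coefXn eqxx mulr1 mulrnAl; congr (_ *+ _).
rewrite [RHS]mpolyXE_id [RHS](bigD1 Z) //=; congr (_ * _).
  by rewrite mnmBE mulmnE mnm1E eqxx mul1n.
apply: eq_bigr => i iZ; rewrite mnmBE mulmnE mnm1E eq_sym (negPf iZ) mul0n subn0 //.
Qed.

Lemma hasse_is_linear Z k : linear (hasse Z k).
Proof.
move=> c P Q; rewrite /hasse -!mul_mpolyC rmorphD rmorphM /= taylorC coefD coefCM //.
Qed.
HB.instance Definition _ Z k := GRing.isLinear.Build A Y Y _ (hasse Z k) (hasse_is_linear Z k).

Lemma hasse_supp Z k P m' : m' \in msupp (hasse Z k P) ->
  exists2 m, m \in msupp P & (k <= m Z)%N /\ m' = (m - U_(Z) *+ k)%MM.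
Proof.
rewrite {1}[P]mpolyE linear_sum /= => /msupp_sum_le /flatten_mapP[m].
rewrite mem_filter /= => mP; rewrite linearZ /= => /msuppZ_le.
rewrite hasse_monomial; have [km|mk] := leqP k (m Z); last first.
  by rewrite bin_small // mulr0n msupp0.
move=> h; exists m => //; split=> //.
suff : m' \in msupp ('X_[m - U_(Z) *+ k] : Y) by rewrite msuppX inE => /eqP.
move: h; rewrite -scaler_nat => /msuppZ_le //.
Qed.

Lemma mvars_hasse V Z k P : mvars V P -> mvars V (hasse Z k P).
Proof.
move=> h m' /hasse_supp[m mP [km ->]] i iV.
by rewrite mnmBE (h _ mP) // sub0n.
Qed.

Lemma hasse_comm Z Z' k k' P : Z != Z' ->
  hasse Z k (hasse Z' k' P) = hasse Z' k' (hasse Z k P).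
Proof.
move=> ZZ; rewrite [P]mpolyE !linear_sum /=; apply: eq_bigr => m _.
rewrite !linearZ /=; congr (_ *: _); rewrite !hasse_monomial !linearMn /= !hasse_monomial.
rewrite !mnmBE !mulmnE !mnm1E (negPf ZZ) eq_sym (negPf ZZ) !mul0n !subn0 -!mulrnA mulnC; congr ('X_[_] *+ _).
by apply/mnmP => i; rewrite !mnmBE subnAC.
Qed.

Lemma hasse0 Z P : hasse Z 0 P = P.
Proof.
rewrite [P in RHS]mpolyE [P in LHS]mpolyE linear_sum /=; apply: eq_bigr => m _.
by rewrite linearZ /= hasse_monomial bin0 mulr1n mulm0n subm0.
Qed.

Lemma hasseC Z k c : (0 < k)%N -> hasse Z k c%:MP = 0.
Proof. by case: k => // k _; rewrite /hasse taylorC coefC. Qed.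

Definition free_of Z P := taylor Z P = P%:P.

Lemma free_hasse Z k P : free_of Z P -> (0 < k)%N -> hasse Z k P = 0.
Proof. by move=> h; case: k => // k _; rewrite /hasse h coefC. Qed.

Lemma hasse_eq0_supp Z P m : (forall k, (0 < k)%N -> hasse Z k P = 0) ->
  m \in msupp P -> m Z = 0%N.
Proof.
move=> h0 mP; apply/eqP/negPn/negP; rewrite -lt0n => mZ.
have := h0 _ mZ; rewrite [P]mpolyE linear_sum /=.
move/(congr1 (mcoeff (m - U_(Z) *+ m Z)%MM)); rewrite mcoeff0 raddf_sum /=.
rewrite (bigD1_seq m) ?msupp_uniq //= linearZ /= mcoeffZ hasse_monomial binn mulr1n mcoeffX eqxx mulr1.
rewrite big1_seq ?addr0 => [/eqP|m1 /andP[m1m m1P]]; first by rewrite mcoeff_eq0 mP.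
rewrite linearZ /= mcoeffZ hasse_monomial -scaler_nat mcoeffZ mcoeffX; case: eqP => [e1|]; rewrite ?mulr0 //.
case: (ltngtP (m1 Z) (m Z)) => [lt|gt|eq]; first by rewrite bin_small // mul0r mulr0.
  have := congr1 (fun m : 'X_{1..r} => m Z) e1; rewrite !mnmBE !mulmnE !mnm1E eqxx !mul1n.
  by rewrite subnn => /eqP; rewrite subn_eq0 leqNgt gt.
case/eqP: m1m; apply/mnmP => i; have := congr1 (fun m : 'X_{1..r} => m i) e1.
rewrite !mnmBE !mulmnE !mnm1E; case: eqP => [<-|_]; [by rewrite eq | by rewrite !mul0n !subn0].
Qed.

Lemma mvars_free V Z P : mvars V P -> Z \notin V -> free_of Z P.
Proof.
move=> h ZV; apply: (@mpoly_hom_eq _ _ _ (taylor Z) polyC (mem V)) => [c|i iV|m mP i iV].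
- exact: taylorC.
- rewrite /= taylorX (_ : i == Z = false) ?scale0r ?addr0 //.
  by apply: contraNF ZV => /eqP<-.
- exact: (h m mP i iV).
Qed.

Lemma freeC Z c : free_of Z c%:MP. Proof. exact: taylorC. Qed.

Lemma mvars_kill V Z P : mvars (Z :: V) P -> mvars V (kill Z P).
Proof.
move=> h m'; rewrite {1}[P]mpolyE rmorph_sum /= => /msupp_sum_le /flatten_mapP[m].
rewrite mem_filter /= => mP; rewrite -mul_mpolyC rmorphM /= killC mul_mpolyC => /msuppZ_le.
rewrite mpolyXE_id rmorph_prod /= => h1.
have [mZ|mZ] := eqVneq (m Z) 0%N; last first.
  by move: h1; rewrite (bigD1 Z) //= rmorphXn /= killX eqxx expr0n (negPf mZ) mul0r msupp0.
move: h1; have -> : \prod_(i < r) kill Z ('X_i ^+ m i) = 'X_[m].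
  rewrite [RHS]mpolyXE_id; apply: eq_bigr => i _; rewrite rmorphXn /= killX.
  by case: eqP => // ->; rewrite mZ !expr0.
rewrite msuppX inE => /eqP-> i iV; have [->//|iZ] := eqVneq i Z.
by apply: (h m mP); rewrite inE negb_or iZ.
Qed.

Lemma taylor_expansion Z P :
  P = \sum_(k < size (taylor Z P)) kill Z (hasse Z k P) * 'X_Z ^+ k.
Proof.
have -> : \sum_(k < size (taylor Z P)) kill Z (hasse Z k P) * 'X_Z ^+ k =
  (map_poly (kill Z) (taylor Z P)).['X_Z].
  rewrite (@horner_coef_wide _ (size (taylor Z P))) ?size_poly //.
  by apply: eq_bigr => i _; rewrite coef_map.
pose f : {rmorphism Y -> Y} := horner_eval 'X_Z \o (map_poly (kill Z) \o taylor Z).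
rewrite -[RHS]/(f P).
apply: (@mpoly_hom_eq _ _ _ idfun f predT) => [c|i _|//]; rewrite /= /horner_eval.
  by rewrite taylorC map_polyC hornerC /= killC.
rewrite taylorX rmorphD /= map_polyC /= killX map_polyZ /= map_polyX rmorph_nat !hornerE.
by case: eqP => [->|_]; rewrite ?mul1r ?add0r // mul0r addr0.
Qed.

Lemma mvars_nil P : mvars [::] P -> exists f, P = f%:MP.
Proof.
move=> h; exists P@_0%MM; apply/mpolyP => m; rewrite mcoeffC.
have [->|m0] := eqVneq m 0%MM; first by rewrite mulr1.
rewrite mulr0; apply/eqP; rewrite mcoeff_eq0; apply: contraNN m0 => mP.
by apply/eqP/mnmP => i; rewrite mnm0E (h m mP).
Qed.

End Hasse.

(** * Algebraic independence of functions *)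

Section SemiInvariants.
Variable S : setting.
Local Notation L := (sL S).
Local Notation abs := (@sabs S).
Local Notation p := (sp S).
Local Notation A := {poly L}.
Local Notation sg := (map_poly (@frob S)).
Local Notation tau := (tau S).
Variables (r : nat) (w : 'I_r -> nat) (b : 'I_r -> {mpoly A[r]}).
Local Notation Y := {mpoly A[r]}.
Implicit Types (P Q : Y) (V : seq 'I_r) (X Z : 'I_r).

(* The action of the Frobenius twist on polynomials in the functions F_i, for a system
   sigma F_i = tau^(w i) (F_i - b_i). *)
Definition shift : Y -> Y :=
  mmap (@mpolyC r A \o sg) (fun i => (tau ^+ w i)%:MP * ('X_i - b i)).
HB.instance Definition _ := GRing.RMorphism.copy shift
  (mmap (@mpolyC r A \o sg) (fun i => (tau ^+ w i)%:MP * ('X_i - b i))).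

Lemma shiftC c : shift c%:MP = (sg c)%:MP. Proof. exact: mmapC. Qed.
Lemma shiftX i : shift 'X_i = (tau ^+ w i)%:MP * ('X_i - b i).
Proof. by rewrite /shift mmapX mmap1U. Qed.

Lemma mpolyC_injective : injective (@mpolyC r A).
Proof. by move=> c d /eqP; rewrite -subr_eq0 -mpolyCB mpolyC_eq0 subr_eq0 => /eqP. Qed.

Lemma tau_neq0 k : tau ^+ k != 0.
Proof. by rewrite expf_neq0 // polyXsubC_eq0. Qed.

Lemma sg_eq0 (f : A) : (sg f == 0) = (f == 0). Proof. exact: map_poly_eq0. Qed.

Lemma tau_balance (f g : A) a c : f != 0 -> g != 0 ->
  f * sg g * tau ^+ a = sg f * g * tau ^+ c -> a = c.
Proof.
move=> f0 g0 /(congr1 (fun h : A => size h)).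
have t0 k := tau_neq0 k; have st k : size (tau ^+ k) = k.+1 by rewrite size_exp_XsubC.
rewrite !size_mul ?mulf_neq0 ?sg_eq0 // !st !size_map_poly.
have := f0; have := g0; rewrite -!size_poly_gt0; move: (size _) (size _) => x y; lia.
Qed.

Lemma hasse_shift V Z m P : mvars V P -> (forall v, v \in V -> free_of Z (b v)) ->
  hasse Z m (shift P) = (tau ^+ (w Z * m))%:MP * shift (hasse Z m P).
Proof.
move=> hV hb; pose c : Y := (tau ^+ w Z)%:MP.
have e : taylor Z (shift P) = (map_poly shift (taylor Z P)) \Po (c *: 'X).
  pose f : {rmorphism Y -> {poly Y}} := taylor Z \o shift.
  pose g : {rmorphism Y -> {poly Y}} := comp_poly (c *: 'X) \o (map_poly shift \o taylor Z).
  apply: (@mpoly_hom_eq _ _ _ f g (mem V)) => [d|i iV|]; last exact: hV.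
    by rewrite /= shiftC !taylorC map_polyC /= comp_polyC shiftC.
  rewrite /= taylorX shiftX !rmorphM !rmorphB /= taylorC taylorX (hb _ iV).
  rewrite rmorphD /= map_polyC map_polyZ /= map_polyX shiftX rmorph_nat.
  rewrite comp_polyD comp_polyC comp_polyZ comp_polyX.
  case: eqP => [->|_]; rewrite ?scale1r ?scale0r ?addr0.
    by rewrite rmorphM rmorphB /= -/c -mul_polyC; ring.
  by rewrite rmorphM rmorphB.
rewrite /hasse e; set Q := map_poly _ _.
have -> : (Q \Po (c *: 'X))`_m = Q`_m * c ^+ m.
  rewrite comp_polyE coef_sum.
  have [mQ|Qm] := ltnP m (size Q); last first.
    rewrite (nth_default _ Qm) mul0r big1 // => i _.
    by rewrite exprZn !coefZ coefXn gtn_eqF ?mulr0 // (leq_trans (ltn_ord i)).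
  rewrite (bigD1 (Ordinal mQ)) //= big1 ?addr0; last first.
    move=> i im; rewrite exprZn !coefZ coefXn; case: eqP => [e'|]; rewrite ?mulr0 //.
    by case/eqP: im; apply: val_inj.
  by rewrite exprZn !coefZ coefXn eqxx mulr1.
by rewrite /Q coef_map /= mulrC /c -rmorphXn /= -exprM.
Qed.

Definition semi_invariant P := exists v v' : A,
  [/\ v != 0, v' != 0 & v%:MP * shift P = v'%:MP * P].

Lemma semi_hasse V Z m P : mvars V P -> (forall v, v \in V -> free_of Z (b v)) ->
  semi_invariant P -> semi_invariant (hasse Z m P).
Proof.
move=> hV hb [v [v' [v0 v'0 e]]]; exists (v * tau ^+ (w Z * m)), v'; split=> //.
  by rewrite mulf_neq0 // tau_neq0.
by rewrite mpolyCM -mulrA -(hasse_shift _ hV hb) !mul_mpolyC -!linearZ /= -!mul_mpolyC e.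
Qed.

Lemma pchar_A : p \in [pchar A]. Proof. by rewrite pchar_poly sL_pchar. Qed.
Lemma pchar_Y : p \in [pchar Y].
Proof.
rewrite inE /= sp_prime /=; have := pchar_A; rewrite inE => /andP[_ /eqP h].
by rewrite -[p%:R](rmorph_nat (@mpolyC r A)) h rmorph0.
Qed.

Lemma exprD_ppow (x y : Y) j : (x + y) ^+ (p ^ j) = x ^+ (p ^ j) + y ^+ (p ^ j).
Proof.
by rewrite exprDn_pchar // (eq_pnat _ (pcharf_eq pchar_Y)) pnatX pnat_id ?sp_prime.
Qed.

Lemma exprB_ppow (x y : Y) j : (x - y) ^+ (p ^ j) = x ^+ (p ^ j) - y ^+ (p ^ j).
Proof.
have : x ^+ (p ^ j) = (x - y) ^+ (p ^ j) + y ^+ (p ^ j) by rewrite -exprD_ppow subrK.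
by move->; rewrite addrK.
Qed.

Lemma ppow_gt0 j : (0 < p ^ j)%N.
Proof. by rewrite expn_gt0 prime_gt0 // sp_prime. Qed.

(* The p-power exponent comes from the vanishing of the intermediate Hasse derivatives
   of f * Z^m0, which forces the binomials 'C(m0, i) to vanish mod p. *)
Lemma single_term Z P m0 (f : A) : (0 < m0)%N -> f != 0 -> hasse Z m0 P = f%:MP ->
  (forall m, (0 < m)%N -> m != m0 -> hasse Z m P = 0) ->
  exists j, m0 = (p ^ j)%N /\ P = kill Z P + f%:MP * 'X_Z ^+ m0.
Proof.
move=> m00 f0 hf h0.
have szm : (m0 < size (taylor Z P))%N.
  rewrite ltnNge; apply/negP => /(nth_default 0); rewrite -/(hasse Z m0 P) hf => /eqP.
  by rewrite mpolyC_eq0 (negPf f0).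
have PE : P = kill Z P + f%:MP * 'X_Z ^+ m0.
  rewrite {1}(taylor_expansion Z P).
  have sz0 : (0 < size (taylor Z P))%N by apply: leq_ltn_trans szm.
  rewrite (bigD1 (Ordinal sz0)) //= hasse0 expr0 mulr1; congr (_ + _).
  rewrite (bigD1 (Ordinal szm)) /=; last by rewrite -val_eqE /= -lt0n.
  rewrite hf killC big1 ?addr0 // => i /andP[i0 im].
  by rewrite h0 ?rmorph0 ?mul0r // lt0n.
have killfree : free_of Z (kill Z P).
  apply: (@mvars_free _ _ [seq i <- enum 'I_r | i != Z]); last by rewrite mem_filter eqxx.
  apply: mvars_kill => m _ i; rewrite inE mem_filter mem_enum inE andbT.
  by case: eqP.
have [j jE] : exists j, m0 = (p ^ j)%N.
  apply: (prime_pow_of_bin (sp_prime S) pchar_A m00) => i /andP[i0 im].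
  have := h0 i i0; rewrite neq_ltn im => /(_ isT).
  rewrite PE linearD /= (free_hasse killfree i0) add0r mul_mpolyC linearZ /= mpolyXn.
  rewrite hasse_monomial mulmnE mnm1E eqxx mul1n -scaler_nat scalerA => /(congr1 (mcoeff _)).
  move=> /(_ (U_(Z) *+ m0 - U_(Z) *+ i)%MM); rewrite mcoeffZ mcoeffX eqxx mulr1 mcoeff0.
  by move/eqP; rewrite mulf_eq0 (negPf f0) /= => /eqP.
by exists j.
Qed.

(* [admissible_diag] adds a function with constant b, such as the one of Li_(n_k), and
   [admissible_off] the one of Li_(n_l, ..., n_k), l < k, with Z the variable of
   Li_(n_l, ..., n_(k-1)) and W the one of Li_(n_k). *)
Inductive admissible : seq 'I_r -> Prop :=
| admissible_nil : admissible [::]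
| admissible_diag V X (a : L) : admissible V -> X \notin V -> (0 < w X)%N ->
    b X = a%:P%:MP -> (forall v, v \in V -> exists a' : L, b v = a'%:P%:MP) ->
    (forall Z, Z \in V -> forall i j, (w Z * p ^ i != w X * p ^ j)%N) ->
    (forall j (P f : A), f != 0 ->
       f * sg P = sg f * tau ^+ (w X * p ^ j) * (P + a ^+ (p ^ j) *: f) -> False) ->
    admissible (X :: V)
| admissible_off V X Z W (a : L) : admissible V -> X \notin V -> Z \in V -> W \in V ->
    Z != W -> b X = a%:P%:MP * ('X_Z - b Z) -> b W = a%:P%:MP ->
    w X = (w Z + w W)%N -> (0 < w W)%N -> (forall v, v \in V -> free_of Z (b v) /\ free_of W (b v)) ->
    (forall v, v \in X :: V -> free_of X (b v)) -> admissible (X :: V).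

Definition no_solution V X := forall j (f : A) P, f != 0 -> mvars V P ->
  f%:MP * shift P = (sg f * tau ^+ (w X * p ^ j))%:MP * (P + f%:MP * b X ^+ (p ^ j)) -> False.

Definition constants_only V := forall P, mvars V P -> semi_invariant P -> exists f : A, P = f%:MP.

Lemma constants_only_step V X : X \notin V -> (0 < w X)%N ->
  (forall v, v \in X :: V -> free_of X (b v)) ->
  constants_only V -> no_solution V X -> constants_only (X :: V).
Proof.
move=> XV wX hb SI NS.
suff H k : forall P, mvars (X :: V) P -> (forall m, m \in msupp P -> (m X < k)%N) ->
    semi_invariant P -> exists f : A, P = f%:MP.
  move=> P hP sP; apply: (H (\max_(m <- msupp P) m X).+1 P hP) => // m mP.
  by rewrite ltnS (bigD1_seq m) ?msupp_uniq //= leq_maxl.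
elim: k => [|k IH] P hP dP sP.
  have P0 : P = 0.
    apply: msuppnil0; case E: (msupp P) => [//|m s].
    by have := dP m; rewrite E mem_head => /(_ isT).
  by exists 0; rewrite P0 mpolyC0.
have hc m : (0 < m)%N -> exists f : A, hasse X m P = f%:MP.
  move=> m0; apply: IH; [exact: mvars_hasse | | exact: semi_hasse hb sP].
  move=> m' /hasse_supp[m1 m1P [mm ->]]; rewrite mnmBE mulmnE mnm1E eqxx mul1n.
  by have := dP _ m1P; lia.
have [v [v' [v0 v'0 e]]] := sP.
have he m (f : A) : hasse X m P = f%:MP -> v * tau ^+ (w X * m) * sg f = v' * f.
  move=> hf; have := congr1 (hasse X m) e; rewrite !mul_mpolyC !linearZ /= (hasse_shift _ hP hb) hf.
  by rewrite shiftC -!mul_mpolyC -!mpolyCM => /mpolyC_injective <-; rewrite mulrA.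
have [h0|[m0 [m00 f0]]] : (forall m, (0 < m)%N -> hasse X m P = 0) \/
   exists m, (0 < m)%N /\ hasse X m P != 0.
  have [|n1] := Classical_Prop.classic (exists m, (0 < m)%N /\ hasse X m P != 0); first by right.
  left=> m m0; apply/eqP/negPn/negP => h; apply: n1; by exists m.
- apply: SI sP => m mP i iV; have [->|iX] := eqVneq i X; last first.
    by apply: hP mP _ _; rewrite inE negb_or iX.
  exact: hasse_eq0_supp mP.
have [f hf] := hc _ m00; have fn0 : f != 0 by apply: contraNneq f0 => h; rewrite hf h mpolyC0.
have uniqm m : (0 < m)%N -> m != m0 -> hasse X m P = 0.
  move=> m1 mm; have [g hg] := hc _ m1; apply/eqP/negPn/negP => g0.
  have gn0 : g != 0 by apply: contraNneq g0 => h; rewrite hg h mpolyC0.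
  have ef := he _ _ hf; have eg := he _ _ hg.
  case/eqP: mm; apply/eqP; rewrite -(eqn_pmul2l wX); apply/eqP.
  apply: (@tau_balance f g _ _ fn0 gn0); apply: (mulfI (mulf_neq0 v0 v'0)).
  transitivity (v' * f * (v * tau ^+ (w X * m) * sg g)); first by ring.
  by rewrite eg -ef; ring.
have [j [jE PE]] := single_term m00 fn0 hf uniqm.
have kv : mvars V (kill X P) by apply: mvars_kill.
case: (NS j f (kill X P) fn0 kv).
have ef := he _ _ hf.
have e2 : v%:MP * shift (kill X P) = v'%:MP * (kill X P + f%:MP * b X ^+ m0).
  have : v%:MP * shift P = v'%:MP * P by [].
  rewrite {1}PE {1}[in RHS]PE rmorphD rmorphM rmorphXn /= shiftC shiftX exprMn -rmorphXn /= -exprM.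
  rewrite jE exprB_ppow -jE => h.
  have h2 : v%:MP * (sg f)%:MP * (tau ^+ (w X * m0))%:MP = v'%:MP * f%:MP :> Y.
    by rewrite -!mpolyCM mulrAC ef.
  have : v%:MP * shift (kill X P) + v%:MP * (sg f)%:MP * (tau ^+ (w X * m0))%:MP * ('X_X ^+ m0 - b X ^+ m0)
     = v'%:MP * (kill X P + f%:MP * 'X_X ^+ m0).
    by rewrite -h; ring.
  by rewrite h2 => /(canRL (addrK _)) ->; ring.
have vv : (v%:MP : Y) != 0 by rewrite mpolyC_eq0.
apply: (mulfI vv); rewrite mulrCA e2 -jE mulrA [RHS]mulrA; congr (_ * _).
by rewrite -!mpolyCM mulrC -ef; congr (_%:MP); ring.
Qed.

Lemma hasseCM Z m (c : A) P : hasse Z m (c%:MP * P) = c%:MP * hasse Z m P.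
Proof. by rewrite /hasse rmorphM /= taylorC coefCM. Qed.

Lemma hasseD Z m P Q : hasse Z m (P + Q) = hasse Z m P + hasse Z m Q.
Proof. exact: raddfD. Qed.

Lemma hasseB Z m P Q : hasse Z m (P - Q) = hasse Z m P - hasse Z m Q.
Proof. exact: raddfB. Qed.

Lemma no_solution_diag V X (a : L) : constants_only V ->
  b X = a%:P%:MP -> (forall v, v \in V -> exists a' : L, b v = a'%:P%:MP) ->
  (forall Z, Z \in V -> (0 < w Z)%N) -> (0 < w X)%N ->
  (forall Z, Z \in V -> forall i j, (w Z * p ^ i != w X * p ^ j)%N) ->
  (forall j (P f : A), f != 0 ->
       f * sg P = sg f * tau ^+ (w X * p ^ j) * (P + a ^+ (p ^ j) *: f) -> False) ->
  no_solution V X.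
Proof.
move=> SI bX bV wV wX hw hbase j f P f0 hP e.
have hb Z v : v \in V -> free_of Z (b v) by move=> /bV[a' ->]; apply: freeC.
set N := (w X * p ^ j)%N in e.
have bXE : f%:MP * b X ^+ (p ^ j) = (a ^+ (p ^ j) *: f)%:MP :> Y.
  by rewrite bX -!rmorphXn /= -mpolyCM -mul_polyC mulrC.
rewrite bXE in e.
have he Z m : (0 < m)%N -> f%:MP * ((tau ^+ (w Z * m))%:MP * shift (hasse Z m P)) =
    (sg f * tau ^+ N)%:MP * hasse Z m P.
  move=> m0; rewrite -(hasse_shift m hP (hb Z)).
  have h := congr1 (hasse Z m) e; rewrite !hasseCM hasseD (hasseC _ _ m0) addr0 in h.
  exact: h.
have hZ Z : Z \in V -> forall m, (0 < m)%N -> hasse Z m P = 0.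
  move=> ZV.
  have hc m : (0 < m)%N -> exists g : A, hasse Z m P = g%:MP.
    move=> m0; apply: SI; first exact: mvars_hasse.
    exists (f * tau ^+ (w Z * m)), (sg f * tau ^+ N); split.
    - by rewrite mulf_neq0 // tau_neq0.
    - by rewrite mulf_neq0 ?tau_neq0 // sg_eq0.
    - by rewrite mpolyCM -mulrA he.
  have hg m (g : A) : (0 < m)%N -> g != 0 -> hasse Z m P = g%:MP -> (w Z * m)%N = N.
    move=> m0 g0 hg; have := he Z m m0; rewrite hg shiftC -!mpolyCM => /mpolyC_injective eg.
    by apply: (tau_balance f0 g0); rewrite -mulrA [sg g * _]mulrC eg; ring.
  move=> m m0; apply/eqP/negPn/negP => hn0; have [g hgE] := hc _ m0.
  have g0 : g != 0 by apply: contraNneq hn0 => h; rewrite hgE h mpolyC0.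
  have [m' m'0 m'm|j' [mE _]] := single_term m0 g0 hgE.
    have [g' hgE'] := hc _ m'0; rewrite hgE'; have [->|g'0] := eqVneq g' 0; first by rewrite mpolyC0.
    case/eqP: m'm; apply/eqP; rewrite -(eqn_pmul2l (wV _ ZV)).
    by rewrite (hg _ _ m'0 g'0 hgE') (hg _ _ m0 g0 hgE).
  by have := hw Z ZV j' j; rewrite -mE (hg _ _ m0 g0 hgE) eqxx.
have [P0 PE] : exists P0 : A, P = P0%:MP.
  apply: mvars_nil => m mP i _; have [iV|iV] := boolP (i \in V); last exact: hP iV.
  exact: hasse_eq0_supp (hZ i iV) mP.
move: e; rewrite PE shiftC -mpolyCD -!mpolyCM => /mpolyC_injective.
exact: hbase.
Qed.

Lemma no_solution_off V X Z W (a : L) : constants_only V -> Z \in V -> W \in V ->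
  Z != W -> b X = a%:P%:MP * ('X_Z - b Z) -> b W = a%:P%:MP ->
  w X = (w Z + w W)%N -> (forall v, v \in V -> free_of Z (b v) /\ free_of W (b v)) ->
  no_solution V X.
Proof.
move=> SI ZV WV ZW bX bW wX hb j f P f0 hP e.
set D := (p ^ j)%N in e.
have D0 : (0 < D)%N by apply: ppow_gt0.
have hbZ v : v \in V -> free_of Z (b v) by move/hb=> [].
have hbW v : v \in V -> free_of W (b v) by move/hb=> [].
have freeXn i Q k : free_of i Q -> free_of i (Q ^+ k).
  by rewrite /free_of rmorphXn /= => ->; rewrite rmorphXn.
have bXD : f%:MP * b X ^+ D = (f * (a ^+ D)%:P)%:MP * ('X_Z ^+ D - b Z ^+ D).
  by rewrite bX exprMn /D exprB_ppow -/D mulrA mpolyCM -!rmorphXn.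
have hX i : hasse i D ('X_i ^+ D : Y) = 1.
  rewrite mpolyXn hasse_monomial mulmnE mnm1E eqxx mul1n binn mulr1n -mpolyX0; congr 'X_[_].
  by apply/mnmP => k; rewrite mnmBE mnm0E subnn.
have hX' i i' : i != i' -> hasse i D ('X_i' ^+ D : Y) = 0.
  move=> ii; apply: free_hasse => //; apply: freeXn.
  by rewrite /free_of taylorX eq_sym (negPf ii) scale0r addr0.
have e1 : f%:MP * shift (hasse Z D P) = (sg f * tau ^+ (w W * D))%:MP * (hasse Z D P + (f * (a ^+ D)%:P)%:MP).
  have := congr1 (hasse Z D) e; rewrite bXD !hasseCM hasseD !hasseCM hasseB.
  rewrite hX (free_hasse (freeXn _ _ D (hbZ _ ZV)) D0) subr0 (hasse_shift _ hP hbZ).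
  rewrite mulr1 wX mulnDl exprD => h.
  have tz : ((tau ^+ (w Z * D))%:MP : Y) != 0 by rewrite mpolyC_eq0 tau_neq0.
  apply: (mulfI tz); rewrite mulrCA h !mulrA -!mpolyCM; congr (_%:MP * _); ring.
have [g gE] : exists g : A, hasse Z D P + f%:MP * 'X_W ^+ D = g%:MP.
  apply: SI.
    move=> m /msuppD_le; rewrite mem_cat => /orP[|]; first exact: mvars_hasse hP m.
    rewrite mul_mpolyC => /msuppZ_le; rewrite mpolyXn msuppX inE => /eqP-> i iV.
    by rewrite mulmnE mnm1E; case: eqP => // e'; rewrite -e' WV in iV.
  exists f, (sg f * tau ^+ (w W * D)); split; first exact: f0.
    by rewrite mulf_neq0 ?tau_neq0 // sg_eq0.
  rewrite rmorphD rmorphM rmorphXn /= shiftC shiftX mulrDr e1 exprMn -rmorphXn /= -exprM.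
  rewrite /D exprB_ppow -/D bW -!rmorphXn /= !mpolyCM; ring.
have [g2 g2E] : exists g2 : A, hasse W D P = g2%:MP.
  apply: SI; first exact: mvars_hasse.
  exists (f * tau ^+ (w W * D)), (sg f * tau ^+ (w X * D)); split.
  - by rewrite mulf_neq0 // tau_neq0.
  - by rewrite mulf_neq0 ?tau_neq0 // sg_eq0.
  rewrite mpolyCM -mulrA -(hasse_shift _ hP hbW).
  have := congr1 (hasse W D) e; rewrite bXD !hasseCM hasseD !hasseCM hasseB.
  have WZ : W != Z by rewrite eq_sym.
  by rewrite (hX' _ _ WZ) (free_hasse (freeXn _ _ D (hbW _ ZV)) D0) subrr mulr0 addr0.
have : hasse Z D (hasse W D P) = 0 by rewrite g2E hasseC.
rewrite (hasse_comm _ _ _ ZW).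
have -> : hasse Z D P = g%:MP - f%:MP * 'X_W ^+ D by rewrite -gE addrK.
rewrite hasseB (hasseC _ _ D0) sub0r hasseCM hX mulr1 => /eqP.
by rewrite oppr_eq0 mpolyC_eq0 (negPf f0).
Qed.

Lemma admissible_weight_gt0 V : admissible V -> forall v, v \in V -> (0 < w v)%N.
Proof.
elim=> [//|V' X a _ IH _ wX _ _ _ _ v|V' X Z W a _ IH _ ZV WV _ _ _ wX wW _ _ v].
  by rewrite inE => /orP[/eqP->|/IH].
by rewrite inE => /orP[/eqP->|/IH//]; rewrite wX addn_gt0 wW orbT.
Qed.

Lemma constants_only_admissible V : admissible V -> constants_only V.
Proof.
elim=> [P hP _|V' X a aV IH XV wX bX bV hw hbase|V' X Z W a aV IH XV ZV WV ZW bX bW wX wW hb hbX].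
- exact: mvars_nil.
- apply: constants_only_step => //.
    by move=> v; rewrite inE => /orP[/eqP->|/bV[c ->]]; rewrite ?bX; apply: freeC.
  exact: (no_solution_diag IH bX bV (admissible_weight_gt0 aV)).
- apply: constants_only_step => //; first by rewrite wX addn_gt0 wW orbT.
  exact: (no_solution_off IH ZV WV ZW bX bW wX hb).
Qed.

Section FunctionalIndependence.
Variables (dep : 'I_r -> nat) (star : 'I_r) (vs : seq 'I_r).

Definition depth (m : 'X_{1..r}) := (\sum_i m i * dep i)%N.
Definition weight (m : 'X_{1..r}) := (\sum_i m i * w i)%N.
Definition below k P := forall m, m \in msupp P -> (depth m < k)%N.

Hypothesis b_depth : forall i, below (dep i) (b i).
Hypothesis vs_adm : admissible vs.
Hypothesis vs_all : forall i, (i \in vs) = (i != star).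
Hypothesis w_star : w star = 1%N.
Hypothesis b_star : b star = 0.
Hypothesis b_free : forall i, free_of star (b i).

Lemma depthD m m' : depth (m + m')%MM = (depth m + depth m')%N.
Proof. by rewrite /depth -big_split; apply: eq_bigr => i _ /=; rewrite mnmDE mulnDl. Qed.

Lemma depthU i : depth U_(i)%MM = dep i.
Proof.
rewrite /depth (bigD1 i) //= mnm1E eqxx mul1n big1 ?addn0 // => j ji.
by rewrite mnm1E eq_sym (negPf ji).
Qed.

(* With respect to [depth], [shift] is triangular on monomials; this gives minimal elements
   of the ideal of relations, which are then semi-invariant. *)
Definition leads (m : 'X_{1..r}) (c : A) P := below (depth m) (P - c *: 'X_[m]).

Lemma belowD k P Q : below k P -> below k Q -> below k (P + Q).
Proof. by move=> hP hQ m /msuppD_le; rewrite mem_cat => /orP[/hP|/hQ]. Qed.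

Lemma belowZ k c P : below k P -> below k (c *: P).
Proof. by move=> hP m /msuppZ_le /hP. Qed.

Lemma belowM k k' P Q : below k P -> below k'.+1 Q -> below (k + k') (P * Q).
Proof.
move=> hP hQ m /msuppM_le/allpairsP[[m1 m2] /= [/hP h1 /hQ h2 ->]].
by rewrite depthD; clear -h1 h2; lia.
Qed.

Lemma leads_below m c P : leads m c P -> below (depth m).+1 P.
Proof.
move=> h; rewrite -[P](subrK (c *: 'X_[m])); apply: belowD => m' => [/h /ltnW //|].
by move=> /msuppZ_le; rewrite msuppX inE => /eqP->.
Qed.

Lemma leadsM m c P m' c' Q : leads m c P -> leads m' c' Q ->
  leads (m + m')%MM (c * c') (P * Q).
Proof.
move=> hP hQ; rewrite /leads depthD.
have -> : P * Q - (c * c') *: 'X_[m + m'] =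
   (P - c *: 'X_[m]) * Q + (Q - c' *: 'X_[m']) * (c *: 'X_[m]).
  rewrite mpolyXD -!mul_mpolyC mpolyCM; ring.
apply: belowD; first exact: belowM hP (leads_below hQ).
rewrite addnC; apply: belowM => // m1 /msuppZ_le; rewrite msuppX inE => /eqP-> //.
Qed.

Lemma shift_leads m : leads m (tau ^+ weight m) (shift 'X_[m]).
Proof.
have l1 : leads 0%MM 1 (1 : Y).
  by rewrite /leads mpolyX0 scale1r subrr => m'; rewrite msupp0.
have lX i : leads U_(i)%MM (tau ^+ w i) (shift 'X_i).
  rewrite /leads shiftX mul_mpolyC scalerBr addrAC subrr add0r depthU -scaleNr.
  by apply: belowZ; apply: b_depth.
have lXn i k : leads (U_(i) *+ k)%MM (tau ^+ (w i * k)) (shift 'X_i ^+ k).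
  elim: k => [|k IH]; first by rewrite mulm0n muln0 !expr0.
  by rewrite exprS mulmS mulnS exprD; apply: leadsM.
have e : m = (\sum_i U_(i) *+ m i)%MM.
  apply/mnmP => j; rewrite mnm_sumE (bigD1 j) //= mulmnE mnm1E eqxx mul1n big1 ?addn0 // => i ij.
  by rewrite mulmnE mnm1E (negPf ij).
have key s : leads (\sum_(i <- s) U_(i) *+ m i)%MM (\prod_(i <- s) tau ^+ (w i * m i))
    (\prod_(i <- s) shift 'X_i ^+ m i).
  by elim: s => [|i s IH]; rewrite ?big_nil // !big_cons; apply: leadsM.
have -> : tau ^+ weight m = \prod_i tau ^+ (w i * m i).
  by rewrite -expr_sum /weight; congr (_ ^+ _); apply: eq_bigr => i _; rewrite mulnC.
have -> : shift 'X_[m] = \prod_i shift 'X_i ^+ m i.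
  by rewrite mpolyXE_id rmorph_prod /=; apply: eq_bigr => i _; rewrite rmorphXn.
by rewrite [X in leads X]e; apply: key.
Qed.

Lemma shift_coef P m : below (depth m).+1 P ->
  (shift P)@_m = sg P@_m * tau ^+ weight m.
Proof.
move=> hP.
have aux m' : (depth m' <= depth m)%N ->
    (shift 'X_[m'])@_m = tau ^+ weight m * (m' == m)%:R.
  move=> dm; have := @shift_leads m'; move: (shift 'X_[m']) => Q hQ.
  have -> : Q = (Q - tau ^+ weight m' *: 'X_[m']) + tau ^+ weight m' *: 'X_[m'] by rewrite subrK.
  rewrite mcoeffD mcoeffZ mcoeffX (_ : (_ - _)@_m = 0) ?add0r.
    by case: eqP => [->|]; rewrite ?mulr0.
  by apply/eqP; rewrite mcoeff_eq0; apply/negP => /hQ; rewrite ltnNge dm.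
rewrite {1}[P]mpolyE rmorph_sum /= raddf_sum /=.
have e m' : (shift (P@_m' *: 'X_[m']))@_m = sg P@_m' * (shift 'X_[m'])@_m.
  by rewrite -mul_mpolyC rmorphM /= shiftC mcoeffCM.
under eq_bigr => m' _ do rewrite e.
have [mP|mP] := boolP (m \in msupp P); last first.
  rewrite memN_msupp_eq0 // rmorph0 mul0r big1_seq // => m' /andP[_ m'P].
  rewrite aux; last by rewrite -ltnS; apply: hP.
  by case: eqP m'P mP => [->->//|_ _ _]; rewrite !mulr0.
rewrite (bigD1_seq m) ?msupp_uniq //= aux // eqxx mulr1 big1_seq ?addr0 // => m' /andP[mm m'P].
rewrite aux; last by rewrite -ltnS; apply: hP.
by rewrite (negPf mm) !mulr0.
Qed.

Lemma shift_below k P : below k P -> below k (shift P).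
Proof.
move=> hP m; rewrite {1}[P]mpolyE rmorph_sum /= => /msupp_sum_le /flatten_mapP[m'].
rewrite mem_filter /= => m'P; rewrite -mul_mpolyC rmorphM /= shiftC mul_mpolyC => /msuppZ_le.
move=> /(leads_below (@shift_leads m')) h.
by apply: leq_trans h _; apply: hP.
Qed.

Lemma free_kill Z P : free_of Z P -> kill Z P = P.
Proof.
move=> h; have := taylor_expansion Z P; rewrite h.
have [->|P0] := eqVneq P 0; first by move=> _; exact: rmorph0.
by rewrite size_polyC P0 big_ord1 hasse0 expr0 mulr1 => /esym.
Qed.

Lemma kill_shift P : kill star (shift P) = shift (kill star P).
Proof.
pose f : {rmorphism Y -> Y} := kill star \o shift.
pose g : {rmorphism Y -> Y} := shift \o kill star.
apply: (@mpoly_hom_eq _ _ _ f g predT) => [c|i _|//]; rewrite /f /g /=.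
  by rewrite shiftC !killC shiftC.
rewrite shiftX rmorphM rmorphB /= killC killX (free_kill (b_free i)).
case: eqP => [->|_]; first by rewrite b_star subr0 mulr0 rmorph0.
by rewrite shiftX.
Qed.

Lemma semi_invariant_monomial P : semi_invariant P ->
  exists (f : A) k, P = f%:MP * 'X_star ^+ k.
Proof.
move=> [v [v' [v0 v'0 e]]].
have hP : mvars (enum 'I_r) P by move=> m _ i; rewrite mem_enum.
have hb i : i \in enum 'I_r -> free_of star (b i) by move=> _; apply: b_free.
pose Pk k := kill star (hasse star k P).
have ek k : v%:MP * ((tau ^+ k)%:MP * shift (Pk k)) = v'%:MP * Pk k.
  have := congr1 (hasse star k) e; rewrite !hasseCM (hasse_shift _ hP hb) w_star mul1n.
  by move/(congr1 (kill star)); rewrite !rmorphM /= !killC kill_shift.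
have ck k : exists f : A, Pk k = f%:MP.
  apply: (constants_only_admissible vs_adm).
    apply: mvars_kill => m _ i; rewrite inE vs_all.
    by case: eqP.
  exists (v * tau ^+ k), v'; split; [by rewrite mulf_neq0 // tau_neq0 | exact: v'0 |].
  by rewrite mpolyCM -mulrA ek.
have PE := taylor_expansion star P.
have uniqk k1 k2 : Pk k1 != 0 -> Pk k2 != 0 -> k1 = k2.
  move=> h1 h2; have [f1 e1] := ck k1; have [f2 e2] := ck k2.
  have f10 : f1 != 0 by apply: contraNneq h1 => f0; rewrite e1 f0 mpolyC0.
  have f20 : f2 != 0 by apply: contraNneq h2 => f0; rewrite e2 f0 mpolyC0.
  have := ek k1; have := ek k2; rewrite e1 e2 !shiftC -!mpolyCM => /mpolyC_injective g2 /mpolyC_injective g1.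
  apply/esym; apply: (@tau_balance f1 f2 _ _ f10 f20); apply: (mulfI (mulf_neq0 v0 v'0)).
  transitivity (v' * f1 * (v * (tau ^+ k2 * sg f2))); first by ring.
  by rewrite g2 -g1; ring.
have [[k Pk0]|h0] := Classical_Prop.classic (exists k, Pk k != 0); last first.
  exists 0, 0%N; rewrite mpolyC0 mul0r PE big1 // => i _.
  have -> : kill star (hasse star i P) = 0; last by rewrite mul0r.
  by apply/eqP/negPn/negP => h; apply: h0; exists i.
have [f fE] := ck k; exists f, k; rewrite PE.
have ksz : (k < size (taylor star P))%N.
  rewrite ltnNge; apply/negP => /(nth_default 0); rewrite -/(hasse star k P) => h.
  by rewrite /Pk h rmorph0 eqxx in Pk0.
rewrite (bigD1 (Ordinal ksz)) //= -/(Pk k) fE big1 ?addr0 // => i ik.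
have -> : kill star (hasse star i P) = 0; last by rewrite mul0r.
apply/eqP/negPn/negP => h; case/eqP: ik; apply: val_inj => /=.
exact: uniqk h Pk0.
Qed.

Variable F : 'I_r -> L -> L.
Definition evaluate t : Y -> L := mmap (horner_eval t) (fun i => F i t).
HB.instance Definition _ t := GRing.RMorphism.copy (evaluate t)
  (mmap (horner_eval t) (fun i => F i t)).

Lemma evaluateC t c : evaluate t c%:MP = c.[t]. Proof. exact: mmapC. Qed.
Lemma evaluateX t i : evaluate t 'X_i = F i t.
Proof. by rewrite /evaluate mmapX mmap1U. Qed.

Hypothesis F_star : forall t, abs t <= 1 -> F star t != 0.
Hypothesis FE : forall t i, abs t <= 1 ->
  frob (F i (frobV t)) = tau.[t] ^+ w i * (F i t - evaluate t (b i)).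

Lemma evaluate_shift t P : abs t <= 1 -> evaluate t (shift P) = frob (evaluate (frobV t) P).
Proof.
move=> t1; pose f : {rmorphism Y -> L} := evaluate t \o shift.
pose g : {rmorphism Y -> L} := @frob S \o evaluate (frobV t).
apply: (@mpoly_hom_eq _ _ _ f g predT) => [c|i _|//]; rewrite /f /g /=.
  by rewrite shiftC !evaluateC frob_horner frobVK.
by rewrite shiftX rmorphM rmorphB /= evaluateC !evaluateX FE // horner_exp.
Qed.

Lemma poly_eq0_disc (f : A) : (forall t, abs t <= 1 -> f.[t] = 0) -> f = 0.
Proof.
move=> h; have [zs [szs uzs z1 _]] := unit_nodes S (size f).
apply/eqP/negPn/negP => f0.
have hz : all (root f) zs by apply/allP => z hz; rewrite rootE h ?z1.
by have := max_poly_roots f0 hz uzs; rewrite ltnNge szs.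
Qed.

Theorem functional_independence P : (forall t, abs t <= 1 -> evaluate t P = 0) -> P = 0.
Proof.
have [k hk] : exists k, below k P.
  exists (\max_(m <- msupp P) depth m).+1 => m mP.
  by rewrite ltnS (bigD1_seq m) ?msupp_uniq //= leq_maxl.
elim: k P hk => [|k IHk] P hk hP.
  by apply: msuppnil0; case E: (msupp P) => [//|m s]; have := hk m; rewrite E mem_head => /(_ isT).
have [n hn] : exists n, (count (fun m => depth m == k) (msupp P) <= n)%N by eexists.
elim: n P hk hP hn => [|n IHn] P hk hP hn.
  apply: IHk => // m mP; have := hk m mP; rewrite ltnS leq_eqVlt => /orP[mk|//].
  by move: hn; rewrite leqNgt -has_count; case/negP; apply/hasP; exists m.
have [/hasP[m0 m0P /eqP m0k]|hn0] := boolP (has (fun m => depth m == k) (msupp P)); last first.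
  by apply: IHn => //; rewrite leqNgt; apply/negP => h; case/negP: hn0; rewrite has_count (leq_trans _ h).
pose c := P@_m0; have c0 : c != 0 by rewrite /c -mcoeff_msupp.
pose c' := sg c * tau ^+ weight m0.
have c'0 : c' != 0 by rewrite mulf_neq0 ?tau_neq0 // sg_eq0.
pose Q := c *: shift P - c' *: P.
have Q0 : Q = 0.
  have coefQ m : depth m = k -> Q@_m = c * (sg P@_m * tau ^+ weight m) - c' * P@_m.
    by move=> mk; rewrite mcoeffB !mcoeffZ shift_coef // mk.
  apply: IHn.
  - rewrite /Q -scaleNr; apply: belowD; apply: belowZ => //; exact: shift_below.
  - move=> t t1; rewrite /Q -!mul_mpolyC rmorphB !rmorphM /= evaluate_shift //.
    rewrite !hP ?rmorph0 ?mulr0 ?subr0 //.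
    by apply: abs_frobV_le.
  - have sub m : m \in msupp Q -> depth m == k -> m \in rem m0 (msupp P).
      move=> mQ /eqP mk; rewrite mem_rem_uniq ?msupp_uniq // inE; apply/andP; split.
        apply: contraTneq mQ => ->; rewrite -mcoeff_eq0 coefQ // /c' -/c.
        by rewrite [_ * c]mulrC subrr.
      rewrite -[_ \in _]negbK; apply: contraTN mQ => mP.
      by rewrite -mcoeff_eq0 coefQ // memN_msupp_eq0 // rmorph0 mul0r !mulr0 subrr eqxx.
    have := count_rem m0 (fun m => depth m == k) (msupp P); rewrite m0P m0k eqxx /= => e.
    have le : (count (fun m => depth m == k) (msupp Q) <= count (fun m => depth m == k) (rem m0 (msupp P)))%N.
      rewrite -!size_filter; apply: uniq_leq_size; first by rewrite filter_uniq // msupp_uniq.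
      by move=> m; rewrite !mem_filter => /andP[mk mQ]; rewrite mk sub.
    by apply: leq_trans le _; rewrite e; lia.
have [f [j PE]] : exists (f : A) j, P = f%:MP * 'X_star ^+ j.
  apply: semi_invariant_monomial; exists c, c'; split=> //.
  by rewrite !mul_mpolyC; apply/eqP; rewrite -subr_eq0; apply/eqP.
rewrite PE (_ : f = 0) ?mpolyC0 ?mul0r //; apply: poly_eq0_disc => t t1.
have := hP t t1; rewrite PE rmorphM rmorphXn /= evaluateC evaluateX => /eqP.
by rewrite mulf_eq0 expf_eq0 (negPf (F_star t1)) andbF orbF => /eqP.
Qed.

End FunctionalIndependence.
End SemiInvariants.

(** * The function Omega *)

Section Functions.
Variable S : setting.
Local Notation L := (sL S).
Local Notation R := (sR S).
Local Notation abs := (@sabs S).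
Local Notation q := (sq S).
Local Notation theta := (stheta S).
Local Notation xi := (sxi S).
Local Notation T := (sabs (stheta S)).
Local Notation lim := (@lim (sR S) (sL S) (@sabs S)).
Local Notation is_lim := (@is_lim (sR S) (sL S) (@sabs S)).

Let T1 : 1 < T := sabs_theta S.
Let T0 : 0 < T := lt_trans ltr01 T1.

Lemma limE u x : is_lim u x -> lim u = x.
Proof.
move=> h; apply: (lim_unique _ h); rewrite /Defs.lim.
by apply: ClassicalEpsilon.epsilon_spec; exists x.
Qed.

Lemma lim_spec u : (exists x, is_lim u x) -> is_lim u (lim u).
Proof. by move=> [x hx]; rewrite (limE hx). Qed.

Lemma is_lim_ext u v x : (forall n, u n = v n) -> is_lim u x -> is_lim v x.
Proof. by move=> uv h e e0; have [N hN] := h e e0; exists N => m; rewrite -uv; apply: hN. Qed.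

Lemma is_limS u x : is_lim u x -> is_lim (fun n => u n.+1) x.
Proof. by move=> h e e0; have [N hN] := h e e0; exists N => m mN; apply: hN; apply: leqW. Qed.

Lemma is_limD u v x y : is_lim u x -> is_lim v y -> is_lim (fun n => u n + v n) (x + y).
Proof.
move=> hu hv e e0; have [N hN] := hu e e0; have [N' hN'] := hv e e0.
exists (maxn N N') => m; rewrite geq_max => /andP[mN mN'].
by rewrite opprD addrACA; apply: absD_lt; auto.
Qed.

Lemma is_lim_cst (c : L) : is_lim (fun=> c) c.
Proof. by move=> e e0; exists 0%N => m _; rewrite subrr abs0. Qed.

Lemma is_limMl (c : L) u x : is_lim u x -> is_lim (fun n => c * u n) (c * x).
Proof.
move=> hu; have [->|c0] := eqVneq c 0.
  by rewrite mul0r; apply: (is_lim_ext _ (is_lim_cst 0)) => n; rewrite mul0r.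
move=> e e0; have ac : 0 < abs c by rewrite abs_gt0.
have [N hN] := hu (e / abs c) ltac:(by rewrite divr_gt0).
by exists N => m /hN; rewrite -mulrBr absM ltr_pdivlMr // mulrC.
Qed.

Lemma is_lim_frob u x : is_lim u x -> is_lim (fun n => frob (u n)) (frob x).
Proof.
move=> hu e e0; have [N hN] := hu (Num.min 1 e) ltac:(by rewrite lt_min ltr01).
exists N => m /hN; rewrite lt_min => /andP[h1 h2].
rewrite -rmorphB /= abs_frob; apply: le_lt_trans h2.
by rewrite ler_iXnr ?abs_ge0 ?(ltW h1) // q_gt0.
Qed.

Lemma abs_lim_cst u x c : 0 < c -> (forall n, abs (u n) = c) -> is_lim u x -> abs x = c.
Proof.
move=> c0 uc hu; have [N hN] := hu c c0.
have h := hN N (leqnn N); rewrite -(uc N).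
have -> : x = u N + - (u N - x) by ring.
by apply: absDl; rewrite absN uc.
Qed.

Lemma is_limV u x : x != 0 -> is_lim u x -> is_lim (fun n => (u n)^-1) x^-1.
Proof.
move=> x0 hu e e0; have ax : 0 < abs x by rewrite abs_gt0.
have [N hN] := hu (Num.min (abs x) (e * abs x * abs x)) ltac:(by rewrite lt_min ax !mulr_gt0).
exists N => m /hN; rewrite lt_min => /andP[h1 h2].
have ux : abs (u m) = abs x.
  by rewrite -[u m](subrK x) addrC absDl.
have u0 : u m != 0 by rewrite -abs_gt0 ux.
have -> : (u m)^-1 - x^-1 = - (u m - x) / (u m * x) by field; rewrite u0 x0.
by rewrite abs_div absN absM ux ltr_pdivrMr ?mulr_gt0 // mulrA.
Qed.

Lemma step_dist (u : nat -> L) (e : R) N : 0 <= e ->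
  (forall n, (N <= n)%N -> abs (u n.+1 - u n) <= e) ->
  forall m, (N <= m)%N -> abs (u m - u N) <= e.
Proof.
move=> e0 h m; elim: m => [|m IH]; first by rewrite leqn0 => /eqP->; rewrite subrr abs0.
rewrite leq_eqVlt => /orP[/eqP<-|]; first by rewrite subrr abs0.
rewrite ltnS => Nm; have -> : u m.+1 - u N = (u m.+1 - u m) + (u m - u N) by ring.
by apply: absD; [apply: h | apply: IH].
Qed.

Lemma analytic_limit rho B (f : nat -> L -> L) (e : nat -> R) :
  (forall n, analytic rho B (f n)) ->
  (forall n t, abs t <= rho -> abs (f n.+1 t - f n t) <= e n) ->
  (forall eps : R, 0 < eps -> exists N, forall n, (N <= n)%N -> e n <= eps) ->
  analytic rho B (fun t => lim (f^~ t)) /\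
  forall t, abs t <= rho -> is_lim (f^~ t) (lim (f^~ t)).
Proof.
move=> hf hs he.
have hc (eps : R) : 0 < eps -> exists N, forall m k, (N <= m)%N -> (N <= k)%N ->
    forall t, abs t <= rho -> abs (f m t - f k t) <= eps.
  move=> e0; have [N hN] := he _ e0; exists N => m k Nm Nk t tr.
  have -> : f m t - f k t = (f m t - f N t) - (f k t - f N t) by ring.
  have hh n : (N <= n)%N -> abs (f n.+1 t - f n t) <= eps.
    by move=> Nn; apply: le_trans (hs _ _ tr) (hN _ Nn).
  by apply: absB; [apply: (@step_dist (f^~ t) _ N (ltW e0) hh m Nm) | apply: (@step_dist (f^~ t) _ N (ltW e0) hh k Nk)].
have hl t : abs t <= rho -> is_lim (f^~ t) (lim (f^~ t)).
  move=> tr; apply: lim_spec; apply: scomplete => eps e0.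
  have [N hN] := hc (eps / 2) ltac:(by rewrite divr_gt0); exists N => m k Nm Nk.
  by apply: le_lt_trans (hN m k Nm Nk t tr) _; lra.
by split=> //; apply: uniform_limit hf hc hl.
Qed.

Lemma geometric_to0 (c C : R) : 0 <= c < 1 -> 0 <= C -> forall eps : R, 0 < eps ->
  exists N, forall n, (N <= n)%N -> C * c ^+ n <= eps.
Proof.
move=> /andP[c0 c1] C0 eps e0; have [->|cn0] := eqVneq c 0.
  by exists 1%N => -[//|n] _; rewrite expr0n mulr0 ltW.
have cp : 0 < c by rewrite lt_def cn0.
have [N hN] := @expr_unbounded R c^-1 (C / eps) ltac:(by rewrite invf_gt1).
exists N => n Nn; apply: le_trans (_ : C * c ^+ N <= _).
  by rewrite ler_wpM2l // ler_wiXn2l // ltW.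
move: hN; rewrite exprVn ltr_pdivrMr // mulrC ltr_pdivlMr ?exprn_gt0 //.
exact: ltW.
Qed.

Lemma analytic_twist rho B f : 1 <= rho -> analytic rho B f ->
  analytic rho (B ^+ q) (fun t : L => frob (f (frobV t))).
Proof.
move=> r1 [h1 h2]; split=> [t tr|eps e0].
  rewrite abs_frob lerXn2r ?nnegrE ?abs_ge0 ?h1 ?abs_frobV_le //.
  by apply: le_trans (h1 0 _); rewrite ?abs_ge0 // abs0 (le_trans ler01).
have [P hP] := h2 (Num.min 1 eps) ltac:(by rewrite lt_min ltr01).
exists (map_poly (@frob S) P) => t tr.
rewrite -[in X in _ - X](frobVK t) -frob_horner -rmorphB /= abs_frob.
have := hP (frobV t) (abs_frobV_le r1 tr); rewrite le_min => /andP[p1 p2].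
by apply: le_trans p2; rewrite ler_iXnr ?abs_ge0 // q_gt0.
Qed.

Lemma qm1_gt0 : (0 < q - 1)%N. Proof. by rewrite subn_gt0 q_gt1. Qed.

Lemma xi_neq0 : xi != 0.
Proof.
have : - theta != 0 by rewrite oppr_eq0 -abs_gt0.
rewrite -(sxiE S); apply: contraNneq => ->.
by rewrite expr0n -/(sq S) gtn_eqF // qm1_gt0.
Qed.

Definition norm_omega := abs (xi ^- q).

Lemma norm_omega_gt0 : 0 < norm_omega.
Proof. by rewrite abs_gt0 invr_eq0 expf_neq0 // xi_neq0. Qed.

Lemma norm_omega_expr : norm_omega ^+ (q - 1) = T ^- q.
Proof.
have h : xi ^+ (q - 1) = - theta := sxiE S.
by rewrite /norm_omega absV absX exprVn exprAC -[abs xi ^+ _]absX h absN.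
Qed.

Definition omegaN N t := xi ^- q * \prod_(i < N) (1 - t / theta ^+ (q ^ i.+1)).
Definition omega t := lim (omegaN^~ t).

Lemma omegaNS N t : omegaN N.+1 t = omegaN N t * (1 - t / theta ^+ (q ^ N.+1)).
Proof. by rewrite /omegaN big_ord_recr /= mulrA. Qed.

Lemma Texp_ge k : T ^+ k <= T ^+ (q ^ k).
Proof. by rewrite ler_weXn2l ?(ltW T1) // ltnW // ltn_expl // q_gt1. Qed.

Lemma abs_tq k (t : L) : abs (t / theta ^+ (q ^ k)) <= abs t / T ^+ k.
Proof.
rewrite abs_div absX ler_wpM2l ?abs_ge0 // lef_pV2 ?posrE ?exprn_gt0 //.
exact: Texp_ge.
Qed.

Lemma omegaN_bound r N t : abs t <= T ^+ r -> abs (omegaN N t) <= norm_omega * (T ^+ r) ^+ (minn N r).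
Proof.
move=> tr; have Tr1 : 1 <= T ^+ r by rewrite exprn_ege1 // ltW.
elim: N => [|N IH]; first by rewrite min0n expr0 mulr1 /omegaN big_ord0 mulr1.
rewrite omegaNS absM; have [rN|Nr] := leqP r N.
  rewrite (minn_idPr (leqW rN)); rewrite (minn_idPr rN) in IH.
  rewrite -[leRHS]mulr1; apply: ler_pM; rewrite ?abs_ge0 //.
  apply: absB; first by rewrite abs1.
  apply: le_trans (abs_tq _ _) _; rewrite ler_pdivrMr ?exprn_gt0 // mul1r.
  by apply: le_trans tr _; rewrite ler_weXn2l ?(ltW T1) // ltnW.
rewrite (minn_idPl Nr); rewrite (minn_idPl (ltnW Nr)) in IH.
rewrite exprSr mulrA; apply: ler_pM; rewrite ?abs_ge0 //.
apply: absB; first by rewrite abs1.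
apply: le_trans (abs_tq _ _) _; rewrite ler_pdivrMr ?exprn_gt0 //.
by apply: le_trans tr _; rewrite ler_peMr ?exprn_ge0 ?(ltW T0) // exprn_ege1 // ltW.
Qed.

Lemma omegaN_analytic r N : analytic (T ^+ r) (norm_omega * (T ^+ r) ^+ r) (omegaN N).
Proof.
have Tr1 : 1 <= T ^+ r by rewrite exprn_ege1 // ltW.
pose P : {poly L} := xi ^- q *: \prod_(i < N) (1 - (theta ^+ (q ^ i.+1))^-1 *: 'X).
have PE t : omegaN N t = P.[t].
  rewrite hornerZ horner_prod; congr (_ * _); apply: eq_bigr => i _.
  by rewrite !hornerE mulrC.
apply: (analytic_ext (f := fun t => P.[t])) => [t _|]; first by rewrite PE.
apply: analytic_poly => t tr; rewrite -PE; apply: le_trans (omegaN_bound N tr) _.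
rewrite ler_wpM2l ?abs_ge0 // ler_weXn2l // geq_minr //.
Qed.

Lemma omega_limit r : analytic (T ^+ r) (norm_omega * (T ^+ r) ^+ r) omega /\
  forall t, abs t <= T ^+ r -> is_lim (omegaN^~ t) (omega t).
Proof.
have Tr0 : 0 <= T ^+ r by rewrite exprn_ge0 // ltW.
have C0 : 0 <= norm_omega * (T ^+ r) ^+ r * T ^+ r by rewrite !mulr_ge0 ?exprn_ge0 ?abs_ge0.
apply: (@analytic_limit _ _ omegaN (fun n => norm_omega * (T ^+ r) ^+ r * T ^+ r * (T^-1) ^+ n)).
- exact: omegaN_analytic.
- move=> n t tr; rewrite omegaNS -[X in _ - X]mulr1 -mulrBr absM -mulrA.
  apply: ler_pM; rewrite ?abs_ge0 //; first exact: analytic_bound (omegaN_analytic r n) _ tr.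
  rewrite addrAC subrr sub0r absN; apply: le_trans (abs_tq _ _) _.
  rewrite exprVn; apply: ler_pM; rewrite ?abs_ge0 ?invr_ge0 ?exprn_ge0 ?(ltW T0) //.
  by rewrite lef_pV2 ?posrE ?exprn_gt0 // ler_weXn2l // ltW.
- apply: geometric_to0 => //; rewrite invr_ge0 (ltW T0) /=.
  by rewrite invf_lt1.
Qed.

Lemma disc_pow (t : L) : exists r, abs t <= T ^+ r.
Proof. by have [r hr] := expr_unbounded (abs t) T1; exists r; apply: ltW. Qed.

Lemma omega_lim t : is_lim (omegaN^~ t) (omega t).
Proof. by have [r tr] := disc_pow t; apply: (omega_limit r).2. Qed.

Lemma abs_omega t : abs t <= T -> abs (omega t) = norm_omega.
Proof.
move=> tT; apply: (abs_lim_cst norm_omega_gt0 _ (omega_lim t)) => n.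
elim: n => [|n IH]; first by rewrite /omegaN big_ord0 mulr1.
rewrite omegaNS absM IH; have -> : abs (1 - t / theta ^+ (q ^ n.+1)) = 1; last by rewrite mulr1.
rewrite -[RHS](@abs1 S); apply: absDl; rewrite absN abs1 abs_div absX.
rewrite ltr_pdivrMr ?exprn_gt0 // mul1r; apply: le_lt_trans tT _.
rewrite ltr_eXnr // expnS; have := q_gt1 S; have : (0 < q ^ n)%N by rewrite expn_gt0 q_gt0.
by move: (q ^ n)%N => Q; nia.
Qed.

Lemma omega_neq0 t : abs t <= T -> omega t != 0.
Proof. by move=> tT; rewrite -abs_gt0 abs_omega // norm_omega_gt0. Qed.

Lemma omegaE t : omega t = (tau S).[t] * frob (omega (frobV t)).
Proof.
have step N : omegaN N.+1 t = (tau S).[t] * frob (omegaN N (frobV t)).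
  rewrite /omegaN big_ord_recl rmorphM rmorph_prod /=.
  have -> : \prod_(i < N) frob (1 - frobV t / theta ^+ (q ^ i.+1)) =
      \prod_(i < N) (1 - t / theta ^+ (q ^ (bump 0 i).+1)).
    apply: eq_bigr => i _; rewrite rmorphB rmorph1 rmorphM fmorphV /= frobVK.
    by rewrite rmorphXn /= frobE -exprM -expnS.
  rewrite !mulrA; congr (_ * _); rewrite fmorphV rmorphXn /= frobE expn1.
  rewrite /tau !hornerE.
  have xq : xi ^+ q * (- theta ^+ q) = (xi ^+ q) ^+ q.
    have h : xi ^+ (q - 1) = - theta := sxiE S.
    have -> : - theta ^+ q = (xi ^+ (q - 1)) ^+ q by rewrite h -!frobE rmorphN.
    by rewrite -exprMn -exprS subn1 prednK // q_gt0.
  have x0 : xi ^+ q != 0 by rewrite expf_neq0 // xi_neq0.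
  have t0 : theta ^+ q != 0 by rewrite expf_neq0 // -abs_gt0.
  have xx0 : xi ^+ q ^+ q != 0 by rewrite expf_neq0.
  rewrite -[xi ^+ q ^- q]/((xi ^+ q) ^+ q)^-1 -xq; field; rewrite ?oppr_eq0 ?t0 ?x0 //.
apply: (lim_unique (is_limS (omega_lim t))).
apply: (is_lim_ext (u := fun n => (tau S).[t] * frob (omegaN n (frobV t)))) => [n|].
  by rewrite step.
by apply: is_limMl; apply: is_lim_frob; apply: omega_lim.
Qed.

Lemma omega_theta : omega theta = (pitilde abs q theta xi)^-1.
Proof.
have prodE N : \prod_(1 <= i < N.+1) (1 - theta ^- (q ^ i - 1))^-1 = (xi ^+ q * omegaN N theta)^-1.
  rewrite /omegaN mulrA mulfV ?expf_neq0 ?xi_neq0 // mul1r big_add1 /= big_mkord.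
  rewrite (big_morph _ (@invfM L) (invr1 L)); apply: eq_bigr => i _; congr ((1 - _)^-1).
  have th0 : theta != 0 by rewrite -abs_gt0.
  have Q0 : (0 < q ^ i.+1)%N by rewrite expn_gt0 q_gt0.
  by move: Q0; case: (q ^ i.+1)%N => // k _; rewrite subn1 exprS invfM mulrA mulfV ?mul1r.
have x0 : xi ^+ q != 0 by rewrite expf_neq0 // xi_neq0.
have o0 : omega theta != 0 by apply: omega_neq0.
have l1 : is_lim (fun N => (xi ^+ q * omegaN N theta)^-1) (xi ^+ q * omega theta)^-1.
  by apply: is_limV; [rewrite mulf_neq0 | apply: is_limMl; apply: omega_lim].
rewrite /pitilde (limE (is_lim_ext (fun n => esym (prodE n)) l1)).
by rewrite invfM invrK mulKf.
Qed.

End Functions.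

(** * The series attached to polylogarithms *)

Section Polylogs.
Variable S : setting.
Local Notation L := (sL S).
Local Notation R := (sR S).
Local Notation abs := (@sabs S).
Local Notation q := (sq S).
Local Notation theta := (stheta S).
Local Notation T := (sabs (stheta S)).
Local Notation lim := (@lim (sR S) (sL S) (@sabs S)).
Local Notation is_lim := (@is_lim (sR S) (sL S) (@sabs S)).
Local Notation omega := (@omega S).
Local Notation norm_omega := (norm_omega S).

Let T1 : 1 < T := sabs_theta S.
Let T0 : 0 < T := lt_trans ltr01 T1.

Definition omega_iter i (t : L) : L := iter i (@frob S) (omega (iter i (@frobV S) t)).

Lemma omega_iterS i t : omega_iter i.+1 t = frob (omega_iter i (frobV t)).
Proof. by rewrite /omega_iter iterS [in iter i.+1 _ t]iterSr. Qed.

Lemma omega_iter_prod i t : omega t = \prod_(j < i) (t - theta ^+ (q ^ j.+1)) * omega_iter i t.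
Proof.
elim: i t => [|i IH] t; first by rewrite big_ord0 mul1r.
rewrite omegaE (IH (frobV t)) rmorphM rmorph_prod /= -omega_iterS big_ord_recl mulrA; congr (_ * _ * _).
  by rewrite /tau !hornerE expn1.
apply: eq_bigr => j _; rewrite rmorphB /= frobVK rmorphXn /= frobE -exprM -expnS.
by [].
Qed.

Fixpoint nested_sum (s : seq (nat * L)) (N : nat) (t : L) : L :=
  if s is (m, z) :: s' then \sum_(i < N) (z ^+ (q ^ i) * omega_iter i t ^+ m) * nested_sum s' i t else 1.

Definition nested_series s t := lim (fun N => nested_sum s N t).
Definition total_weight (s : seq (nat * L)) := sumn (map fst s).

Lemma theta_sub_neq0 i : theta - theta ^+ (q ^ i.+1) != 0.
Proof.
rewrite subr_eq0; apply/eqP => /(congr1 abs) /eqP; rewrite absX -{1}[T]expr1.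
rewrite (inj_eq (ieexprIn T0 (negbT (gt_eqF T1)))) => /eqP e.
have : (0 < q ^ i)%N by rewrite expn_gt0 q_gt0.
by have := q_gt1 S; move: e; rewrite expnS; move: (q ^ i)%N => Q; nia.
Qed.

Lemma omega_iter_theta i : omega_iter i theta = omega theta / carlitzL q theta i.
Proof.
have cE : carlitzL q theta i = \prod_(j < i) (theta - theta ^+ (q ^ j.+1)).
  by rewrite /carlitzL big_add1 /= big_mkord.
have cL0 : carlitzL q theta i != 0.
  by rewrite cE; apply/prodf_neq0 => j _; apply: theta_sub_neq0.
by rewrite (omega_iter_prod i) -cE mulrC mulKf.
Qed.

Lemma nested_sum_theta s N : nested_sum s N theta = omega theta ^+ total_weight s * Li_partial q theta s N.
Proof.
elim: s N => [|[m z] s IH] N /=; first by rewrite expr0 mulr1.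
rewrite mulr_sumr; apply: eq_bigr => i _; rewrite IH omega_iter_theta /total_weight /= exprD expr_div_n.
by ring.
Qed.

Lemma frob_expq i (x : L) : frob (x ^+ (q ^ i)) = x ^+ (q ^ i.+1).
Proof. by rewrite frobE -exprM -expnSr. Qed.

Lemma nested_sum_rcons s m z N t : nested_sum (rcons s (m, z)) N.+1 t =
  frob (nested_sum (rcons s (m, z)) N (frobV t)) + z * omega t ^+ m * frob (nested_sum s N (frobV t)).
Proof.
elim: s N t => [|[m' z'] s IH] N t /=.
  rewrite big_ord_recl /= expn0 expr1 mulr1 rmorph1 mulr1 addrC; congr (_ + _).
  rewrite rmorph_sum; apply: eq_bigr => i _ /=.
  by rewrite !mulr1 rmorphM /= frob_expq rmorphXn /= -omega_iterS /bump /= add1n.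
rewrite big_ord_recl.
have -> : nested_sum (rcons s (m, z)) 0 t = 0 by case: (s) => [|[? ?] ?] /=; rewrite big_ord0.
rewrite mulr0 add0r !rmorph_sum mulr_sumr -big_split; apply: eq_bigr => i _ /=.
rewrite /bump /= add1n IH !rmorphM /= frob_expq rmorphXn /= -omega_iterS.
by ring.
Qed.

Definition convergent (s : seq (nat * L)) :=
  forall mz, mz \in s -> abs mz.2 ^+ (q - 1) < T ^+ (mz.1 * q).

Lemma ratio_lt1 m (z : L) : abs z ^+ (q - 1) < T ^+ (m * q) -> abs z * norm_omega ^+ m < 1.
Proof.
move=> h; rewrite ltNge; apply/negP => h1.
have c00 := norm_omega_gt0 S.
have : 1 <= (abs z * norm_omega ^+ m) ^+ (q - 1) by rewrite exprn_ege1.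
rewrite exprMn exprAC norm_omega_expr -exprVn -exprM mulnC exprVn leNgt ltr_pdivrMr ?exprn_gt0 // mul1r.
by rewrite h.
Qed.

Lemma omega_iter_analytic r i : exists B, analytic (T ^+ r) B (omega_iter i).
Proof.
have r1 : 1 <= T ^+ r by rewrite exprn_ege1 // ltW.
elim: i => [|i [B hB]]; first by eexists; apply: (omega_limit S r).1.
by exists (B ^+ q); apply: (analytic_ext _ (analytic_twist r1 hB)) => t _; rewrite omega_iterS.
Qed.

Lemma abs_iter_frobV i (x : L) : abs (iter i (@frobV S) x) ^+ (q ^ i) = abs x.
Proof. by rewrite -absX -iter_frobE iter_frobVK. Qed.

Lemma abs_omega_iter r i t : (r <= i)%N -> abs t <= T ^+ r -> abs (omega_iter i t) = norm_omega ^+ (q ^ i).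
Proof.
move=> ri tr; rewrite /omega_iter iter_frobE absX abs_omega //.
rewrite leNgt; apply/negP => h.
have : T ^+ (q ^ i) < abs (iter i (@frobV S) t) ^+ (q ^ i).
  by rewrite ltrXn2r ?nnegrE ?abs_ge0 ?(ltW T0) // -lt0n expn_gt0 q_gt0.
rewrite abs_iter_frobV ltNge (le_trans tr) //; apply: le_trans (Texp_ge S r) _.
by rewrite ler_weXn2l ?(ltW T1) // leq_exp2l // q_gt1.
Qed.

Lemma nested_sum_analytic s r : convergent s ->
  (exists2 B, 0 <= B & forall N, analytic (T ^+ r) B (nested_sum s N)) /\
  exists e : nat -> R, (forall n t, abs t <= T ^+ r -> abs (nested_sum s n.+1 t - nested_sum s n t) <= e n) /\
    (forall eps : R, 0 < eps -> exists N, forall n, (N <= n)%N -> e n <= eps).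
Proof.
elim: s => [|[m z] s IH] hs.
  split.
    by exists 1 => // N; apply: analyticW (analytic_cst (T ^+ r) (1 : L)); rewrite abs1.
  exists (fun=> 0); split=> [n t _|eps e0]; first by rewrite /= subrr abs0.
  by exists 0%N => n _; apply: ltW.
have [|[B B0 hB] _] := IH; first by move=> mz h; apply: hs; rewrite inE h orbT.
have zm := ratio_lt1 (hs (m, z) (mem_head _ _)).
set k := abs z * norm_omega ^+ m in zm.
have c00 := norm_omega_gt0 S.
have k0 : 0 <= k by rewrite mulr_ge0 ?abs_ge0 // exprn_ge0 // ltW.
pose term i t := (z ^+ (q ^ i) * omega_iter i t ^+ m) * nested_sum s i t.
have tb i t : (r <= i)%N -> abs t <= T ^+ r -> abs (term i t) <= B * k ^+ i.
  move=> ri tr; rewrite /term absM mulrC; apply: ler_pM; rewrite ?abs_ge0 //.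
    exact: analytic_bound (hB i) _ tr.
  rewrite absM !absX (abs_omega_iter ri tr) exprAC -exprMn -/k.
  by apply: ler_wiXn2l; rewrite ?(ltW zm) // ltnW // ltn_expl // q_gt1.
have ta i : exists2 B', 0 <= B' & analytic (T ^+ r) B' (term i).
  have [Bt hBt] := omega_iter_analytic r i.
  have r0 : abs (0 : L) <= T ^+ r by rewrite abs0 exprn_ge0 // ltW.
  have Bt0 : 0 <= Bt by apply: le_trans (analytic_bound hBt r0); rewrite abs_ge0.
  exists (abs (z ^+ (q ^ i)) * Bt ^+ m * B); first by rewrite !mulr_ge0 ?abs_ge0 ?exprn_ge0.
  apply: analyticM => //; apply: analyticM; first exact: analytic_cst.
  exact: analyticX.
have tfin n : exists2 B', 0 <= B' & forall i, (i < n)%N -> analytic (T ^+ r) B' (term i).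
  elim: n => [|n [B1 B10 h1]]; first by exists 0.
  have [B2 B20 h2] := ta n; exists (Num.max B1 B2); first by rewrite le_max B10.
  move=> i; rewrite ltnS leq_eqVlt => /orP[/eqP->|/h1 h]; [apply: analyticW h2|apply: analyticW h];
  by rewrite le_max lexx ?orbT.
have [B1 B10 h1] := tfin r.
split.
  exists (Num.max B1 B); first by rewrite le_max B10.
  move=> N; apply: analytic_sum => [|i _]; first by rewrite le_max B10.
  rewrite -/(term i); have [ir|ri] := ltnP i r.
    by apply: analyticW (h1 _ ir); rewrite le_max lexx.
  have [B2 _ [_ h2]] := ta i; split=> // t tr; apply: le_trans (tb i t ri tr) _.
  by rewrite le_max; apply/orP; right; rewrite ler_piMr // exprn_ile1 // ltW.
exists (fun n => if (n < r)%N then B1 else B * k ^+ n); split.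
  move=> n t tr; rewrite /= big_ord_recr /= addrAC subrr add0r -/(term n t).
  by case: ltnP => nr; [apply: analytic_bound (h1 _ nr) _ tr | apply: tb].
move=> eps e0; have [|N hN] := @geometric_to0 S k B _ B0 eps e0; first by rewrite k0.
by exists (maxn N r) => n; rewrite geq_max => /andP[Nn rn]; rewrite ltnNge rn hN.
Qed.

Lemma nested_series_limit s r : convergent s -> (exists B, analytic (T ^+ r) B (nested_series s)) /\
  forall t, abs t <= T ^+ r -> is_lim (fun N => nested_sum s N t) (nested_series s t).
Proof.
move=> hs; have [[B _ hB] [e [h1 h2]]] := nested_sum_analytic r hs.
have [h3 h4] := analytic_limit hB h1 h2.
by split; first exists B.
Qed.

Lemma nested_series_lim s t : convergent s -> is_lim (fun N => nested_sum s N t) (nested_series s t).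
Proof. by move=> hs; have [r tr] := disc_pow t; apply: (nested_series_limit r hs).2. Qed.

Lemma nested_series_rcons s m z t : convergent (rcons s (m, z)) ->
  nested_series (rcons s (m, z)) t =
  frob (nested_series (rcons s (m, z)) (frobV t)) + z * omega t ^+ m * frob (nested_series s (frobV t)).
Proof.
move=> hs; have hs' : convergent s.
  by move=> mz h; apply: hs; rewrite mem_rcons inE h orbT.
apply: (lim_unique (is_limS (nested_series_lim t hs))).
apply: (is_lim_ext (u := fun n => frob (nested_sum (rcons s (m, z)) n (frobV t)) +
  z * omega t ^+ m * frob (nested_sum s n (frobV t)))) => [n|]; first by rewrite nested_sum_rcons.
apply: is_limD; first by apply: is_lim_frob; apply: nested_series_lim.
by apply: is_limMl; apply: is_lim_frob; apply: nested_series_lim.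
Qed.

Lemma nested_series_nil t : nested_series [::] t = 1.
Proof. by apply: limE; apply: is_lim_cst. Qed.

Lemma nested_series_theta s : convergent s -> nested_series s theta = omega theta ^+ total_weight s * Li abs q theta s.
Proof.
move=> hs; have o0 : omega theta ^+ total_weight s != 0.
  by rewrite expf_neq0 // omega_neq0.
have h : is_lim (Li_partial q theta s) (omega theta ^- total_weight s * nested_series s theta).
  apply: (is_lim_ext (u := fun N => omega theta ^- total_weight s * nested_sum s N theta)) => [n|].
    by rewrite nested_sum_theta mulKf.
  by apply: is_limMl; apply: nested_series_lim.
by rewrite /Li (limE h) mulVKf.
Qed.

End Polylogs.

(** * From functions to values *)

Section BiIntegral.
Variable S : setting.
Local Notation L := (sL S).
Local Notation q := (sq S).
Local Notation C := {poly {poly L}}.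

Lemma bidegree_of_invariant (c : C) : map_poly (map_poly (@frob S)) c = c ->
  exists k, @bidegree S k k c.
Proof.
move=> hc; exists (\max_(i < size c) size (c`_i)%R + size c)%N; split=> [i|i|].
- by apply/overFqP; rewrite -{2}hc coef_map.
- have [ic|ci] := ltnP i (size c); last by rewrite nth_default // size_poly0.
  apply: leqW; apply: leq_trans (leq_addr _ _).
  exact: (leq_bigmax (F := fun i : 'I_(size c) => size (c`_i)%R) (Ordinal ic)).
- exact: leqW (leq_addl _ _).
Qed.

Definition bitau : C := 'X - ('X^q)%:P.

Lemma spec_polyC x (f : {poly L}) : spec x f%:P = (f.[x])%:P.
Proof. by rewrite /spec map_polyC. Qed.

Lemma spec_bitau : spec (stheta S) bitau = tau S.
Proof.
apply/polyP => i; rewrite coef_spec /bitau /tau !coefB !coefX !coefC hornerD hornerN.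
by congr (_ - _); case: eqP => _; rewrite ?hornerXn ?hornerC ?horner0.
Qed.

Variable r : nat.

Definition degle (K : nzRingType) k (P : {mpoly K[r]}) := forall m, m \in msupp P -> (mdeg m <= k)%N.

Lemma degleM (K : nzRingType) k k' (P Q : {mpoly K[r]}) :
  degle k P -> degle k' Q -> degle (k + k') (P * Q).
Proof.
move=> hP hQ m /msuppM_le/allpairsP[[m1 m2] /= [/hP h1 /hQ h2 ->]].
by rewrite mdegD leq_add.
Qed.

Lemma degleX (K : nzRingType) k n (P : {mpoly K[r]}) : degle k P -> degle (k * n) (P ^+ n).
Proof.
move=> hP; elim: n => [|n IH]; last by rewrite exprS mulnS; apply: degleM.
by rewrite expr0 -mpolyX0 => m; rewrite msuppX inE => /eqP->; rewrite mdeg0.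
Qed.

Lemma degle_prod (K : nzRingType) (P : 'I_r -> {mpoly K[r]}) (k : 'I_r -> nat) (s : seq 'I_r) :
  (forall i, degle (k i) (P i)) -> degle (\sum_(i <- s) k i) (\prod_(i <- s) P i).
Proof.
move=> h; elim: s => [|i s IH]; last by rewrite !big_cons; apply: degleM.
by rewrite !big_nil -mpolyX0 => m; rewrite msuppX inE => /eqP->; rewrite mdeg0.
Qed.

Lemma degleC (K : nzRingType) (c : K) : degle 0 (c%:MP : {mpoly K[r]}).
Proof. by move=> m; rewrite msuppC; case: eqP => // _; rewrite inE => /eqP->; rewrite mdeg0. Qed.

Lemma degleD (K : nzRingType) k (P Q : {mpoly K[r]}) : degle k P -> degle k Q -> degle k (P + Q).
Proof. by move=> hP hQ m /msuppD_le; rewrite mem_cat => /orP[/hP|/hQ]. Qed.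

Lemma degleXU (K : nzRingType) i : degle 1 ('X_i : {mpoly K[r]}).
Proof. by move=> m; rewrite msuppX inE => /eqP->; rewrite mdeg1. Qed.

Lemma degleW (K : nzRingType) k k' (P : {mpoly K[r]}) : (k <= k')%N -> degle k P -> degle k' P.
Proof. by move=> kk hP m /hP h; apply: leq_trans kk. Qed.

Lemma degle_msize (K : nzRingType) k (P : {mpoly K[r]}) : degle k P -> (msize P <= k.+1)%N.
Proof.
move=> hP; rewrite msizeE big_seq; apply/bigmax_leqP_seq => m _ mP.
by rewrite ltnS hP.
Qed.

End BiIntegral.

Section IndependenceOfValues.
Variable S : setting.
Local Notation L := (sL S).
Local Notation R := (sR S).
Local Notation abs := (@sabs S).
Local Notation q := (sq S).
Local Notation theta := (stheta S).
Local Notation T := (sabs (stheta S)).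
Local Notation overFq := (@polyOverFq (sL S) q).
Local Notation A := {poly L}.
Local Notation tau := (tau S).
Local Notation omega := (@omega S).
Variables (r : nat) (w : 'I_r -> nat) (b : 'I_r -> {mpoly A[r]}).
Variables (dep : 'I_r -> nat) (star : 'I_r) (vs : seq 'I_r).
Hypothesis b_depth : forall i, below dep (dep i) (b i).
Hypothesis vs_adm : admissible w b vs.
Hypothesis vs_all : forall i, (i \in vs) = (i != star).
Hypothesis w_star : w star = 1%N.
Hypothesis b_star : b star = 0.
Hypothesis b_free : forall i, free_of star (b i).

Variables (pr : 'I_r -> option 'I_r) (a : 'I_r -> L) (W : nat).
Let wp i := if pr i is Some j then w j else 0%N.
Hypothesis bE : forall i, b i = (a i)%:P%:MP *
  (if pr i is Some j then 'X_j - b j else 1).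
Hypothesis wW : forall i, (w i <= W)%N.
Hypothesis aK : forall i, exists f g : A, [/\ overFq f, overFq g, g != 0 & a i = f.[theta] / g.[theta]].

Variables (F H : 'I_r -> L -> L).
Hypothesis F_star : forall t, abs t <= 1 -> F star t != 0.
Hypothesis FE : forall t i, abs t <= T ->
  frob (F i (frobV t)) = tau.[t] ^+ w i * (F i t - evaluate F t (b i)).
Hypothesis HE : forall t i, abs t <= T -> H i t = omega t ^+ W * F i t.
Hypothesis Han : forall i k, exists B : R, analytic (T ^+ k) B (H i).

Let T1 : 1 < T := sabs_theta S.

Lemma common_denominator : exists beta : A, [/\ overFq beta, beta != 0 &
  forall i, exists2 f : A, overFq f & f.[theta] = beta.[theta] * a i].
Proof.
have [fg hfg] := ClassicalEpsilon.choice (fun i (fg : A * A) =>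
  [/\ overFq fg.1, overFq fg.2, fg.2 != 0 & a i = fg.1.[theta] / fg.2.[theta]])
  (fun i => let: ex_intro f (ex_intro g h) := aK i in ex_intro _ (f, g) h).
exists (\prod_i (fg i).2); split.
- by elim/big_rec: _ => [|i x _ hx]; [apply: overFq1 | apply: overFqM => //; have [] := hfg i].
- by apply/prodf_neq0 => i _; have [] := hfg i.
move=> i; exists ((fg i).1 * \prod_(j | j != i) (fg j).2).
  apply: overFqM; first by have [] := hfg i.
  by elim/big_rec: _ => [|j x _ hx]; [apply: overFq1 | apply: overFqM => //; have [] := hfg j].
have [_ g2 g0 ->] := hfg i.
rewrite [in RHS](bigD1 i) //= !hornerM mulrAC; have gn0 : (fg i).2.[theta] != 0.
  by apply: contraNneq g0 => h; rewrite (overFq_root g2 T1 h).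
by field; rewrite gn0.
Qed.

Section System.
Variables (beta : A) (ta : 'I_r -> A) (D : nat) (lam : L).
Hypotheses (beta_q : overFq beta) (beta0 : beta != 0).
Hypotheses (ta_q : forall i, overFq (ta i)) (taE : forall i, (ta i).[theta] = beta.[theta] * a i).
Let be := beta.[theta].
Hypothesis lamE : lam * be ^- D = lam ^+ q.
Hypothesis lam0 : lam != 0.

Local Notation C := {poly {poly L}}.
Local Notation Z := {mpoly C[r]}.
Local Notation bitau := (@bitau S).

(* F_i = sigma F_i / tau^(w i) + b_i with denominators cleared, as a polynomial in the sigma F_j
   (note b_i = a_i sigma F_j / tau^(w j), where j = pr i). *)
Definition var_image i : Z := (beta%:P * bitau ^+ (W - w i))%:MP * 'X_i +
  ((ta i)%:P * bitau ^+ (W - wp i))%:MP * (if pr i is Some j then 'X_j else 1).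

Definition monomial_image (m : 'X_{1..r}) : Z :=
  ((beta%:P * bitau ^+ W) ^+ (D - mdeg m))%:MP * \prod_i var_image i ^+ m i.

Lemma beta_theta_neq0 : be != 0.
Proof. by apply: contraNneq beta0 => h; rewrite (overFq_root beta_q T1 h). Qed.

Lemma tau_neq0_disc t : abs t <= T -> tau.[t] != 0.
Proof.
move=> tT; have -> : tau.[t] = t - theta ^+ q := hornerXsubC _ t; rewrite subr_eq0; apply: contraTneq tT => ->.
by rewrite -ltNge absX ltr_eXnr // q_gt1.
Qed.

Definition specev z (K : comNzRingType) (h : {rmorphism L -> K}) : C -> K :=
  h \o (horner_eval z \o @spec S theta).
HB.instance Definition _ z K h := GRing.RMorphism.copy (@specev z K h)
  (h \o (horner_eval z \o @spec S theta)).

Lemma mmap_var_image z (K : comNzRingType) (h : {rmorphism L -> K}) (x y : 'I_r -> K) (yb : 'I_r -> K) i :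
  abs z <= T ->
  (forall i, x i = h (tau.[z]) ^+ w i * (y i - yb i)) ->
  (forall i, yb i = h (a i) * (if pr i is Some j then y j - yb j else 1)) ->
  mmap (specev z h) x (var_image i) = h (be * tau.[z] ^+ W) * y i.
Proof.
move=> zT hx hyb; rewrite /var_image rmorphD !rmorphM !rmorphXn /= !mmapC /=.
have e1 (f : A) : specev z h f%:P = h f.[theta] by rewrite /specev /= spec_polyC /horner_eval hornerC.
have e2 : specev z h bitau = h tau.[z] by rewrite /specev /= spec_bitau.
rewrite !e1 !e2 taE rmorphM mmapX mmap1U hx.
have -> : mmap (specev z h) x (if pr i is Some j then 'X_j else 1) =
    if pr i is Some j then x j else 1.
  by case: (pr i) => [j|]; [rewrite mmapX mmap1U | rewrite rmorph1].
have eW k : (k <= W)%N -> h tau.[z] ^+ (W - k) * h tau.[z] ^+ k = h tau.[z] ^+ W.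
  by move=> kW; rewrite -exprD subnK.
have wpW : (wp i <= W)%N by rewrite /wp; case: (pr i).
have hp : h tau.[z] ^+ (W - wp i) * (if pr i is Some j then x j else 1) =
    h tau.[z] ^+ W * (if pr i is Some j then y j - yb j else 1).
  rewrite /wp; case: (pr i) => [j|]; last by rewrite subn0.
  by rewrite hx mulrA eW.
rewrite -!mulrA hp -/be.
transitivity (h be * ((h tau.[z] ^+ (W - w i) * h tau.[z] ^+ w i) * (y i - yb i)) +
  h be * (h tau.[z] ^+ W * (h (a i) * (if pr i is Some j then y j - yb j else 1)))).
  by ring.
rewrite -hyb eW //; ring.
Qed.

Lemma mmap_monomial_image z (K : comNzRingType) (h : {rmorphism L -> K}) (x y : 'I_r -> K) (yb : 'I_r -> K) m :
  abs z <= T -> (mdeg m <= D)%N ->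
  (forall i, x i = h (tau.[z]) ^+ w i * (y i - yb i)) ->
  (forall i, yb i = h (a i) * (if pr i is Some j then y j - yb j else 1)) ->
  mmap (specev z h) x (monomial_image m) = h (be * tau.[z] ^+ W) ^+ D * \prod_i y i ^+ m i.
Proof.
move=> zT mD hx hyb; rewrite /monomial_image rmorphM /= mmapC /= rmorphXn rmorph_prod /=.
have -> : specev z h (beta%:P * bitau ^+ W) = h (be * tau.[z] ^+ W).
  by rewrite rmorphM rmorphXn /= /specev /= spec_polyC spec_bitau /horner_eval hornerC -rmorphXn -rmorphM.
have -> : \prod_i mmap (specev z h) x (var_image i ^+ m i) = h (be * tau.[z] ^+ W) ^+ mdeg m * \prod_i y i ^+ m i.
  rewrite mdegE -prodrXr -big_split; apply: eq_bigr => i _ /=.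
  by rewrite rmorphXn /= (mmap_var_image _ zT hx hyb) exprMn.
by rewrite mulrA -exprD subnK.
Qed.

Lemma monomial_image_invariant m : map_mpoly (map_poly (map_poly (@frob S))) (monomial_image m) = monomial_image m.
Proof.
pose fc : {rmorphism C -> C} := map_poly (map_poly (@frob S)).
pose phi : {rmorphism Z -> Z} := map_mpoly fc; rewrite -[LHS]/(phi (monomial_image m)).
have phiC c : phi c%:MP = (fc c)%:MP.
  apply/mpolyP => m'; rewrite [LHS]mcoeff_map_mpoly !mcoeffC.
  by case: eqP => _; rewrite ?mulr1 ?mulr0 //; exact: (rmorph0 fc).
have phiX i : phi 'X_i = 'X_i by exact: (map_mpolyX fc).
have phiM : {morph phi : x y / x * y} := rmorphM phi.
have fcC (f : A) : overFq f -> fc f%:P = f%:P.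
  by move=> /overFqP hf; rewrite [LHS]map_polyC /= hf.
have fct k : fc (bitau ^+ k) = bitau ^+ k.
  rewrite rmorphXn rmorphB fcC; last exact: overFqXn.
  by congr ((_ - _) ^+ _); exact: map_polyX.
have fcT (f : A) k : overFq f -> fc (f%:P * bitau ^+ k) = f%:P * bitau ^+ k.
  by move=> hf; rewrite rmorphM fcC // fct.
rewrite /monomial_image rmorphM phiC rmorphXn fcT // rmorph_prod; congr (_ * _); apply: eq_bigr => i _.
rewrite rmorphXn; congr (_ ^+ _); rewrite /var_image rmorphD !phiM !phiC !fcT // phiX.
by case: (pr i) => [j|]; rewrite ?phiX ?rmorph1.
Qed.

Lemma degle_monomial_image m : (mdeg m <= D)%N -> degle D (monomial_image m).
Proof.
move=> mD; apply: (@degleW _ _ (0 + mdeg m)) => //; apply: degleM; first exact: degleC.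
rewrite mdegE; apply: degle_prod => i; rewrite -[X in degle X _]mul1n; apply: degleX.
apply: degleD; apply: (@degleW _ _ (0 + 1)) => //; apply: degleM; try exact: degleC.
  exact: degleXU.
by case: (pr i) => [j|]; [apply: degleXU | apply: (@degleW _ _ 0) => //; apply: degleC].
Qed.

Local Notation Ix := 'X_{1..r < D.+1}.
Definition scaled_monomial (m : 'X_{1..r}) t : L :=
  lam * (omega t ^+ (W * (D - mdeg m)) * \prod_i H i t ^+ m i).

Lemma scaled_monomialE m t : (mdeg m <= D)%N -> abs t <= T ->
  scaled_monomial m t = lam * omega t ^+ (W * D) * \prod_i F i t ^+ m i.
Proof.
move=> mD tT; rewrite /scaled_monomial -mulrA; congr (_ * _).
have -> : \prod_i H i t ^+ m i = omega t ^+ (W * mdeg m) * \prod_i F i t ^+ m i.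
  rewrite mdegE exprM -prodrXr -big_split; apply: eq_bigr => i _ /=.
  by rewrite HE // exprMn.
by rewrite mulrA -exprD -mulnDr subnK.
Qed.

Lemma scaled_monomial_analytic m k : exists B : R, analytic (T ^+ k) B (scaled_monomial m).
Proof.
have Tk : abs (0 : L) <= T ^+ k by rewrite abs0 exprn_ge0 // ltW // (lt_trans ltr01).
have pos B f : analytic (T ^+ k) B f -> 0 <= B.
  by move=> h; apply: le_trans (analytic_bound h Tk); rewrite abs_ge0.
have prodan (s : seq 'I_r) : exists B : R, analytic (T ^+ k) B (fun t => \prod_(i <- s) H i t ^+ m i).
  elim: s => [|i s [B hB]].
    exists (abs (1 : L)); apply: (analytic_ext _ (analytic_cst (T ^+ k) 1)) => t _.
    by rewrite big_nil.
  have [B' hB'] := Han i k; exists (B' ^+ m i * B).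
  apply: (analytic_ext (f := fun t => H i t ^+ m i * \prod_(i <- s) H i t ^+ m i)) => [t _|].
    by rewrite big_cons.
  exact: analyticM (analyticX _ (pos _ _ hB') hB') hB.
have [B hB] := prodan (index_enum 'I_r).
have [ho _] := omega_limit S k.
eexists; apply: analyticM; first exact: analytic_cst.
exact: analyticM (analyticX _ (pos _ _ ho) ho) hB.
Qed.

Lemma scaled_monomial_system m t : (mdeg m <= D)%N -> abs t <= T ->
  scaled_monomial m t = \sum_(n : Ix) (spec theta (monomial_image m)@_n).[t] * frob (scaled_monomial n (frobV t)).
Proof.
move=> mD tT; have vT : abs (frobV t) <= T by apply: abs_frobV_le => //; apply: ltW.
pose x i := frob (F i (frobV t)).
have := @mmap_monomial_image t L idfun x (fun i => F i t) (fun i => evaluate F t (b i)) m tT mD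
  (fun i => FE i tT).
have hyb i : evaluate F t (b i) = a i * (if pr i is Some j then F j t - evaluate F t (b j) else 1).
  rewrite bE rmorphM /= evaluateC hornerC; congr (_ * _).
  by case: (pr i) => [j|]; rewrite ?rmorphB /= ?evaluateX ?rmorph1.
move/(_ hyb); rewrite (mmapE D.+1); last by apply: degle_msize; apply: degle_monomial_image.
move=> e; rewrite scaled_monomialE //.
have -> : \sum_(n : Ix) (spec theta (monomial_image m)@_n).[t] * frob (scaled_monomial n (frobV t)) =
  frob (lam * omega (frobV t) ^+ (W * D)) * \sum_(n : Ix) specev t idfun (monomial_image m)@_n * mmap1 x n.
  rewrite mulr_sumr; apply: eq_bigr => n _.
  rewrite scaled_monomialE ?(bmnm_mdeg_le n) //; last by have := bmdeg n; rewrite ltnS.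
  rewrite rmorphM /= rmorph_prod /= mulrCA; congr (_ * (_ * _)).
  by rewrite /mmap1; apply: eq_bigr => i _; rewrite rmorphXn.
have fl : frob lam = lam * be ^- D by rewrite frobE -lamE.
have b0 : be ^+ D != 0 by rewrite expf_neq0 // beta_theta_neq0.
rewrite e /= [omega t]omegaE rmorphM rmorphXn /= fl !exprMn -[tau.[t] ^+ W ^+ D]exprM.
move: (\prod_i _) (tau.[t] ^+ _) (frob _ ^+ _) (be ^+ D) b0 => x1 x2 x3 x4 x40.
by field; rewrite x40.
Qed.

Lemma monomial_image_injective z (c : Ix -> L) : abs z <= T ->
  (forall n : Ix, \sum_m c m * (spec theta (monomial_image m)@_n).[z] = 0) -> forall m, c m = 0.
Proof.
move=> zT hc m0.
pose bz i : {mpoly L[r]} := map_mpoly (horner_eval z) (b i).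
pose K : comNzRingType := {mpoly L[r]}.
pose h : {rmorphism L -> K} := @mpolyC r L.
pose x (i : 'I_r) : K := h tau.[z] ^+ w i * ('X_i - bz i).
have hyb i : bz i = h (a i) * (if pr i is Some j then 'X_j - bz j else 1).
  have mM P Q : map_mpoly (horner_eval z) (P * Q) =
    map_mpoly (horner_eval z) P * map_mpoly (horner_eval z) Q := rmorphM _ P Q.
  have mB P Q : map_mpoly (horner_eval z) (P - Q) =
    map_mpoly (horner_eval z) P - map_mpoly (horner_eval z) Q := rmorphB _ P Q.
  have m1 : map_mpoly (horner_eval z) (1 : {mpoly A[r]}) = 1 := rmorph1 _.
  have mC c' : map_mpoly (horner_eval z) (c'%:P%:MP : {mpoly A[r]}) = c'%:MP.
    by rewrite map_mpolyC /= /horner_eval hornerC.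
  rewrite /bz bE mM mC; congr (_ * _).
  by case: (pr i) => [j|]; rewrite ?m1 // mB map_mpolyX.
have im (m : Ix) : mmap (specev z h) x (monomial_image m) = h (be * tau.[z] ^+ W) ^+ D * 'X_[m].
  rewrite (@mmap_monomial_image z K h x (fun i => 'X_i) bz) //; first by rewrite [in RHS]mpolyXE_id.
  by have := bmdeg m; rewrite ltnS.
have : \sum_m h (c m) * mmap (specev z h) x (monomial_image m) = 0.
  have e (m : Ix) : mmap (specev z h) x (monomial_image m) = \sum_(n : Ix) h (spec theta (monomial_image m)@_n).[z] * mmap1 x n.
    rewrite (mmapE D.+1) //; apply: degle_msize; apply: degle_monomial_image.
    by have := bmdeg m; rewrite ltnS.
  under eq_bigr => m _ do rewrite e mulr_sumr.
  rewrite exchange_big big1 // => n _ /=.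
  transitivity (h (\sum_m c m * (spec theta (monomial_image m)@_n).[z]) * mmap1 x n).
    by rewrite rmorph_sum mulr_suml; apply: eq_bigr => m _; rewrite rmorphM mulrA.
  by rewrite hc rmorph0 mul0r.
under eq_bigr => m _ do rewrite im mulrCA.
rewrite -mulr_sumr => /eqP; rewrite mulf_eq0 expf_eq0.
have -> : (h (be * tau.[z] ^+ W) == 0) = false.
  by rewrite mpolyC_eq0 mulf_eq0 expf_eq0 (negPf beta_theta_neq0) (negPf (tau_neq0_disc zT)) andbF.
rewrite andbF /= => /eqP /(congr1 (mcoeff m0)); rewrite mcoeff0 raddf_sum /= (bigD1 m0) //=.
rewrite mcoeffCM mcoeffX eqxx mulr1 big1 ?addr0 // => m mm0.
rewrite mcoeffCM mcoeffX; case: eqP => [e|]; rewrite ?mulr0 //.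
by case/eqP: mm0; apply: val_inj.
Qed.

End System.

(* The monomials in the F_i of degree at most [msize Q], multiplied by a power of Omega to make
   them entire, satisfy a linear system to which the criterion applies. The constant [lam]
   absorbs the denominator [be ^+ D]. *)
Theorem independence_of_values (Q : {mpoly L[r]}) :
  (forall m, exists2 f : A, overFq f & Q@_m = f.[theta]) ->
  Q.@[fun i => F i theta] = 0 -> Q = 0.
Proof.
move=> hQ Q0; have [//|Qn0] := eqVneq Q 0; exfalso.
have [beta [bq b0 /fin_all_exists2[ta ta_q taE]]] := common_denominator.
pose D := msize Q; pose be := beta.[theta].
have be_neq0 : be != 0 := beta_theta_neq0 bq b0.
have [lam lamE] : exists lam : L, lam ^+ (q - 1) = be ^- D.
  have [x hx] := @solve_monicpoly L (q - 1)%N (fun i => if i == 0%N then be ^- D else 0) (qm1_gt0 S).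
  exists x; rewrite hx (bigD1 (Ordinal (qm1_gt0 S))) //= expr0 mulr1 big1 ?addr0 // => i i0.
  by case: eqP => [e|]; rewrite ?mul0r //; case/eqP: i0; apply: val_inj.
have lam0 : lam != 0.
  apply/eqP => l0; move/eqP: lamE; rewrite l0 expr0n; have /lt0n_neq0/negPf-> := qm1_gt0 S.
  by rewrite eq_sym invr_eq0 expf_eq0 (negPf be_neq0) andbF.
have lamq : lam * be ^- D = lam ^+ q by rewrite -lamE -exprS subn1 prednK // q_gt0.
pose Ix := 'X_{1..r < D.+1}.
have Ix0 : (mdeg (0%MM : 'X_{1..r}) < D.+1)%N by rewrite mdeg0.
have cI : (#|{: Ix}|.-1.+1 = #|{: Ix}|)%N by rewrite prednK //; apply/card_gt0P; exists (BMultinom Ix0).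
pose ev (i : 'I_(#|{: Ix}|.-1.+1)) : Ix := enum_val (cast_ord cI i).
pose rk (m : Ix) : 'I_(#|{: Ix}|.-1.+1) := cast_ord (esym cI) (enum_rank m).
have evK : cancel ev rk by move=> i; rewrite /rk /ev enum_valK cast_ordK.
have rkK : cancel rk ev by move=> m; rewrite /rk /ev cast_ordKV enum_rankK.
have mD (m : Ix) : (mdeg m <= D)%N by have := bmdeg m; rewrite ltnS.
have resum (G : Ix -> L) : \sum_i G (ev i) = \sum_m G m.
  by rewrite (reindex ev) //; exists rk => x _.
pose M i j := (monomial_image beta ta D (ev i))@_(ev j).
pose g i := scaled_monomial D lam (ev i).
have [md Mdeg] : exists md, forall i j, @bidegree S md md (M i j).
  have /fin_all_exists[mm hm] : forall ij, exists k, @bidegree S k k (M ij.1 ij.2).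
    move=> [i j]; apply: bidegree_of_invariant.
    by rewrite /= /M -[in RHS](monomial_image_invariant D bq ta_q (ev i)) mcoeff_map_mpoly.
  exists (\max_ij mm ij) => i j.
  by apply: bidegreeW (hm (i, j)); exact: (leq_bigmax (F := mm) (i, j)).
have gE t i : abs t <= T -> g i t = \sum_j (spec theta (M i j)).[t] * frob (g j (frobV t)).
  move=> tT; rewrite /g (scaled_monomial_system bq b0 taE lamq (mD _) tT).
  by rewrite -(resum (fun n => (spec theta (monomial_image beta ta D (ev i))@_n).[t] * frob (scaled_monomial D lam n (frobV t)))).
have Minj z c : abs z <= T -> (forall j, \sum_i c i * (spec theta (M i j)).[z] = 0) -> forall i, c i = 0.
  move=> zT hc i.
  have := @monomial_image_injective beta ta D bq b0 taE z (fun m => c (rk m)) zT; move/(_ _ (ev i)); rewrite evK.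
  apply=> n; rewrite -[RHS](hc (rk n)) -resum.
  by apply: eq_bigr => j _; rewrite /M evK rkK.
have gan k : exists B : R, forall i, analytic (T ^+ k) B (g i).
  have /fin_all_exists[B hB] : forall i, exists B : R, analytic (T ^+ k) B (g i).
    by move=> i; apply: scaled_monomial_analytic.
  exists (\sum_i `|B i|) => i; apply: analyticW (hB i).
  by rewrite (bigD1 i) //= (le_trans (ler_norm _)) // lerDl sumr_ge0.
have /ClassicalEpsilon.choice[f0 hf0] : forall m, exists f : A, overFq f /\ Q@_m = f.[theta].
  by move=> m; have [f] := hQ m; exists f.
pose F0 i := f0 (ev i).
have F0q i : overFq (F0 i) by have [] := hf0 (ev i).
have sF0 i : (size (F0 i) <= (\max_i size (F0 i)).+1)%N.
  by apply: leqW; apply: (leq_bigmax (F := fun i => size (F0 i)) i).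
have vals t : abs t <= T -> forall i, g i t = lam * omega t ^+ (W * D) * \prod_j F j t ^+ (ev i : 'X_{1..r}) j.
  by move=> tT i; rewrite /g scaled_monomialE.
have F0n : exists i, F0 i != 0.
  have lD : (mdeg (mlead Q) < D.+1)%N by rewrite ltnS ltnW // mlead_deg.
  exists (rk (BMultinom lD)); apply/eqP => e0.
  have [_] := hf0 (BMultinom lD); rewrite -(rkK (BMultinom lD)) -/(F0 _) e0 horner0 rkK /=.
  by apply/eqP; rewrite mleadc_eq0.
have F0rel : \sum_i (F0 i).[theta] * g i theta = 0.
  transitivity (lam * omega theta ^+ (W * D) * Q.@[fun i => F i theta]); last by rewrite Q0 mulr0.
  have -> : Q.@[fun i => F i theta] = \sum_(m : Ix) Q@_m * \prod_i F i theta ^+ (m : 'X_{1..r}) i.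
    by rewrite {1}/meval (mmapE D.+1).
  rewrite -(resum (fun m => Q@_m * \prod_i F i theta ^+ (m : 'X_{1..r}) i)) mulr_sumr.
  apply: eq_bigr => i _; have [_ ->] := hf0 (ev i).
  by rewrite vals // mulrCA.
have [h [[i0 hi0] hrel]] := linear_relation_criterion Mdeg gE Minj gan F0q sF0 F0n F0rel.
pose P : {mpoly A[r]} := \sum_i (h i)%:MP * 'X_[ev i].
have P0 : P = 0.
  have T1' t : abs t <= 1 -> abs t <= T by move=> t1; apply: le_trans t1 (ltW T1).
  apply: (functional_independence b_depth vs_adm vs_all w_star b_star b_free F_star (fun t i t1 => FE i (T1' t t1))).
  move=> t t1; rewrite /P rmorph_sum /=.
  apply: (mulfI (x := lam * omega t ^+ (W * D))).
    by rewrite mulf_neq0 // expf_neq0 // omega_neq0 ?T1'.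
  rewrite mulr0 -[RHS](hrel t t1) mulr_sumr; apply: eq_bigr => i _.
  rewrite vals ?T1' // rmorphM /= evaluateC [evaluate _ _ _]mmapX mulrCA; congr (_ * (_ * _)).
move/eqP: hi0; apply.
have := congr1 (mcoeff (ev i0)) P0; rewrite mcoeff0 /P raddf_sum /= (bigD1 i0) //=.
rewrite mcoeffCM mcoeffX eqxx mulr1 big1 ?addr0 // => i ii0.
rewrite mcoeffCM mcoeffX; case: eqP => [e|]; rewrite ?mulr0 //.
by case/eqP: ii0; rewrite -[i]evK -[i0]evK; congr rk; apply: val_inj.
Qed.
End IndependenceOfValues.

(** * Algebraic coefficients *)

Section Descent.
Variable S : setting.
Local Notation L := (sL S).
Local Notation q := (sq S).
Local Notation theta := (stheta S).
Local Notation overFq := (@polyOverFq (sL S) q).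
Local Notation inK := (@inK (sL S) q theta).

Lemma inK_overFq (f : {poly L}) : overFq f -> inK f.[theta].
Proof. by move=> hf; exists f, 1; rewrite hornerC oner_neq0 divr1; split=> //; apply: overFq1. Qed.

Lemma inKB x y : inK x -> inK y -> inK (x - y).
Proof.
move=> [f [g [hf hg g0 ->]]] [f' [g' [hf' hg' g0' ->]]].
exists (f * g' - f' * g), (g * g'); split; try exact: overFqM.
- by apply: overFqB; apply: overFqM.
- by rewrite hornerM mulf_neq0.
- by rewrite !hornerE; field; rewrite g0 g0'.
Qed.

Lemma inKM x y : inK x -> inK y -> inK (x * y).
Proof.
move=> [f [g [hf hg g0 ->]]] [f' [g' [hf' hg' g0' ->]]].
exists (f * f'), (g * g'); split; try exact: overFqM.
- by rewrite hornerM mulf_neq0.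
- by rewrite !hornerM mulf_div.
Qed.

Lemma inKV x : inK x -> inK x^-1.
Proof.
move=> [f [g [hf hg g0 ->]]]; have [f0|f0] := eqVneq f.[theta] 0.
  rewrite f0 mul0r invr0 -(horner0 theta); apply: inK_overFq; exact: overFq0.
by exists g, f; rewrite invfM invrK mulrC.
Qed.

Lemma inK_bool (c : bool) : inK c%:R.
Proof.
case: c; first by rewrite -(hornerC 1 theta); apply: inK_overFq; apply: overFq1.
have -> : (false%:R : L) = (0 : {poly L}).[theta] by rewrite horner0.
by apply: inK_overFq; apply: overFq0.
Qed.

Lemma inK_inKbar x : inK x -> inKbar q theta x.
Proof.
move=> hx; exists ('X - x%:P); rewrite polyXsubC_eq0 root_XsubC; split=> // i.
rewrite coefB coefX coefC; apply: inKB; first exact: inK_bool.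
by case: eqP => // _; apply: (inK_bool false).
Qed.

Definition in_K : pred L := fun x => if ClassicalEpsilon.excluded_middle_informative (inK x) then true else false.

Lemma in_KP x : reflect (inK x) (x \in in_K).
Proof. by rewrite unfold_in /in_K; case: ClassicalEpsilon.excluded_middle_informative => h; constructor. Qed.

Fact in_K_subring : subring_closed in_K.
Proof.
split.
- by apply/in_KP; apply: (inK_bool true).
- by move=> x y /in_KP hx /in_KP hy; apply/in_KP/inKB.
- by move=> x y /in_KP hx /in_KP hy; apply/in_KP/inKM.
Qed.
HB.instance Definition _ := GRing.isSubringClosed.Build L in_K in_K_subring.

Record Krat := Rational { Kval :> L; _ : Kval \in in_K }.
HB.instance Definition _ := [isSub for Kval].
HB.instance Definition _ := [Choice of Krat by <:].
HB.instance Definition _ := [SubChoice_isSubComNzRing of Krat by <:].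

Definition Kincl : {rmorphism Krat -> L} := val.

Lemma inKbar_integral c : inKbar q theta c -> integralOver Kincl c.
Proof.
move=> [P [P0 hP rP]]; have l0 : lead_coef P != 0 by rewrite lead_coef_eq0.
have hK i : ((lead_coef P)^-1 *: P)`_i \in in_K.
  by apply/in_KP; rewrite coefZ; apply: inKM => //; apply: inKV; apply: hP.
pose p : {poly Krat} := \poly_(i < size P) Rational (hK i).
have pE : map_poly Kincl p = (lead_coef P)^-1 *: P.
  apply/polyP => i; rewrite coef_map coef_poly /=.
  by case: ltnP => // h; rewrite /= coefZ [P`_i]nth_default ?mulr0.
exists p; last by rewrite pE rootZ // invr_eq0.
apply/monicP; apply: (val_inj : injective Kincl).
rewrite -lead_coef_map_inj //; last exact: val_inj.
by rewrite pE lead_coefZ mulVf.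
Qed.

Variables (r : nat) (x : 'I_r -> L).
Local Notation KM := {mpoly Krat[r]}.
Local Notation LM := {mpoly L[r]}.
Definition Mincl : {rmorphism KM -> LM} := map_mpoly Kincl.

Lemma mpolyC_integral c : inKbar q theta c -> integralOver Mincl (c%:MP : LM).
Proof.
move=> /inKbar_integral[p mp rp]; exists (map_poly (@mpolyC r Krat) p); first exact: monic_map.
rewrite -map_poly_comp (eq_map_poly (g := @mpolyC r L \o Kincl)); last first.
  move=> u; apply/mpolyP => m; rewrite [LHS]mcoeff_map_mpoly !mcoeffC; case: eqP => _; rewrite ?mulr1 ?mulr0 ?rmorph0 //.
by rewrite map_poly_comp; apply: rmorph_root.
Qed.

Lemma mpoly_integral (P : LM) : (forall m, inKbar q theta P@_m) -> integralOver Mincl P.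
Proof.
move=> hP; rewrite [P]mpolyE; elim/big_rec: _ => [|m Q _ IH]; first exact: integral0.
apply: integral_add => //; rewrite -mul_mpolyC; apply: integral_mul; first exact: mpolyC_integral.
by rewrite -(map_mpolyX Kincl m); apply: integral_id.
Qed.

Lemma clear_denominators (Q : KM) : Q != 0 -> exists2 Q' : LM, Q' != 0 &
  (forall m, exists2 f, overFq f & Q'@_m = f.[theta]) /\
  exists c, Q' = c%:MP * Mincl Q.
Proof.
move=> Q0.
have /ClassicalEpsilon.choice[fg hfg] : forall m, exists fg : {poly L} * {poly L},
    [/\ overFq fg.1, overFq fg.2, fg.2.[theta] != 0 & Kval Q@_m = fg.1.[theta] / fg.2.[theta]].
  by move=> m; case: (Q@_m) => u /= /in_KP[f [g h]]; exists (f, g).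
pose D := \prod_(m <- msupp Q) (fg m).2.
have Dq (s : seq 'X_{1..r}) : overFq (\prod_(m <- s) (fg m).2).
  by elim/big_rec: _ => [|i y _ hy]; [apply: overFq1 | apply: overFqM => //; have [] := hfg i].
have D0 : D.[theta] != 0.
  rewrite /D; elim/big_rec: _ => [|i y _ hy]; first by rewrite hornerC oner_neq0.
  by rewrite hornerM mulf_neq0 //; have [] := hfg i.
exists (D.[theta]%:MP * Mincl Q).
  rewrite mulf_neq0 //; first by rewrite mpolyC_eq0.
  apply: contraNneq Q0 => /mpolyP h; apply/eqP/mpolyP => m; rewrite mcoeff0; apply: val_inj.
  by have := h m; rewrite mcoeff_map_mpoly mcoeff0.
split; last by exists D.[theta].
move=> m; rewrite mcoeffCM mcoeff_map_mpoly.
have [ms|ms] := boolP (m \in msupp Q); last first.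
  by exists 0; [apply: overFq0 | rewrite (memN_msupp_eq0 ms) /= horner0 mulr0].
exists ((fg m).1 * \prod_(m' <- rem m (msupp Q)) (fg m').2).
  by apply: overFqM => //; have [] := hfg m.
have [_ _ g0 /= ->] := hfg m.
rewrite /D (perm_big _ (perm_to_rem ms)) big_cons !hornerM.
by field.
Qed.

(* P is integral over the polynomials with coefficients in K; the lowest nonzero coefficient
   of an integral equation of P vanishes at x together with P. *)
Theorem descent (P : LM) : P != 0 -> (forall m, inKbar q theta P@_m) -> P.@[x] = 0 ->
  exists2 Q : LM, Q != 0 & (forall m, exists2 f, overFq f & Q@_m = f.[theta]) /\ Q.@[x] = 0.
Proof.
move=> P0 /mpoly_integral[p mp rp] Px.
have Minj : injective Mincl.
  move=> Q1 Q2 /mpolyP h; apply/mpolyP => m; apply: (val_inj : injective Kincl).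
  by have := h m; rewrite !mcoeff_map_mpoly.
suff [Q Q0 Qx] : exists2 Q : KM, Q != 0 & (Mincl Q).@[x] = 0.
  have [Q' Q'0 [hQ' [c Q'E]]] := clear_denominators Q0.
  by exists Q' => //; split=> //; rewrite Q'E mevalM Qx mulr0.
have p0 : p != 0 by rewrite monic_neq0.
move: p p0 rp {mp}; apply: poly_ind => [|p c IH]; first by rewrite eqxx.
have hX : map_poly Mincl (p * 'X) = map_poly Mincl p * 'X.
  by rewrite rmorphM; congr (_ * _); exact: map_polyX.
have hD : map_poly Mincl (p * 'X + c%:P) = map_poly Mincl p * 'X + (Mincl c)%:P.
  by rewrite rmorphD; congr (_ + _); [exact: hX | exact: (map_polyC Mincl c)].
have [-> | c0] := eqVneq c 0.
  rewrite polyC0 addr0 => pX0; rewrite hX /root hornerMX.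
  rewrite mulf_eq0 (negPf P0) orbF; apply: IH.
  by apply: contraNneq pX0 => ->; rewrite mul0r.
move=> _; rewrite hD /root hornerD hornerMX hornerC => /eqP h.
exists c => //; have := congr1 (fun Q : LM => Q.@[x]) h.
by rewrite mevalD mevalM Px mulr0 add0r meval0.
Qed.

End Descent.

(** * The polylogarithms of the theorem *)

Section Concrete.
Variable S : setting.
Local Notation L := (sL S).
Local Notation R := (sR S).
Local Notation abs := (@sabs S).
Local Notation p := (sp S).
Local Notation q := (sq S).
Local Notation theta := (stheta S).
Local Notation T := (sabs (stheta S)).
Local Notation overFq := (@polyOverFq (sL S) q).
Local Notation A := {poly L}.
Local Notation tau := (tau S).
Local Notation sg := (map_poly (@frob S)).
Local Notation omega := (@omega S).
Variables (d : nat) (n : 'I_d -> nat) (alpha : 'I_d -> L).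
Hypothesis n_gt0 : forall i, (0 < n i)%N.
Hypothesis n_ndiv : forall i, ~~ ((q - 1) %| n i)%N.
Hypothesis n_pow : forall i j, i != j -> forall k : nat, n i <> (p ^ k * n j)%N.
Hypothesis alphaK : forall i, inK q theta (alpha i).
Hypothesis alpha_neq0 : forall i, alpha i != 0.
Hypothesis alpha_lt : forall i, abs (alpha i) ^+ (q - 1) < T ^+ (n i * q).

Local Notation I := (option {x : 'I_d * 'I_d | (x.1 <= x.2)%N}).
Local Notation r := #|{: I}|.
Local Notation Y := {mpoly A[r]}.

(* [segment l k] lists the data of the indices [l, ..., k - 1]. *)
Definition segment (l k : nat) : seq (nat * L) :=
  [seq (n i, alpha i) | i <- [seq i : 'I_d <- enum 'I_d | (l <= i < k)%N]].

Lemma segment_rcons (l : nat) (k : 'I_d) : (l <= k)%N ->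
  segment l k.+1 = rcons (segment l k) (n k, alpha k).
Proof.
move=> lk; rewrite /segment -map_rcons; congr map; apply: (inj_map val_inj).
have fm k' : [seq val i | i <- [seq i : 'I_d <- enum 'I_d | (l <= i < k')%N]] =
    [seq i <- iota 0 d | (l <= i < k')%N].
  by rewrite -val_enum_ord filter_map.
rewrite map_rcons !fm.
have -> : iota 0 d = iota 0 k ++ (k : nat) :: iota k.+1 (d - k.+1).
  have e : d = (k + (d - k.+1).+1)%N by have := ltn_ord k; lia.
  by rewrite {1}e iotaD.
rewrite !filter_cat /= lk ltnn ltnS leqnn /=.
have -> : [seq i <- iota k.+1 (d - k.+1) | (l <= i < k.+1)%N] = [::].
  by apply/eqP; rewrite -[_ == _]negbK -has_filter; apply/hasPn => i; rewrite mem_iota; lia.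
have -> : [seq i <- iota k.+1 (d - k.+1) | (l <= i < k)%N] = [::].
  by apply/eqP; rewrite -[_ == _]negbK -has_filter; apply/hasPn => i; rewrite mem_iota; lia.
rewrite cats0 cats1; congr rcons; apply: eq_in_filter => i; rewrite mem_iota; lia.
Qed.

Lemma segment_nil k : segment k k = [::].
Proof.
rewrite /segment; have -> : [seq i : 'I_d <- enum 'I_d | (k <= i < k)%N] = [::] => //.
by apply/eqP; rewrite -[_ == _]negbK -has_filter; apply/hasPn => i _; lia.
Qed.

Lemma segment_convergent l k : convergent (segment l k).
Proof. by move=> mz /mapP[i _ ->] /=; apply: alpha_lt. Qed.

Lemma total_weight_rcons s mz : total_weight (rcons s mz) = (@total_weight S s + mz.1)%N.
Proof. by rewrite /total_weight map_rcons sumn_rcons. Qed.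

(* The variables are [pvar l k] (l <= k) for Li_(n_l, ..., n_k), and [pstar] for pi tilde;
   [onpt v0 f] is the function with value [f l k] at [pvar l k] and [v0] at [pstar]. *)
Definition pstar : 'I_r := enum_rank (None : I).
Definition pvar (l k : 'I_d) : 'I_r := enum_rank (insub (l, k) : I).
Definition onpt V (v0 : V) (f : 'I_d -> 'I_d -> V) (i : 'I_r) : V :=
  if omap val (enum_val i : I) is Some (l, k) then f l k else v0.

Lemma onpt_pstar V (v0 : V) f : onpt v0 f pstar = v0.
Proof. by rewrite /onpt /pstar enum_rankK. Qed.

Lemma onptX V (v0 : V) f (l k : 'I_d) : (l <= k)%N -> onpt v0 f (pvar l k) = f l k.
Proof. by move=> lk; rewrite /onpt /pvar enum_rankK /= insubT. Qed.

Variant point_spec : 'I_r -> Prop :=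
| PointStar : point_spec pstar
| PointX (l k : 'I_d) : (l <= k)%N -> point_spec (pvar l k).

Lemma pointP i : point_spec i.
Proof.
rewrite -[i]enum_valK; case: (enum_val i) => [[[l k] lk]|]; last exact: PointStar.
have -> : Some (exist _ (l, k) lk) = insub (l, k) :> I by rewrite insubT; congr Some; apply: val_inj.
exact: PointX.
Qed.

Lemma pvar_inj (l k l' k' : 'I_d) : (l <= k)%N -> (l' <= k')%N -> pvar l k = pvar l' k' -> l = l' /\ k = k'.
Proof.
move=> lk lk' e; have := congr1 (onpt (l, k) (fun l k => (l, k))) e.
by rewrite !onptX // => -[].
Qed.

Lemma pvar_pstar (l k : 'I_d) : (l <= k)%N -> (pvar l k == pstar) = false.
Proof.
move=> lk; apply/eqP => e; have := congr1 (onpt false (fun _ _ => true)) e.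
by rewrite onptX // onpt_pstar.
Qed.

Definition opred (k : 'I_d) : 'I_d := Ordinal (leq_ltn_trans (leq_pred k) (ltn_ord k)).

Definition pweight := onpt 1%N (fun l k => @total_weight S (segment l k.+1)).
Definition pdepth := onpt 0%N (fun l k => (k - l).+1).
Definition pcoef := onpt (0 : L) (fun l k => alpha k).
Definition ppred := onpt None (fun l k => if (l < k)%N then Some (pvar l (opred k)) else None).

Fixpoint pconst_rec (m : nat) (i : 'I_r) : Y :=
  if m is m'.+1 then (pcoef i)%:P%:MP * (if ppred i is Some j then 'X_j - pconst_rec m' j else 1) else 0.
Definition pconst i := pconst_rec (pdepth i) i.

Lemma ppred_depth i j : ppred i = Some j -> pdepth i = (pdepth j).+1.
Proof.
case: (pointP i) => [|l k lk]; first by rewrite /ppred onpt_pstar.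
rewrite /ppred /pdepth !onptX //; case: ifP => // lk1 [<-].
by rewrite onptX /=; lia.
Qed.

Lemma pconstE i : pconst i = (pcoef i)%:P%:MP * (if ppred i is Some j then 'X_j - pconst j else 1).
Proof.
rewrite /pconst; case e : (pdepth i) => [|m] /=.
  case: (pointP i) e => [|l k lk]; last by rewrite /pdepth onptX.
  by rewrite /pcoef onpt_pstar polyC0 mpolyC0 mul0r.
by case e' : (ppred i) => [j|//]; move: e; rewrite (ppred_depth e') => -[->].
Qed.

Lemma pdepth_ind (P : 'I_r -> Prop) :
  (forall i, (forall j, ppred i = Some j -> P j) -> P i) -> forall i, P i.
Proof.
move=> h i; move e : (pdepth i) => m; elim: m i e => [|m IH] i e; apply: h => j hj.
  by move: e; rewrite (ppred_depth hj).
by apply: IH; move: e; rewrite (ppred_depth hj) => -[].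
Qed.

Lemma pconst_pstar : pconst pstar = 0.
Proof. by rewrite pconstE /pcoef onpt_pstar polyC0 mpolyC0 mul0r. Qed.

Lemma pconst_diag k : pconst (pvar k k) = (alpha k)%:P%:MP.
Proof. by rewrite pconstE /pcoef /ppred !onptX // ltnn mulr1. Qed.

Lemma pconst_off (l k : 'I_d) : (l < k)%N ->
  pconst (pvar l k) = (alpha k)%:P%:MP * ('X_(pvar l (opred k)) - pconst (pvar l (opred k))).
Proof. by move=> lk; rewrite pconstE /pcoef /ppred !onptX ?lk // ltnW. Qed.

Lemma pconst_depth i : below pdepth (pdepth i) (pconst i).
Proof.
move: i; apply: pdepth_ind => i IH.
have bC (c : A) : below pdepth 1 (c%:MP : Y).
  by move=> m; rewrite msuppC; case: eqP => // _; rewrite inE => /eqP->; rewrite /depth big1 // => j _; rewrite mnm0E.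
case: (pointP i) IH => [|l k lk] IH; first by rewrite pconst_pstar => m; rewrite msupp0.
rewrite pconstE; case e : (ppred _) => [j|]; last first.
  by rewrite mulr1 => m /bC h; apply: leq_trans h _; rewrite /pdepth onptX.
rewrite (ppred_depth e) -add1n; apply: belowM; first exact: bC.
apply: belowD.
  move=> m; rewrite msuppX inE => /eqP->; rewrite /depth (bigD1 j) //= big1 ?addn0 => [|j' jj].
    by rewrite mnm1E eqxx mul1n.
  by rewrite mnm1E eq_sym (negPf jj).
by rewrite -scaleN1r; apply: belowZ => m /(IH _ e); lia.
Qed.

(* The only variables of [pconst (pvar l k)] are the [pvar l k'] with [k' < k]. *)
Lemma pconst_free i Z :
  onpt true (fun l k => onpt true (fun l' k' => ~~ ((l == l') && (k' < k)%N)) Z) i ->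
  free_of Z (pconst i).
Proof.
move: i; apply: pdepth_ind => i IH; case: (pointP i) IH => [|l k lk] IH hZ.
  by rewrite pconst_pstar -mpolyC0; apply: freeC.
rewrite pconstE; case e : (ppred _) => [j|]; last by rewrite mulr1; apply: freeC.
have jE : (l < k)%N /\ j = pvar l (opred k).
  by move: e; rewrite /ppred onptX //; case: ifP => // lk1 [].
case: jE => lk1 jE; have ljk : (l <= opred k)%N by rewrite /=; lia.
rewrite /free_of rmorphM rmorphB /= taylorC taylorX.
have -> : taylor Z (pconst j) = (pconst j)%:P.
  apply: (IH _ e); move: hZ; rewrite jE !onptX // /onpt.
  case: (omap _ _) => [[l' k']|//]; apply: contra => /andP[-> h] /=.
  by rewrite (leq_trans h) // leq_pred.
have -> : (j == Z) = false.
  apply: contraTF hZ => /eqP<-; rewrite jE !onptX //= eqxx /=.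
  by rewrite prednK //; lia.
by rewrite scale0r addr0 !rmorphM !rmorphB.
Qed.

Lemma pweight_diag k : pweight (pvar k k) = n k.
Proof. by rewrite /pweight onptX // segment_rcons // segment_nil /total_weight /= addn0. Qed.

Lemma pweight_off (l k : 'I_d) : (l < k)%N -> pweight (pvar l k) = (pweight (pvar l (opred k)) + pweight (pvar k k))%N.
Proof.
move=> lk; rewrite pweight_diag /pweight !onptX /= ?(ltnW lk) //; last by lia.
rewrite segment_rcons ?(ltnW lk) // total_weight_rcons /= prednK //; lia.
Qed.

Lemma no_twisted_diag k j (P f : A) : f != 0 ->
  f * sg P = sg f * tau ^+ (pweight (pvar k k) * p ^ j) * (P + alpha k ^+ (p ^ j) *: f) -> False.
Proof.
have p_gt0 : (0 < p ^ j)%N by rewrite expn_gt0 prime_gt0 // sp_prime.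
have [f1 [g1 [hf1 hg1 g10 aE]]] := alphaK k.
have f10 : f1 != 0.
  by apply: contraNneq (alpha_neq0 k) => e; rewrite aE e horner0 mul0r.
have g1n : g1 != 0 by apply: contraNneq g10 => ->; rewrite horner0.
rewrite pweight_diag.
apply: (@no_twisted_solution S (n k * p ^ j) ((size g1).-1 * p ^ j) ((size f1).-1 * p ^ j)).
- by rewrite muln_gt0 n_gt0.
- by rewrite expf_neq0.
- by rewrite absX exprAC mulnAC [T ^+ _]exprM ltrXn2r ?exprn_ge0 ?abs_ge0 ?alpha_lt // -lt0n.
- have T1 := sabs_theta S.
  rewrite absX aE abs_div (abs_overFq hf1 T1 f10) (abs_overFq hg1 T1 g1n) !exprM -exprMn.
  by rewrite divfK // expf_neq0 // gt_eqF // (lt_trans ltr01).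
rewrite -mulnA [(n k * _)%N]mulnC Gauss_dvdr ?n_ndiv //.
rewrite coprime_sym.
have cq : coprime q (q - 1).
  by rewrite subn1 -{1}(prednK (q_gt0 S)) coprimeSn.
rewrite coprimeMl cq andbT; apply: coprimeXl.
by move: cq; rewrite /sq coprime_pexpl // se_gt0.
Qed.

Lemma weights_independent i j k m : i != j -> (n i * p ^ k != n j * p ^ m)%N.
Proof.
move=> ij; apply/eqP => e.
have p_gt0 s : (0 < p ^ s)%N by rewrite expn_gt0 prime_gt0 // sp_prime.
case/orP: (leq_total k m) => h.
  apply: (n_pow ij (k := (m - k)%N)); apply/eqP; rewrite -(eqn_pmul2r (p_gt0 k)) e.
  by rewrite mulnAC -expnD subnK // mulnC.
apply: (n_pow (i := j) (j := i) _ (k := (k - m)%N)); first by rewrite eq_sym.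
apply/eqP; rewrite -(eqn_pmul2r (p_gt0 m)) -e.
by rewrite mulnAC -expnD subnK // mulnC.
Qed.

Definition diags := [seq pvar k k | k <- enum 'I_d].
Definition offs : seq ('I_d * 'I_d) :=
  sort (fun x y : 'I_d * 'I_d => y.2 <= x.2)%N [seq x : 'I_d * 'I_d <- enum {: 'I_d * 'I_d} | (x.1 < x.2)%N].

Lemma mem_diags k : pvar k k \in diags.
Proof. by apply: (map_f (fun k => pvar k k)); rewrite mem_enum. Qed.

Lemma admissible_diags : admissible pweight pconst diags.
Proof.
rewrite /diags; have: uniq (enum 'I_d) by exact: enum_uniq.
elim: (enum 'I_d) => [_|k s IH /= /andP[ks us]]; first exact: admissible_nil.
have mem_diag v : v \in [seq pvar k k | k <- s] -> exists2 k', v = pvar k' k' & k' != k.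
  by case/mapP => k' k's ->; exists k' => //; apply: contraNneq ks => <-.
apply: (admissible_diag (a := alpha k)); first exact: IH.
- apply/negP => /mem_diag[k' e]; have [<- _] := pvar_inj (leqnn _) (leqnn _) e.
  by rewrite eqxx.
- by rewrite pweight_diag.
- exact: pconst_diag.
- by move=> v /mem_diag[k' -> _]; exists (alpha k'); rewrite pconst_diag.
- by move=> v /mem_diag[k' -> k'k] i j; rewrite !pweight_diag weights_independent.
- by move=> j P f; apply: no_twisted_diag.
Qed.

Lemma admissible_offs s : uniq s -> pairwise (fun x y : 'I_d * 'I_d => y.2 <= x.2)%N s ->
  (forall x, x \in s -> (x.1 < x.2)%N) ->
  (forall x y : 'I_d * 'I_d, x \in s -> (y.1 < y.2)%N -> (y.2 < x.2)%N -> y \in s) ->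
  admissible pweight pconst ([seq pvar x.1 x.2 | x <- s] ++ diags).
Proof.
elim: s => [|[l k] s IH] /=; first by move=> *; apply: admissible_diags.
move=> /andP[xs us] /andP[/allP hx hs] hlt hcl.
have lk : (l < k)%N := hlt _ (mem_head _ _).
have hlt' x : x \in s -> (x.1 < x.2)%N by move=> xs'; apply: hlt; rewrite inE xs' orbT.
set V := _ ++ diags.
have memV v : v \in V -> (exists2 x, x \in s & v = pvar x.1 x.2) \/ exists m, v = pvar m m.
  by rewrite mem_cat => /orP[/mapP[x h1 h2]|/mapP[m h1 h2]]; [left; exists x | right; exists m].
have lkp : (l <= opred k)%N by rewrite /=; lia.
apply: (admissible_off (a := alpha k) (Z := pvar l (opred k)) (W := pvar k k)).
- apply: IH => // x y xs' y12 yx; have := hcl x y; rewrite !inE xs' orbT => /(_ isT y12 yx).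
  case/orP => // /eqP e; have := hx x xs'; rewrite e in yx.
  by rewrite leqNgt yx.
- apply/negP => /memV[[x x_s e]|[m e]].
    have [e1 e2] := pvar_inj (ltnW lk) (ltnW (hlt' _ x_s)) e.
    by move: xs; rewrite e1 e2 -surjective_pairing x_s.
  by have [e1 e2] := pvar_inj (ltnW lk) (leqnn _) e; move: lk; rewrite e1 e2 ltnn.
- rewrite mem_cat; have [e|ne] := eqVneq l (opred k).
    by rewrite -e mem_diags orbT.
  have lkp1 : (l < opred k)%N by rewrite ltn_neqAle lkp andbT.
  have kpk : (opred k < k)%N by rewrite /= prednK //; lia.
  have := hcl (l, k) (l, opred k) (mem_head _ _) lkp1 kpk; rewrite inE => /orP[/eqP[e]|h].
    by have := kpk; rewrite e ltnn.
  by rewrite (map_f (fun x => pvar x.1 x.2) h).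
- by rewrite mem_cat mem_diags orbT.
- apply/eqP => e; have [_ e2] := pvar_inj lkp (leqnn _) e.
  by have := congr1 val e2; rewrite /=; lia.
- exact: pconst_off.
- exact: pconst_diag.
- exact: pweight_off.
- by rewrite pweight_diag.
- move=> v /memV[[x x_s ->]|[m ->]]; last by rewrite pconst_diag; split; apply: freeC.
  have := hx x x_s; have := hlt' x x_s; case: x x_s => [l' k'] /= x_s l'k' k'k.
  split; apply: pconst_free; rewrite !onptX ?(ltnW l'k') // negb_and -leqNgt /=.
    case: eqP => [e|//]; apply/orP; right; subst l'.
    have [h|] := ltnP k.-1 k'; last by [].
    suff e : k' = k by move: xs; rewrite -e x_s.
    by apply: val_inj => /=; lia.
  by rewrite k'k orbT.
move=> v; rewrite inE => /orP[/eqP->|/memV[[x x_s ->]|[m ->]]]; last by rewrite pconst_diag; apply: freeC.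
  by apply: pconst_free; rewrite !onptX ?(ltnW lk) // ltnn andbF.
have := hx x x_s; have := hlt' x x_s; case: x x_s => [l' k'] /= x_s l'k' k'k.
by apply: pconst_free; rewrite !onptX ?(ltnW l'k') ?(ltnW lk) // negb_and -leqNgt k'k orbT.
Qed.

Definition pvars := [seq pvar x.1 x.2 | x <- offs] ++ diags.

Lemma mem_offs (x : 'I_d * 'I_d) : (x \in offs) = (x.1 < x.2)%N.
Proof. by rewrite mem_sort mem_filter mem_enum andbT. Qed.

Lemma admissible_pvars : admissible pweight pconst pvars.
Proof.
apply: admissible_offs.
- by rewrite sort_uniq filter_uniq // enum_uniq.
- rewrite -sorted_pairwise; last by move=> y x z h1 h2; apply: leq_trans h2 h1.
  by apply: sort_sorted => x y; apply: leq_total.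
- by move=> x; rewrite mem_offs.
- by move=> x y _; rewrite mem_offs.
Qed.

Lemma mem_pvars i : (i \in pvars) = (i != pstar).
Proof.
rewrite mem_cat; case: (pointP i) => [|l k lk].
  rewrite eqxx; apply/negP => /orP[/mapP[x]|/mapP[k _]].
    by rewrite mem_offs => h /esym/eqP; rewrite pvar_pstar // ltnW.
  by move=> /esym/eqP; rewrite pvar_pstar.
rewrite pvar_pstar //=; move: lk; rewrite leq_eqVlt => /orP[/eqP/val_inj->|lk].
  by rewrite mem_diags orbT.
by rewrite (map_f (fun x => pvar x.1 x.2) (x := (l, k))) // mem_offs.
Qed.

Definition pfun (i : 'I_r) (t : L) : L := onpt (omega t)^-1
  (fun l k => nested_series (segment l k.+1) t / omega t ^+ @total_weight S (segment l k.+1)) i.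
Definition total_pweight := (\sum_i pweight i)%N.
Definition pfun_entire (i : 'I_r) (t : L) : L := onpt 1
  (fun l k => nested_series (segment l k.+1) t) i * omega t ^+ (total_pweight - pweight i).

Lemma pweight_le i : (pweight i <= total_pweight)%N.
Proof. by rewrite /total_pweight (bigD1 i) //= leq_addr. Qed.

Lemma pfun_entireE t i : abs t <= T -> pfun_entire i t = omega t ^+ total_pweight * pfun i t.
Proof.
move=> tT; have o0 := omega_neq0 tT; have := pweight_le i.
rewrite /pfun_entire /pfun /pweight; case: (pointP i) => [|l k lk]; rewrite ?onpt_pstar ?onptX // => h.
  by rewrite mul1r -{2}(subnK h) exprD expr1 mulfK.
rewrite -{2}(subnK h) exprD; have := expf_neq0 (total_weight (segment l k.+1)) o0.
by move: (omega t ^+ _) (omega t ^+ _) (nested_series _ _) => x y z y0; field.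
Qed.

Lemma pfun_entire_analytic i k : exists B : R, analytic (T ^+ k) B (pfun_entire i).
Proof.
have Tk : abs (0 : L) <= T ^+ k by rewrite abs0 exprn_ge0 // ltW // (lt_trans ltr01) // sabs_theta.
have [ho _] := omega_limit S k.
have oge := le_trans (abs_ge0 _) (analytic_bound ho Tk).
have ho' := analyticX (total_pweight - pweight i) oge ho.
have [B hB] : exists B : R, analytic (T ^+ k) B (fun t => onpt 1 (fun l k => nested_series (segment l k.+1) t) i).
  case: (pointP i) => [|l j lj].
    by exists (abs 1); apply: (analytic_ext (f := fun=> 1)) (analytic_cst _ 1) => t _; rewrite onpt_pstar.
  have [[B hB] _] := nested_series_limit k (@segment_convergent l j.+1).
  by exists B; apply: (analytic_ext (f := nested_series (segment l j.+1))) hB => t _; rewrite onptX.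
by eexists; exact: (analyticM hB ho').
Qed.

Lemma omega_twist t : abs t <= T -> frob (omega (frobV t)) = omega t / tau.[t].
Proof. by move=> tT; rewrite [omega t]omegaE mulrAC mulfV ?mul1r // tau_neq0_disc. Qed.

Lemma pfun_twist_of_evaluate t (l k : 'I_d) : abs t <= T -> (l <= k)%N ->
  evaluate pfun t (pconst (pvar l k)) =
    alpha k * frob (nested_series (segment l k) (frobV t)) / omega t ^+ @total_weight S (segment l k) ->
  frob (pfun (pvar l k) (frobV t)) = tau.[t] ^+ pweight (pvar l k) * (pfun (pvar l k) t - evaluate pfun t (pconst (pvar l k))).
Proof.
move=> tT lk ->; rewrite /pweight /pfun !onptX // segment_rcons // total_weight_rcons /=.
have hs : convergent (rcons (segment l k) (n k, alpha k)).
  by rewrite -segment_rcons //; apply: segment_convergent.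
rewrite [Z in tau.[t] ^+ _ * (Z / _ - _)](nested_series_rcons t hs) rmorphM fmorphV rmorphXn /= omega_twist //.
have o0 := omega_neq0 tT; have t0 := tau_neq0_disc tT.
rewrite expr_div_n !exprD; field; rewrite !expf_neq0 //.
Qed.

Lemma evaluate_pconst t (l k : 'I_d) : abs t <= T -> (l <= k)%N ->
  evaluate pfun t (pconst (pvar l k)) =
  alpha k * frob (nested_series (segment l k) (frobV t)) / omega t ^+ @total_weight S (segment l k).
Proof.
move=> tT; move e : (val k) => m; elim: m k e => [|m IH] k e lk.
  have l0 : (l : nat) = 0%N by apply/eqP; rewrite -leqn0.
  have <- : l = k by apply: val_inj; rewrite /= l0 e.
  by rewrite pconst_diag evaluateC hornerC l0 segment_nil nested_series_nil rmorph1 mulr1 expr0 divr1.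
move: lk; rewrite leq_eqVlt => /orP[/eqP lk|lk].
  have <- : l = k by apply: val_inj; rewrite /= lk e.
  by rewrite pconst_diag evaluateC hornerC lk segment_nil nested_series_nil rmorph1 mulr1 expr0 divr1.
have ek : (opred k : nat) = m by rewrite /= e.
have lkp : (l <= opred k)%N by rewrite ek -ltnS.
have IHk := IH _ ek lk; rewrite -ek in IHk; have hF := pfun_twist_of_evaluate tT lkp IHk.
rewrite (pconst_off (l := l) (k := k)) ?e // rmorphM rmorphB /= evaluateC evaluateX hornerC.
have o0 := omega_neq0 tT; have t0 := tau_neq0_disc tT.
apply: (mulfI (expf_neq0 (pweight (pvar l (opred k))) t0)).
rewrite mulrCA -hF /pweight /pfun !onptX // rmorphM fmorphV rmorphXn /= omega_twist // e.
by rewrite expr_div_n; field; rewrite !expf_neq0.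
Qed.

Lemma pfun_twist t i : abs t <= T ->
  frob (pfun i (frobV t)) = tau.[t] ^+ pweight i * (pfun i t - evaluate pfun t (pconst i)).
Proof.
move=> tT; case: (pointP i) => [|l k lk]; last by apply: pfun_twist_of_evaluate => //; apply: evaluate_pconst.
rewrite pconst_pstar rmorph0 subr0 /pweight /pfun !onpt_pstar fmorphV /= omega_twist // invf_div expr1.
by [].
Qed.

Lemma pfun_pstar_neq0 t : abs t <= 1 -> pfun pstar t != 0.
Proof.
move=> t1; rewrite /pfun onpt_pstar invr_eq0; apply: omega_neq0.
exact: le_trans t1 (ltW (sabs_theta S)).
Qed.

Lemma pcoefK i : exists f g : A, [/\ overFq f, overFq g, g != 0 & pcoef i = f.[theta] / g.[theta]].
Proof.
rewrite /pcoef; case: (pointP i) => [|l k lk]; rewrite ?onpt_pstar ?onptX //.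
  exists 0, 1; rewrite horner0 mul0r oner_neq0; split=> //; [exact: overFq0 | exact: overFq1].
have [f [g [hf hg g0 e]]] := alphaK k; exists f, g; split=> //.
by apply: contraNneq g0 => ->; rewrite horner0.
Qed.

Lemma pfun_theta i : pfun i theta = onpt (pitilde abs q theta (sxi S))
  (fun l k => Li abs q theta (segment l k.+1)) i.
Proof.
rewrite /pfun; case: (pointP i) => [|l k lk]; rewrite ?onpt_pstar ?onptX //.
  by rewrite omega_theta invrK.
rewrite (nested_series_theta (@segment_convergent _ _)) mulrAC mulfV ?mul1r //.
by rewrite expf_neq0 // omega_neq0.
Qed.

Theorem polylogs_independent (P : {mpoly L[r]}) : (forall m, inKbar q theta P@_m) ->
  P.@[fun i => pfun i theta] = 0 -> P = 0.
Proof.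
move=> hP P0; have [//|/descent hd] := eqVneq P 0.
have [Q Q0 [hQ Qx]] := hd _ hP P0; case/eqP: Q0.
have wst : pweight pstar = 1%N by rewrite /pweight onpt_pstar.
have bfs i : free_of pstar (pconst i).
  by apply: pconst_free; case: (pointP i) => [|l k lk]; rewrite ?onpt_pstar ?onptX // onpt_pstar.
exact: (independence_of_values pconst_depth admissible_pvars mem_pvars wst pconst_pstar bfs pconstE pweight_le pcoefK
  pfun_pstar_neq0 (fun t i => @pfun_twist t i) pfun_entireE pfun_entire_analytic hQ Qx).
Qed.

End Concrete.

Theorem theorem1p5
  (* the ambient field: any complete, algebraically closed field L of
     characteristic p with an absolute value abs : L -> R (such a field
     contains an isometric copy of C_infty, see NOTES.md) *)
  (R : realType) (p e : nat) (hp : prime p) (he : (0 < e)%N)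
  (L : closedFieldType) (hchar : p \in [pchar L])
  (abs : L -> R)
  (abs_ge0 : forall x, 0 <= abs x)
  (abs_eq0 : forall x, abs x = 0 <-> x = 0)
  (absM : forall x y, abs (x * y) = abs x * abs y)
  (absD : forall x y, abs (x + y) <= Num.max (abs x) (abs y))
  (complete : forall u : nat -> L, cauchy_seq abs u -> exists v, is_lim abs u v)
  (* theta is transcendental over F_q, and |theta| > 1 *)
  (theta : L)
  (htheta : forall P : {poly L}, polyOverFq (p ^ e) P -> P != 0 -> P.[theta] != 0)
  (habstheta : 1 < abs theta)
  (* a fixed (q-1)-st root of -theta *)
  (xi : L) (hxi : xi ^+ (p ^ e - 1) = - theta)
  (d : nat) (hd : (0 < d)%N)
  (n : 'I_d -> nat) (hnpos : forall i, (0 < n i)%N)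
  (hninj : injective n)
  (hndiv : forall i, ~~ ((p ^ e - 1) %| n i)%N)
  (hnpow : forall i j, i != j -> forall k : nat, n i <> (p ^ k * n j)%N)
  (alpha : 'I_d -> L)
  (halphaK : forall i, inK (p ^ e) theta (alpha i))
  (halpha0 : forall i, alpha i != 0)
  (halphaabs : forall i,
     abs (alpha i) ^+ (p ^ e - 1) < abs theta ^+ (n i * p ^ e)) :
  let q := (p ^ e)%N in
  let f : option {x : 'I_d * 'I_d | (x.1 <= x.2)%N} -> L := fun o =>
    match o with
    | None => pitilde abs q theta xi
    | Some x => Li abs q theta
        (map (fun i : 'I_d => (n i, alpha i))
           [seq i : 'I_d <- enum 'I_d | ((val x).1 <= i <= (val x).2)%N])
    end in
  injective f /\ alg_indep_Kbar q theta f.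
Proof.
move=> q f.
pose S := Setting hp he hchar abs_ge0 abs_eq0 absM absD complete habstheta hxi.
have fE j : f (enum_val j) = @pfun S d n alpha j (stheta S).
  by rewrite (@pfun_theta S d n alpha halphaabs) /f /onpt; case: (enum_val j) => [[[l k] lk]|].
have ind : alg_indep_Kbar q theta f.
  move=> P hP P0.
  apply: (@polylogs_independent S d n alpha) => //.
  by rewrite -[RHS]P0; apply: meval_eq => j; exact: esym (fE j).
split=> // x y fxy; apply/eqP/negPn/negP => xy.
pose P : {mpoly L[#|{: option {x : 'I_d * 'I_d | (x.1 <= x.2)%N}}|]} := 'X_(enum_rank x) - 'X_(enum_rank y).
have P0 : P = 0.
  apply: ind => [m|]; last by rewrite mevalB !mevalXU !enum_rankK fxy subrr.
  apply: (@inK_inKbar S); rewrite mcoeffB !mcoeffX; apply: inKB; exact: (@inK_bool S).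
have := congr1 (mcoeff U_(enum_rank x)) P0.
rewrite mcoeffB !mcoeffX eqxx mcoeff0 eq_mnm1 (inj_eq enum_rank_inj) eq_sym (negPf xy) subr0.
by move/eqP; rewrite oner_eq0.
Qed.
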